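(* Let $\boldsymbol q=(q_0,\dots,q_N)$ and $\boldsymbol d=(d_1,\dots,d_r)$ be any sequences of positive integers satisfying $Q:=q_0+\dots+q_N=d_1+\dots+d_r$. Then the monodromy group of the hypergeometric differential equation $$\left[\prod_{\nu=0}^N\prod_{a=0}^{q_\nu-1}(q_\nu\theta_t-a)-t\prod_{k=1}^r\prod_{b=1}^{d_k}(d_k\theta_t+b)\right]I=0,\qquad \theta_t=t\frac{\partial}{\partial t},$$ is conjugate (in $GL(Q,\mathbb C)$, after choosing a basis of the $Q$-dimensional space of local solutions) to the hypergeometric group $H_{\boldsymbol q,\boldsymbol d}$.
   Context: The equation has regular singularities at $t=0$, $t=\infty$ and $t=\lambda:=\prod_{\nu=0}^N q_\nu^{q_\nu}\big/\prod_{k=1}^r d_k^{d_k}$. Its monodromy group is the group of linear automorphisms of the $Q$-dimensional space of solutions near a base point obtained by analytic continuation along loops in $\mathbb P^1\setminus\{0,\lambda,\infty\}$. Define integers $A_i,B_i$ ($1\le i\le Q$) by $$\prod_{k=1}^r(T^{d_k}-1)=T^Q+A_1T^{Q-1}+\dots+A_Q,\qquad \prod_{\nu=0}^N(T^{q_\nu}-1)=T^Q+B_1T^{Q-1}+\dots+B_Q.$$ The hypergeometric group $H_{\boldsymbol q,\boldsymbol d}$ is the subgroup of $GL(Q,\mathbb Z)$ generated by $$h_\infty=\begin{pmatrix}0&0&\cdots&0&-A_Q\\1&0&\cdots&0&-A_{Q-1}\\0&1&\cdots&0&-A_{Q-2}\\\vdots&\vdots&\ddots&\vdots&\vdots\\0&0&\cdots&1&-A_1\end{pmatrix},\qquad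 h_0^{-1}=\begin{pmatrix}0&0&\cdots&0&-B_Q\\1&0&\cdots&0&-B_{Q-1}\\0&1&\cdots&0&-B_{Q-2}\\\vdots&\vdots&\ddots&\vdots&\vdots\\0&0&\cdots&1&-B_1\end{pmatrix}.$$ *)

(* Defs.v *)
From HB Require Import structures.
From mathcomp Require Import all_boot all_order all_algebra.
From mathcomp Require Import complex.
From mathcomp Require Import all_classical all_reals all_analysis.

Set Implicit Arguments.
Unset Strict Implicit.
Unset Printing Implicit Defensive.

Import Order.TTheory GRing.Theory Num.Theory.
Import numFieldNormedType.Exports.

Local Open Scope classical_set_scope.
Local Open Scope complex_scope.
Local Open Scope ring_scope.

(* [R[i]] is canonically an [R]-algebra; packed as a [numClosedFieldType] it gets
   the topology of its modulus and is a normed module over itself, so that [derive1] on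
   functions [complexField R -> complexField R] is the complex derivative. *)
Definition complexField (R : realType) : numClosedFieldType := R[i].
Arguments complexField : simpl never.

Section ComplexAnalysis.
Variable R : realType.
Local Notation C := (complexField R).

Implicit Types (f g : C -> C) (z b lambda : C) (gamma : R -> C).

Definition analytic_at f z : Prop :=
  exists a : nat -> C, \forall w \near z,
    series (fun n => a n * (w - z) ^+ n) @ \oo --> f w.

(* [F s] represents the germ at [gamma s] of the continued function;
   only the germ of [F s] at [gamma s] is meaningful. *)
Definition continues_along gamma f g : Prop :=
  exists F : R -> C -> C,
    [/\ forall s : R, s \in `[0, 1] -> analytic_at (F s) (gamma s),
        forall s : R, s \in `[0, 1] ->
          \forall s' \near within `[0, 1] (nbhs s),
            \forall z \near gamma s', F s' z = F s z,
        \forall z \near gamma 0, F 0 z = f z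
      & \forall z \near gamma 1, F 1 z = g z].

Definition loop_avoiding (S : set C) b gamma : Prop :=
  [/\ {within `[0, 1], continuous gamma},
      gamma 0 = b, gamma 1 = b
    & forall s : R, s \in `[0, 1] -> ~ S (gamma s)].

(* [L] is a differential operator acting on functions. *)
Definition local_solution (L : (C -> C) -> C -> C) b f : Prop :=
  analytic_at f b /\ \forall z \near b, L f z = 0.

(* Local solutions are identified when they coincide near [b]. *)
Definition solution_basis (L : (C -> C) -> C -> C) b n (e : 'I_n -> C -> C) :=
  [/\ forall i, local_solution L b (e i),
      forall c : 'I_n -> C,
        (\forall z \near b, \sum_i c i * e i z = 0) -> forall i, c i = 0
    & forall f, local_solution L b f ->
        exists c : 'I_n -> C, \forall z \near b, f z = \sum_i c i * e i z].

(* Matrices act on columns: column [i] of [M] holds the coordinates, in the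
   basis [e] of local solutions at [b], of the continuation of [e i]. *)
Definition monodromy_group (S : set C) b n (e : 'I_n -> C -> C) :
    set 'M[C]_n :=
  [set M | exists2 gamma, loop_avoiding S b gamma &
     forall i, continues_along gamma (e i) (fun z => \sum_j M j i * e j z)].

Definition theta f : C -> C := fun t => t * derive1 f t.

Definition theta_affine (c a : C) f : C -> C := fun t => c * theta f t + a * f t.

Definition op_comp (A B : (C -> C) -> C -> C) : (C -> C) -> C -> C := A \o B.

Definition hypergeometric_op N r (q : 'I_N.+1 -> nat) (d : 'I_r -> nat) :
    (C -> C) -> C -> C :=
  fun f t =>
    (\big[op_comp/id]_(nu < N.+1) \big[op_comp/id]_(a < q nu)
       theta_affine (q nu)%:R (- a%:R)) f t
    - t * (\big[op_comp/id]_(k < r) \big[op_comp/id]_(1 <= b < (d k).+1)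
       theta_affine (d k)%:R b%:R) f t.

Definition hypergeometric_lambda N r (q : 'I_N.+1 -> nat) (d : 'I_r -> nat) : C :=
  (\prod_(nu < N.+1) (q nu)%:R ^+ q nu) / (\prod_(k < r) (d k)%:R ^+ d k).

End ComplexAnalysis.

(* If [p] = T^n + A_1 T^(n-1) + ... + A_n, then [p`_i] = A_(n-i). This is the
   transpose of [mxpoly.companionmx]. *)
Definition last_column_companion (n : nat) (p : {poly int}) : 'M[int]_n :=
  \matrix_(i < n, j < n)
    if (j == n.-1 :> nat) then - p`_i else (i == j.+1 :> nat)%:R.

Inductive generated_by n (S : set 'M[int]_n) : 'M[int]_n -> Prop :=
| generated_incl A : S A -> generated_by S A
| generated_one : generated_by S 1%:M
| generated_mul A B :
    generated_by S A -> generated_by S B -> generated_by S (A *m B)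
| generated_inv A : generated_by S A -> generated_by S (invmx A).

(* For positive [q nu] and [d k] both polynomials have constant term 1 or -1, so
   the generators h_infinity and h_0^-1 have determinant 1 or -1 and [invmx] is
   the genuine inverse. *)
Definition hypergeometric_group N r (q : 'I_N.+1 -> nat) (d : 'I_r -> nat)
    (n : nat) : set 'M[int]_n :=
  generated_by
    [set last_column_companion n (\prod_(k < r) ('X^(d k) - 1));
         last_column_companion n (\prod_(nu < N.+1) ('X^(q nu) - 1))].
Arguments hypergeometric_group {N r} q d n.

(* Main.v *)
(* Let p and r be the monic indicial polynomials at 0 and infinity, with roots the exponents
   a/q_nu in [0, 1) and -b/d_k in [-1, 0), and let D be the difference of their companion
   matrices, which has rank one.  On jets y = (f, theta f, ..., theta^(Q-1) f) the equation is
   the Fuchsian system theta y = (M + t / (t - lambda) D) y with M the companion matrix of p.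
   The complement of {0, lambda, infinity} is covered by five convex charts carrying
   fundamental matrices; all of them glue trivially with the upper half plane, so the monodromy
   is generated by the gluing matrices a and b of the lower half plane through ]0, lambda[ and
   ]lambda, oo[.  Frobenius solutions at 0 and at infinity show that a and b are annihilated by
   prod (X^q_nu - 1) and prod (X^d_k - 1).  The solutions holomorphic at lambda form a
   hyperplane on which a = b, and it contains no eigenvector of a: the power series of such an
   eigenvector at 0 has positive coefficients of size about lambda^-n n^-(Q-1) / n, so its last
   jet component is unbounded at lambda.  Hence a covector vanishing on that hyperplane is
   cyclic, and a common cyclic basis brings a and b to companion form (Levelt's argument). *)
Require Import Defs.
From HB Require Import structures.
From mathcomp Require Import all_boot all_order all_algebra.
From mathcomp Require Import complex.
From mathcomp Require Import all_classical all_reals all_analysis.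
From mathcomp Require Import ring lra zify.
Import Order.TTheory GRing.Theory Num.Theory.
Import numFieldNormedType.Exports.
Set Implicit Arguments.
Unset Strict Implicit.
Unset Printing Implicit Defensive.
Local Open Scope classical_set_scope.
Local Open Scope complex_scope.
Local Open Scope ring_scope.

(** * Modulus, power series and complex derivatives *)

Section Modulus.
Variable R : realType.
Local Notation C := (complexField R).
Implicit Types (x y z w : C) (e r : R).

(** The usual form of Levelt's argument rests on [a] and [b] having no common eigenvalue. Here 1 is
    always one, since 0 is an exponent at the origin and -1 an exponent at infinity; cyclicity must
    therefore come from analysis, namely from the sign of the Frobenius coefficients. It is enough
    to exclude eigenvectors of [a]: a nonzero [a]-stable subspace of the hyperplane would contain
    one. The normalization of the exponents serves twice. In a half-open interval of length 1 no two
    of them differ by a nonzero integer, whatever their multiplicities, so Frobenius solutions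
    [H(t) t^M] exist without case distinctions; and the signs make the ratio [r(X) / p(X + 1)] of
    consecutive coefficients positive. In the coordinate [x = log t] a multivalued solution becomes
    a function and a turn around 0 a translation by [2 pi i], so no branch of a logarithm is ever
    chosen. All comparisons of solutions reduce to uniqueness along a segment, which is why the
    charts are convex. *)

Definition cRe (z : C) : R := complex.Re z.
Definition cIm (z : C) : R := complex.Im z.
Definition toC (x : R) : C := x%:C.
(** The norm of a [numClosedFieldType] has its values in the field itself; estimates are carried out
    on this real version. *)
Definition cmod (z : C) : R := cRe `|z|.

Lemma cmodE z : `|z| = toC (cmod z).
Proof. by rewrite /cmod /toC /cRe; case: z => a b; rewrite normc_def. Qed.

Lemma cmod_def z : cmod z = Num.sqrt (cRe z ^+ 2 + cIm z ^+ 2).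
Proof. by rewrite /cmod normc_def. Qed.

Lemma toC_inj : injective toC. Proof. by move=> x y []. Qed.

Lemma toCD (a b : R) : toC (a + b) = toC a + toC b.
Proof. by rewrite /toC rmorphD. Qed.
Lemma toCM (a b : R) : toC (a * b) = toC a * toC b.
Proof. by rewrite /toC rmorphM. Qed.
Lemma toCN (a : R) : toC (- a) = - toC a.
Proof. by rewrite /toC rmorphN. Qed.
Lemma toCB (a b : R) : toC (a - b) = toC a - toC b.
Proof. by rewrite /toC rmorphB. Qed.
Lemma toC0 : toC 0 = 0. Proof. by []. Qed.
Lemma toC1 : toC 1 = 1. Proof. by []. Qed.
Lemma toCX (a : R) n : toC (a ^+ n) = toC a ^+ n.
Proof. by rewrite /toC rmorphXn. Qed.
Lemma toCV (a : R) : toC a^-1 = (toC a)^-1.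
Proof. by rewrite /toC (fmorphV (real_complex R)). Qed.
Lemma toC_nat n : toC n%:R = n%:R.
Proof. by rewrite /toC rmorph_nat. Qed.
Lemma toC_eq0 (a : R) : (toC a == 0) = (a == 0).
Proof. by rewrite -toC0 (inj_eq toC_inj). Qed.

Lemma cIm_toC (a : R) : cIm (toC a) = 0. Proof. by []. Qed.
Lemma cReD x y : cRe (x + y) = cRe x + cRe y. Proof. by case: x y => ? ? []. Qed.
Lemma cImD x y : cIm (x + y) = cIm x + cIm y. Proof. by case: x y => ? ? []. Qed.
Lemma cReN x : cRe (- x) = - cRe x. Proof. by case: x. Qed.
Lemma cImN x : cIm (- x) = - cIm x. Proof. by case: x. Qed.
Lemma cReB x y : cRe (x - y) = cRe x - cRe y. Proof. by rewrite cReD cReN. Qed.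
Lemma cImB x y : cIm (x - y) = cIm x - cIm y. Proof. by rewrite cImD cImN. Qed.
Lemma cReM x y : cRe (x * y) = cRe x * cRe y - cIm x * cIm y.
Proof. by case: x y => ? ? []. Qed.
Lemma cImM x y : cIm (x * y) = cRe x * cIm y + cIm x * cRe y.
Proof. by case: x y => ? ? []. Qed.
Lemma cRe0 : cRe 0 = 0. Proof. by []. Qed.
Lemma cIm0 : cIm 0 = 0. Proof. by []. Qed.
Lemma cRe_sum (I : Type) (s : seq I) (P : pred I) (F : I -> C) :
  cRe (\sum_(i <- s | P i) F i) = \sum_(i <- s | P i) cRe (F i).
Proof. by apply: (big_morph cRe); [exact: cReD|exact: cRe0]. Qed.
Lemma cIm_sum (I : Type) (s : seq I) (P : pred I) (F : I -> C) :
  cIm (\sum_(i <- s | P i) F i) = \sum_(i <- s | P i) cIm (F i).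
Proof. by apply: (big_morph cIm); [exact: cImD|exact: cIm0]. Qed.
Lemma complex_eqP x y : cRe x = cRe y -> cIm x = cIm y -> x = y.
Proof. by case: x y => a b [c d] /= -> ->. Qed.

Lemma cmod_ge0 z : 0 <= cmod z.
Proof. by rewrite cmod_def sqrtr_ge0. Qed.
Lemma cmod_toC (a : R) : cmod (toC a) = `|a|.
Proof. by rewrite cmod_def /= expr0n addr0 sqrtr_sqr. Qed.
Lemma cmod0 : cmod 0 = 0. Proof. by rewrite -toC0 cmod_toC normr0. Qed.
Lemma cmod1 : cmod 1 = 1. Proof. by rewrite -toC1 cmod_toC normr1. Qed.
Lemma cmodM x y : cmod (x * y) = cmod x * cmod y.
Proof. by apply: toC_inj; rewrite toCM -!cmodE normrM. Qed.
Lemma cmodN x : cmod (- x) = cmod x.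
Proof. by rewrite /cmod normrN. Qed.
Lemma cmod_dist x y : cmod (x - y) = cmod (y - x).
Proof. by rewrite /cmod distrC. Qed.
Lemma cmodX x n : cmod (x ^+ n) = cmod x ^+ n.
Proof. by apply: toC_inj; rewrite toCX -!cmodE normrX. Qed.
Lemma cmodV x : cmod x^-1 = (cmod x)^-1.
Proof. by apply: toC_inj; rewrite toCV -!cmodE normfV. Qed.
Lemma cmod_eq0 x : (cmod x == 0) = (x == 0).
Proof. by rewrite -toC_eq0 -cmodE normr_eq0. Qed.
Lemma cmod_gt0 x : (0 < cmod x) = (x != 0).
Proof. by rewrite lt_neqAle cmod_ge0 andbT eq_sym cmod_eq0. Qed.
Lemma cmod_nat n : cmod (n%:R) = n%:R.
Proof. by rewrite -toC_nat cmod_toC normr_nat. Qed.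
Lemma toC_le (a b : R) : (toC a <= toC b) = (a <= b).
Proof. exact: lecR. Qed.
Lemma toC_lt (a b : R) : (toC a < toC b) = (a < b).
Proof. exact: ltcR. Qed.
Lemma cmodD x y : cmod (x + y) <= cmod x + cmod y.
Proof. by rewrite -toC_le toCD -!cmodE ler_normD. Qed.
Lemma cmodB x y : cmod (x - y) <= cmod x + cmod y.
Proof. by rewrite -(cmodN y) cmodD. Qed.
Lemma cmod_sum (I : Type) (s : seq I) (P : pred I) (F : I -> C) :
  cmod (\sum_(i <- s | P i) F i) <= \sum_(i <- s | P i) cmod (F i).
Proof.
elim/big_ind2: _ => // [|a b c d ab cd]; first by rewrite cmod0.
by rewrite (le_trans (cmodD _ _))// lerD.
Qed.
Lemma cRe_le x : `|cRe x| <= cmod x.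
Proof. by rewrite cmod_def -sqrtr_sqr ler_wsqrtr// lerDl sqr_ge0. Qed.
Lemma cIm_le x : `|cIm x| <= cmod x.
Proof. by rewrite cmod_def -sqrtr_sqr ler_wsqrtr// lerDr sqr_ge0. Qed.
Lemma cmod_le x : cmod x <= `|cRe x| + `|cIm x|.
Proof.
rewrite cmod_def -(@ler_sqr _ _ _) ?nnegrE ?sqrtr_ge0 ?addr_ge0//.
rewrite sqr_sqrtr ?addr_ge0 ?sqr_ge0// sqrrD !real_normK ?num_real//.
by rewrite -addrA lerD2l lerDr mulrn_wge0// mulr_ge0.
Qed.
Lemma cmod_sqr x : cmod x ^+ 2 = cRe x ^+ 2 + cIm x ^+ 2.
Proof. by rewrite cmod_def sqr_sqrtr// addr_ge0 ?sqr_ge0. Qed.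

(** The left side is the real part of [x] times the conjugate [y'] of [y]. *)
Lemma cdot_le x y : cRe x * cRe y + cIm x * cIm y <= cmod x * cmod y.
Proof.
pose y' : C := cRe y +i* (- cIm y).
have -> : cmod y = cmod y' by rewrite !cmod_def /= sqrrN.
rewrite -cmodM; apply: le_trans (le_trans (ler_norm _) (cRe_le _)).
by rewrite cReM /= mulrN opprK.
Qed.

Definition cexists_nbhs (c : C) (P : C -> Prop) :=
  exists2 e : R, 0 < e & forall z, cmod (z - c) < e -> P z.

(** A positive element of [C] has imaginary part 0, so the balls that define the topology of [C]
    have real radii. *)
Lemma nearP_cmod (c : C) (P : C -> Prop) :
  (\forall z \near c, P z) <-> cexists_nbhs c P.
Proof.
have ltE (x y : C) : (x < y) = (cIm y == cIm x) && (cRe x < cRe y) := ltcE x y.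
split.
- move=> /nbhs_ballP[e e0 H]; have := e0; rewrite /= ltE => /andP[/eqP e1 e2].
  exists (cRe e) => // z zc; apply: H; rewrite -ball_normE /= distrC cmodE.
  by rewrite ltE cIm_toC e1 eqxx.
- move=> [e e0 H]; apply/nbhs_ballP; exists (toC e); first by rewrite /= -toC0 toC_lt.
  by move=> z; rewrite -ball_normE /= distrC cmodE toC_lt => /H.
Qed.

End Modulus.

(** * Complex series with geometric majorants *)

Section Series.
Variable R : realType.
Local Notation C := (complexField R).
Implicit Types (u v a b : nat -> C) (x y z w l : C) (r e K : R).

Lemma halfR_gt0 e : 0 < e -> 0 < e / 2. Proof. by move=> e0; lra. Qed.

Definition is_csum u l :=
  forall e, 0 < e -> exists N, forall n, (N <= n)%N -> cmod (\sum_(i < n) u i - l) < e.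

(** Total, with value 0 for a divergent series, so that power series are functions on all of [C]
    before anything is known about convergence. *)
Definition csum u : C := xget 0 [set l | is_csum u l].

Lemma is_csum_uniq u l l' : is_csum u l -> is_csum u l' -> l = l'.
Proof.
move=> h h'; apply/eqP; rewrite -subr_eq0 -cmod_eq0 eq_le cmod_ge0 andbT.
apply/ler_addgt0Pr => e e0; rewrite add0r.
have [N hN] := h _ (halfR_gt0 e0).
have [M hM] := h' _ (halfR_gt0 e0).
have {}hN := hN (maxn N M) (leq_maxl _ _); have {}hM := hM (maxn N M) (leq_maxr _ _).
set S := \sum_(i < _) _ in hN hM.
rewrite (_ : l - l' = (S - l') - (S - l)); last by ring.
by apply: (le_trans (cmodB _ _)); lra.
Qed.

Lemma is_csum_csum u l : is_csum u l -> csum u = l.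
Proof.
move=> h; apply: (@is_csum_uniq u) => //.
exact: (@xgetPex _ 0 [set l | is_csum u l] (ex_intro _ l h)).
Qed.

Lemma is_csumD u v l l' : is_csum u l -> is_csum v l' -> is_csum (fun n => u n + v n) (l + l').
Proof.
move=> h h' e e0; have [N hN] := h _ (halfR_gt0 e0).
have [M hM] := h' _ (halfR_gt0 e0).
exists (maxn N M) => n; rewrite geq_max => /andP[/hN {}hN /hM {}hM].
rewrite big_split /= opprD addrACA; apply: (le_lt_trans (cmodD _ _)); lra.
Qed.

Lemma is_csumZ u l (k : C) : is_csum u l -> is_csum (fun n => k * u n) (k * l).
Proof.
move=> h e e0; have k0 : 0 < cmod k + 1 by have := cmod_ge0 k; lra.
have [N hN] := h _ (divr_gt0 e0 k0); exists N => n /hN {}hN.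
rewrite -mulr_sumr -mulrBr cmodM; move: hN; rewrite ltr_pdivlMr// mulrC.
by apply: le_lt_trans; rewrite ler_wpM2r ?cmod_ge0// lerDl.
Qed.

Lemma is_csum0S u l : is_csum (fun n => u n.+1) l -> is_csum u (u 0%N + l).
Proof.
move=> h e e0; have [N hN] := h _ e0; exists N.+1 => -[//|n] Nn.
rewrite big_ord_recl /= (_ : u 0%N + _ - _ = \sum_(i < n) u i.+1 - l); last by ring.
exact: hN.
Qed.

Lemma eq_is_csum u v l : u =1 v -> is_csum u l -> is_csum v l.
Proof. by move=> /funext ->. Qed.

Lemma sum_geo_le (K r : R) n m : 0 <= K -> 0 <= r < 1 ->
  \sum_(n <= i < m) K * r ^+ i <= K * r ^+ n / (1 - r).
Proof.
move=> K0 /andP[r0 r1]; have r1' : 0 < 1 - r by lra.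
have [nm|mn] := leqP n m; last first.
  rewrite big_geq; last exact: ltnW.
  by apply: divr_ge0; [rewrite mulr_ge0 ?exprn_ge0|exact: ltW].
rewrite ler_pdivlMr//; apply: (@le_trans _ _ (K * r ^+ n - K * r ^+ m)).
  rewrite -mulr_sumr -mulrA -mulrBr ler_wpM2l// mulr_suml.
  rewrite -[leRHS]opprB -(@telescope_sumr _ n m (fun i => r ^+ i))// -sumrN.
  by apply: ler_sum => i _; rewrite exprS; lra.
by rewrite gerBl mulr_ge0 ?exprn_ge0.
Qed.

Lemma real_geo_cvg (v : nat -> R) (K r : R) : 0 <= r < 1 ->
  (forall n, `|v n| <= K * r ^+ n) ->
  exists l : R, forall e, 0 < e -> exists N, forall n, (N <= n)%N -> `|\sum_(i < n) v i - l| < e.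
Proof.
move=> r01 h.
have K0 : 0 <= K by have := h 0%N; rewrite expr0 mulr1; apply: le_trans.
have cv : cvgn (series v).
  apply: normed_cvg; apply: (@series_le_cvg _ _ (geometric K r)) => [n|n|n|].
  - exact: normr_ge0.
  - by apply: mulr_ge0 => //; apply: exprn_ge0; case/andP: r01.
  - exact: h.
  - by apply: is_cvg_geometric_series; case/andP: r01 => a b; rewrite ger0_norm.
exists (limn (series v)) => e e0.
have /cvgrPdist_lt/(_ _ e0)[N _ hN] := cv.
exists N => n /hN /=; rewrite distrC seriesEord.
by [].
Qed.

Lemma geo_is_csum u (K r : R) : 0 <= r < 1 -> (forall n, cmod (u n) <= K * r ^+ n) ->
  is_csum u (csum u).
Proof.
move=> r01 h.
have [lr hr] := @real_geo_cvg (fun n => cRe (u n)) K r r01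
  (fun n => le_trans (cRe_le _) (h n)).
have [li hi] := @real_geo_cvg (fun n => cIm (u n)) K r r01
  (fun n => le_trans (cIm_le _) (h n)).
have H : is_csum u (lr +i* li).
  move=> e e0; have [N hN] := hr _ (halfR_gt0 e0).
  have [M hM] := hi _ (halfR_gt0 e0).
  exists (maxn N M) => n; rewrite geq_max => /andP[/hN {}hN /hM {}hM].
  apply: (le_lt_trans (cmod_le _)).
  by rewrite cReB cImB cRe_sum cIm_sum; move: hN hM; rewrite /=; lra.
by rewrite (is_csum_csum H).
Qed.

Lemma is_csum_bound u l (B : R) n :
  (forall m, (n <= m)%N -> \sum_(n <= i < m) cmod (u i) <= B) ->
  is_csum u l -> cmod (l - \sum_(i < n) u i) <= B.
Proof.
move=> hB h; apply/ler_addgt0Pr => e e0.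
have [N hN] := h _ e0; have {}hN := hN (maxn N n) (leq_maxl _ _).
set m := maxn N n in hN; have nm : (n <= m)%N := leq_maxr _ _.
have := hB _ nm; have := cmod_sum (index_iota n m) xpredT u.
have -> : \sum_(n <= i < m) u i = \sum_(i < m) u i - \sum_(i < n) u i.
  rewrite -!(big_mkord xpredT u) [\sum_(0 <= i < m) _](@big_cat_nat _ _ _ n)//=.
  by rewrite addrAC subrr add0r.
set S := \sum_(i < m) _ in hN *; set T := \sum_(i < n) _ => h1 h2.
rewrite (_ : l - T = (S - T) - (S - l)); last by ring.
by apply: (le_trans (cmodB _ _)); lra.
Qed.

Lemma geo_tail u (K r : R) n : 0 <= r < 1 -> (forall n, cmod (u n) <= K * r ^+ n) ->
  cmod (csum u - \sum_(i < n) u i) <= K * r ^+ n / (1 - r).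
Proof.
move=> r01 h; apply: is_csum_bound (geo_is_csum r01 h) => m _.
have K0 : 0 <= K by have := h 0%N; rewrite expr0 mulr1; apply: le_trans; exact: cmod_ge0.
by apply: le_trans (sum_geo_le n m K0 r01); apply: ler_sum => i _; exact: h.
Qed.

End Series.

(** * Power series, their tails and their zeros *)

Section PowerSeries.
Variable R : realType.
Local Notation C := (complexField R).
Implicit Types (u v a b : nat -> C) (x y z w h : C) (r e K : R).

Definition psterm a z : nat -> C := fun n => a n * z ^+ n.
Definition PS a z : C := csum (psterm a z).

(** Abel's condition: the terms are bounded at radius [r]. It gives geometric convergence in the
    open disc and says nothing about the circle. *)
Definition pscvg a r := 0 < r /\ exists K, forall n, cmod (a n) * r ^+ n <= K.

Lemma pscvg_bound a r : pscvg a r ->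
  exists2 K, 0 < K & forall z n, cmod (psterm a z n) <= K * (cmod z / r) ^+ n.
Proof.
move=> [r0 [K hK]]; have K0 : 0 <= K by apply: le_trans (hK 0%N); rewrite mulr1 cmod_ge0.
exists (K + 1); first by lra.
move=> z n; rewrite /psterm cmodM cmodX expr_div_n mulrA ler_pdivlMr ?exprn_gt0//.
rewrite mulrAC ler_wpM2r ?exprn_ge0 ?cmod_ge0//; have := hK n; lra.
Qed.

Lemma ratio01 r z : 0 < r -> cmod z < r -> 0 <= cmod z / r < 1.
Proof. by move=> r0 zr; rewrite divr_ge0 ?cmod_ge0 ?ltW//= ltr_pdivrMr ?mul1r. Qed.

Lemma PS_is_csum a r z : pscvg a r -> cmod z < r -> is_csum (psterm a z) (PS a z).
Proof.
move=> ar zr; have [K K0 hK] := pscvg_bound ar; have [r0 _] := ar.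
exact: geo_is_csum (ratio01 r0 zr) (hK z).
Qed.

Lemma pscvg_le a r r' : 0 < r' -> r' <= r -> pscvg a r -> pscvg a r'.
Proof.
move=> r0 rr [_ [K hK]]; split => //; exists K => n; apply: le_trans (hK n).
by rewrite ler_wpM2l ?cmod_ge0//; apply: lerXn2r => //; rewrite nnegrE; lra.
Qed.

Lemma PS_tail a r n : pscvg a r -> exists2 K, 0 < K & forall z, cmod z <= r / 2 ->
  cmod (PS a z - \sum_(i < n) psterm a z i) <= K * cmod z ^+ n.
Proof.
move=> ar; have [K K0 hK] := pscvg_bound ar; have [r0 _] := ar.
(* The factor 2 bounds [1 / (1 - |z| / r)] when [|z| <= r / 2]. *)
exists (K * r ^- n * 2); first by rewrite !mulr_gt0 ?invr_gt0 ?exprn_gt0.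
move=> z zr; have r01 : 0 <= cmod z / r < 1 by apply: ratio01 => //; lra.
have z2 : cmod z / r <= 1 / 2 by rewrite ler_pdivrMr//; lra.
apply: (le_trans (geo_tail n r01 (hK z))).
rewrite expr_div_n; set X := r ^- n; set Y := cmod z ^+ n.
rewrite (_ : K * X * 2 * Y = K * (Y * X) * 2); last by ring.
rewrite ler_wpM2l//; last by rewrite -div1r ler_pdivrMr; lra.
by rewrite mulr_ge0 ?(ltW K0)// mulr_ge0 ?invr_ge0 ?exprn_ge0 ?cmod_ge0 ?(ltW r0).
Qed.

Lemma PSD a b r z : pscvg a r -> pscvg b r -> cmod z < r ->
  PS (fun n => a n + b n) z = PS a z + PS b z.
Proof.
move=> ar br zr; apply: is_csum_csum.
have := is_csumD (PS_is_csum ar zr) (PS_is_csum br zr).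
by apply: eq_is_csum => n; rewrite /psterm mulrDl.
Qed.

Lemma PSZ a r z k : pscvg a r -> cmod z < r -> PS (fun n => k * a n) z = k * PS a z.
Proof.
move=> ar zr; apply: is_csum_csum; have := is_csumZ k (PS_is_csum ar zr).
by apply: eq_is_csum => n; rewrite /psterm mulrA.
Qed.

Definition psshift a : nat -> C := fun n => if n is n'.+1 then a n' else 0.
Definition psder a : nat -> C := fun n => n.+1%:R * a n.+1.

Lemma PS_shift a r z : pscvg a r -> cmod z < r -> PS (psshift a) z = z * PS a z.
Proof.
move=> ar zr; apply: is_csum_csum; rewrite -[z * _]add0r -(mul0r (z ^+ 0)).
apply: (@is_csum0S _ (psterm (psshift a) z)).
have := is_csumZ z (PS_is_csum ar zr).
by apply: eq_is_csum => n; rewrite /psterm /= exprS mulrCA.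
Qed.

Lemma pscvgD a b r : pscvg a r -> pscvg b r -> pscvg (fun n => a n + b n) r.
Proof.
move=> [r0 [K hK]] [_ [L hL]]; split => //; exists (K + L) => n.
apply: le_trans (lerD (hK n) (hL n)).
by rewrite -mulrDl ler_wpM2r ?exprn_ge0 ?(ltW r0)// cmodD.
Qed.

Lemma pscvgZ a r k : pscvg a r -> pscvg (fun n => k * a n) r.
Proof.
move=> [r0 [K hK]]; split => //; exists (cmod k * K) => n.
by rewrite cmodM -mulrA ler_wpM2l ?cmod_ge0.
Qed.

Lemma pscvg_shift a r : pscvg a r -> pscvg (psshift a) r.
Proof.
move=> [r0 [K hK]]; split => //.
have K0 : 0 <= K by apply: le_trans (hK 0%N); rewrite mulr1 cmod_ge0.
exists (K * r) => -[|n] /=; first by rewrite cmod0 mul0r mulr_ge0// ltW.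
by rewrite exprSr mulrA ler_wpM2r ?(ltW r0).
Qed.

Lemma pscvg0 r : 0 < r -> pscvg (fun=> 0) r.
Proof. by move=> r0; split => //; exists 0 => n; rewrite cmod0 mul0r. Qed.

Lemma PS0 a : PS a 0 = a 0%N.
Proof.
apply: is_csum_csum => e e0; exists 1%N => -[//|n] _.
rewrite big_ord_recl /psterm expr0 mulr1 big1 ?addr0 ?subrr ?cmod0// => i _.
by rewrite expr0n mulr0.
Qed.

(** Strong induction: if [a n] is the first nonzero coefficient, the tail beyond degree [n] is at
    most [K |z|^(n+1)], which forbids zeros with [0 < |z| < |a n| / K] close to 0. *)
Lemma PS_isolated a r : pscvg a r ->
  (forall e, 0 < e -> exists2 z, z != 0 & cmod z < e /\ PS a z = 0) ->
  forall n, a n = 0.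
Proof.
move=> ar hz n; move: n; suff H n : (forall m, (m < n)%N -> a m = 0) -> a n = 0.
  by move=> n; elim/ltn_ind: n.
move=> hn; apply/eqP; apply: contraT => an0.
have [K K0 hK] := PS_tail n.+1 ar; have [r0 _] := ar.
have an : 0 < cmod (a n) by rewrite cmod_gt0.
have [z z0 [ze pz]] := hz (Num.min (r / 2) (cmod (a n) / K))
  ltac:(by rewrite lt_min !divr_gt0).
move: ze; rewrite lt_min => /andP[z1 z2].
have := hK z (ltW z1); rewrite pz sub0r cmodN big_ord_recr big1 /=; last first.
  by move=> i _; rewrite /psterm hn// mul0r.
rewrite add0r /psterm cmodM cmodX exprSr mulrCA mulrC.
rewrite ler_pM2l ?exprn_gt0 ?cmod_gt0// => h.
by move: z2; rewrite ltr_pdivlMr// mulrC ltNge h.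
Qed.

End PowerSeries.

Section Recentering.
Variable R : realType.
Local Notation C := (complexField R).
Implicit Types (u v a b : nat -> C) (x y z w h l : C) (r e K : R).

(** Delays the series in [z0] that multiplies [h^k], so that the index becomes the total degree in
    [z0] and [h]. *)
Lemma is_csum_delay k u l : is_csum u l ->
  is_csum (fun n => if (k <= n)%N then u (n - k)%N else 0) l.
Proof.
move=> ul; elim: k => [|k IH]; first by apply: eq_is_csum ul => n; rewrite subn0.
rewrite -[l]add0r.
exact: (@is_csum0S _ (fun n => if (k < n)%N then u (n - k.+1)%N else 0)).
Qed.

Lemma is_csum_fin m (u : nat -> nat -> C) (l : nat -> C) :
  (forall k, (k < m)%N -> is_csum (u k) (l k)) ->
  is_csum (fun n => \sum_(k < m) u k n) (\sum_(k < m) l k).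
Proof.
elim: m => [|m IH] H.
  by move=> e e0; exists 0%N => n _; rewrite big_ord0 subr0 big1 ?cmod0// => i _; rewrite big_ord0.
rewrite big_ord_recr /=.
have := is_csumD (IH (fun k km => H k (ltnW km))) (H m (leqnn _)).
by apply: eq_is_csum => n; rewrite big_ord_recr.
Qed.

Lemma is_csum_geo_le u l K (s : R) : 0 <= s < 1 -> (forall n, cmod (u n) <= K * s ^+ n) ->
  is_csum u l -> cmod l <= K / (1 - s).
Proof.
move=> s01 h ul; have := geo_tail 0 s01 h.
by rewrite (is_csum_csum ul) big_ord0 subr0 mulr1.
Qed.

Lemma binomial_term_le (x y : R) n k : 0 <= x -> 0 <= y -> (k <= n)%N ->
  (x ^+ (n - k) * y ^+ k) *+ 'C(n, k) <= (x + y) ^+ n.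
Proof.
move=> x0 y0 kn; rewrite exprDn (bigD1 (Ordinal (kn : (k < n.+1)%N)))//= lerDl.
by apply: sumr_ge0 => i _; rewrite mulrn_wge0// mulr_ge0 ?exprn_ge0.
Qed.

Lemma expr_vanish (s M : R) : 0 <= s < 1 -> forall e, 0 < e ->
  exists N, forall n, (N <= n)%N -> M * s ^+ n < e.
Proof.
move=> /andP[s0 s1] e e0.
have cv : (fun n => M * s ^+ n) @ \oo --> (M * 0 : R).
  by apply: cvgMr; apply: cvg_expr; rewrite ger0_norm.
rewrite mulr0 in cv; have /cvgrPdist_lt/(_ _ e0)[N _ hN] := cv.
exists N => n /hN /=; rewrite sub0r normrN; apply: le_lt_trans; exact: ler_norm.
Qed.

(* Expanding [(z0 + h)^n] and exchanging the two sums; the exchange is justified by comparing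
   the tails with the value of the majorant series at [|z0| + r1]. *)
Lemma PS_recenter a r z0 r1 : pscvg a r -> 0 < r1 -> cmod z0 + r1 < r ->
  exists b, [/\ pscvg b r1, b 0%N = PS a z0, b 1%N = PS (psder a) z0 &
    forall h, cmod h < r1 -> PS a (z0 + h) = PS b h].
Proof.
move=> ar r10 z0r; have [r0 [K hK]] := ar.
have K0 : 0 <= K by apply: le_trans (hK 0%N); rewrite mulr1 cmod_ge0.
set q := cmod z0 + r1; have q0 : 0 < q by rewrite /q; have := cmod_ge0 z0; lra.
set s := q / r.
have s01 : 0 <= s < 1 by rewrite /s divr_ge0 ?ltW//= ltr_pdivrMr// mul1r.
have s1 : 0 < 1 - s by case/andP: s01; lra.
have aq n : cmod (a n) * q ^+ n <= K * s ^+ n.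
  by rewrite /s expr_div_n mulrA ler_pdivlMr ?exprn_gt0// mulrAC ler_wpM2r ?exprn_ge0 ?(ltW q0).
(* The contribution of [a (n + k) * (z0 + h) ^+ (n + k)] to the coefficient of [h ^+ k]. *)
pose t k n : C := 'C(n + k, k)%:R * a (n + k)%N * z0 ^+ n.
have tK : forall k n, cmod (t k n) * r1 ^+ k <= K * s ^+ (n + k).
  move=> k n; apply: le_trans (aq _); rewrite /t !cmodM cmod_nat cmodX.
  rewrite [_%:R * _]mulrC -!mulrA ler_wpM2l ?cmod_ge0// mulrC.
  have := binomial_term_le (cmod_ge0 z0) (ltW r10) (leq_addl n k).
  by rewrite addnK -mulr_natr.
have tK' : forall k n, cmod (t k n) <= K * s ^+ k / r1 ^+ k * s ^+ n.
  move=> k n; by rewrite mulrAC ler_pdivlMr ?exprn_gt0// -mulrA -exprD [(k + n)%N]addnC.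
pose b k := csum (t k).
have tb k : is_csum (t k) (b k) by apply: geo_is_csum s01 (tK' k).
have bK k : cmod (b k) * r1 ^+ k <= K / (1 - s) * s ^+ k.
  rewrite -ler_pdivlMr ?exprn_gt0//; apply: le_trans (is_csum_geo_le s01 (tK' k) (tb k)) _.
  by rewrite le_eqVlt; apply/orP; left; apply/eqP; ring.
exists b; split.
- split => //; exists (K / (1 - s)) => k; apply: le_trans (bK k) _.
  case/andP: s01 => s0 /ltW ?; rewrite ler_piMr ?exprn_ile1//.
  by rewrite divr_ge0// ltW.
- by congr csum; apply/funext => n; rewrite /t /psterm addn0 bin0 mul1r.
- by congr csum; apply/funext => n; rewrite /t /psterm /psder bin1 addn1.
move=> h hr1.
have br1 : pscvg b r1.
  split => //; exists (K / (1 - s)) => k; apply: le_trans (bK k) _.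
  case/andP: s01 => s0 /ltW ?; rewrite ler_piMr ?exprn_ile1//.
  by rewrite divr_ge0// ltW.
apply: (@is_csum_uniq _ (psterm b h)); last exact: PS_is_csum br1 hr1.
have zhr : cmod (z0 + h) < r.
  by apply: le_lt_trans (cmodD _ _) _; apply: le_lt_trans z0r; rewrite lerD2l ltW.
have hF := PS_is_csum ar zhr.
set th := cmod h / r1.
have th01 : 0 <= th < 1 by rewrite /th divr_ge0 ?cmod_ge0 ?ltW//= ltr_pdivrMr// mul1r.
(* Truncation at [k < m] leaves, in each total degree [n], only terms with at least [m] factors [h];
   these are smaller than the majorant [q ^+ n] by the factor [th ^+ m]. *)
suff main m : cmod (\sum_(k < m) psterm b h k - PS a (z0 + h)) <= K / (1 - s) * th ^+ m.
  move=> e e0; have [N hN] := @expr_vanish th (K / (1 - s)) th01 e e0.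
  by exists N => n /hN; apply: le_lt_trans.
have H1 : is_csum (fun n => \sum_(k < m) h ^+ k *
    (if (k <= n)%N then t k (n - k)%N else 0)) (\sum_(k < m) psterm b h k).
  apply: (@is_csum_fin m (fun k n => h ^+ k *
    (if (k <= n)%N then t k (n - k)%N else 0)) (psterm b h)) => k _.
  have -> : psterm b h k = h ^+ k * b k by rewrite /psterm mulrC.
  exact: (is_csumZ (h ^+ k) (is_csum_delay k (tb k))).
have {}hF := is_csumZ (-1) hF; have {}H1 := is_csumD H1 hF.
rewrite mulN1r in H1.
rewrite [X in _ <= X](_ : _ = K * th ^+ m / (1 - s)); last by ring.
apply: is_csum_geo_le s01 _ H1 => n; rewrite /=.
have -> : \sum_(k < m) h ^+ k * (if (k <= n)%N then t k (n - k)%N else 0) =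
    \sum_(k < n.+1 | (k < m)%N) a n * ((z0 ^+ (n - k) * h ^+ k) *+ 'C(n, k)).
  pose F k := h ^+ k * (if (k <= n)%N then t k (n - k)%N else 0).
  rewrite -(big_mkord xpredT F) -(big_mkord (fun k => (k < m)%N)
     (fun k => a n * ((z0 ^+ (n - k) * h ^+ k) *+ 'C(n, k)))).
  have FE k : (k < n.+1)%N -> F k = a n * ((z0 ^+ (n - k) * h ^+ k) *+ 'C(n, k)).
    by rewrite ltnS /F /t => kn; rewrite kn subnK//; rewrite -mulr_natr; ring.
  rewrite (eq_big_nat _ _ (F2 := fun k => if (k < n.+1)%N then F k else 0)); last first.
    by move=> k _; rewrite /F ltnS; case: (k <= n)%N; rewrite ?mulr0.
  rewrite -big_mkcond /=.
  rewrite [LHS](big_nat_widen _ _ (maxn m n.+1)) ?leq_maxl//.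
  rewrite [RHS](big_nat_widen _ _ (maxn m n.+1)) ?leq_maxr//.
  by apply: eq_big => k; [rewrite andbC|move=> /andP[kn _]; rewrite FE].
rewrite mulN1r /psterm exprDn mulr_sumr [X in _ - X](bigID (fun k : 'I_n.+1 => (k < m)%N))/=.
rewrite opprD addrA subrr sub0r cmodN.
apply: le_trans (cmod_sum _ _ _) _.
apply: (@le_trans _ _ (cmod (a n) * (th ^+ m * q ^+ n))); last first.
  rewrite mulrCA mulrC [K * _ * _]mulrAC ler_wpM2r//.
  by case/andP: th01 => th0 _; exact: exprn_ge0.
under eq_bigr do rewrite cmodM.
rewrite -mulr_sumr ler_wpM2l ?cmod_ge0//.
rewrite /q exprDn mulr_sumr [leRHS](bigID (fun k : 'I_n.+1 => (k < m)%N))/=.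
rewrite -[leLHS]add0r lerD//.
  apply: sumr_ge0 => k _; case/andP: th01 => th0 _.
  by rewrite mulr_ge0 ?exprn_ge0// mulrn_wge0// mulr_ge0 ?exprn_ge0 ?cmod_ge0// ltW.
apply: ler_sum => k; rewrite -leqNgt => mk.
rewrite -[_ *+ 'C(n, k)]mulr_natr cmodM cmod_nat cmodM !cmodX -[X in _ <= _ * X]mulr_natr mulrA.
rewrite ler_wpM2r// mulrCA ler_wpM2l ?exprn_ge0 ?cmod_ge0//.
rewrite (_ : cmod h = th * r1); last by rewrite /th divfK// gt_eqF.
rewrite exprMn ler_wpM2r ?exprn_ge0 ?(ltW r10)//.
by case/andP: th01 => th0 /ltW th1; apply: ler_wiXn2l.
Qed.

End Recentering.

(** * Complex differentiability *)

Section ComplexDerivative.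
Variable R : realType.
Local Notation C := (complexField R).
Implicit Types (f g : C -> C) (a b : nat -> C) (x y z w h d : C) (r e K : R).

(** The little-o form: it asserts differentiability, which an equation about [derive1] does not, and
    it contains no quotient by [h]. *)
Definition cderiv f z d := forall e, 0 < e ->
  exists2 dl, 0 < dl & forall h, cmod h < dl -> cmod (f (z + h) - f z - d * h) <= e * cmod h.

Lemma cderiv_cst k z : cderiv (fun=> k) z 0.
Proof. by move=> e e0; exists 1 => // h _; rewrite mul0r subrr subr0 cmod0 mulr_ge0 ?cmod_ge0 ?ltW. Qed.

Lemma cderiv_id z : cderiv (fun w => w) z 1.
Proof.
move=> e e0; exists 1 => // h _.
by rewrite (_ : z + h - z - 1 * h = 0) ?cmod0 ?mulr_ge0 ?cmod_ge0 ?ltW//; ring.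
Qed.

Lemma cderivD f g z d d' : cderiv f z d -> cderiv g z d' ->
  cderiv (fun w => f w + g w) z (d + d').
Proof.
move=> hf hg e e0; have [r r0 hr] := hf _ (halfR_gt0 e0).
have [s s0 hs] := hg _ (halfR_gt0 e0).
exists (Num.min r s) => [|h]; first by rewrite lt_min r0.
rewrite lt_min => /andP[/hr {}hr /hs {}hs].
rewrite (_ : _ - _ = (f (z + h) - f z - d * h) + (g (z + h) - g z - d' * h)); last by ring.
by apply: le_trans (cmodD _ _) _; lra.
Qed.

Lemma cderivZ f z d k : cderiv f z d -> cderiv (fun w => k * f w) z (k * d).
Proof.
move=> hf e e0; have k0 : 0 < cmod k + 1 by have := cmod_ge0 k; lra.
have [r r0 hr] := hf _ (divr_gt0 e0 k0); exists r => // h /hr {}hr.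
rewrite (_ : _ - _ = k * (f (z + h) - f z - d * h)); last by ring.
rewrite cmodM; have : cmod k * cmod (f (z + h) - f z - d * h) <=
  (cmod k + 1) * (e / (cmod k + 1) * cmod h).
  apply: ler_pM => //; rewrite ?cmod_ge0//; lra.
by rewrite mulrA mulrCA divff ?mulr1// gt_eqF.
Qed.

Lemma cderiv_sum n (F : 'I_n -> C -> C) (D : 'I_n -> C) z :
  (forall i, cderiv (F i) z (D i)) -> cderiv (fun w => \sum_i F i w) z (\sum_i D i).
Proof.
elim: n F D => [|n IH] F D h.
  rewrite big_ord0 (_ : (fun w => _) = fun=> 0); first exact: cderiv_cst.
  by apply/funext => w; rewrite big_ord0.
rewrite big_ord_recl (_ : (fun w => _) = fun w => F ord0 w + \sum_i F (lift ord0 i) w).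
  by apply: cderivD => //; apply: IH.
by apply/funext => w; rewrite big_ord_recl.
Qed.

Lemma cderiv_lip f z d : cderiv f z d -> exists2 dl, 0 < dl &
  forall h, cmod h < dl -> cmod (f (z + h) - f z) <= (cmod d + 1) * cmod h.
Proof.
move=> /(_ 1 ltr01)[r r0 hr]; exists r => // h /hr {}hr.
rewrite (_ : f (z + h) - f z = (f (z + h) - f z - d * h) + d * h); last by ring.
by apply: le_trans (cmodD _ _) _; rewrite cmodM; lra.
Qed.

Lemma cderiv_cont f z d : cderiv f z d -> forall e, 0 < e -> exists2 dl, 0 < dl &
  forall h, cmod h < dl -> cmod (f (z + h) - f z) < e.
Proof.
move=> /cderiv_lip[r r0 hr] e e0; have d0 : 0 < cmod d + 1 by have := cmod_ge0 d; lra.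
exists (Num.min r (e / (cmod d + 1))) => [|h]; first by rewrite lt_min r0 divr_gt0.
rewrite lt_min => /andP[/hr {}hr]; rewrite ltr_pdivlMr// mulrC.
exact: le_lt_trans.
Qed.

Lemma cderiv_comp f g z d d' : cderiv f z d -> cderiv g (f z) d' ->
  cderiv (fun w => g (f w)) z (d' * d).
Proof.
move=> hf hg e e0; have [r r0 hr] := cderiv_lip hf.
set K := cmod d + 1; have K0 : 0 < K by rewrite /K; have := cmod_ge0 d; lra.
have [s s0 hs] := hg _ (divr_gt0 (halfR_gt0 e0) K0).
have k0 : 0 < cmod d' + 1 by have := cmod_ge0 d'; lra.
have [q q0 hq] := hf _ (divr_gt0 (halfR_gt0 e0) k0).
have [p p0 hp] := cderiv_cont hf s0.
exists (Num.min (Num.min r q) p) => [|h]; first by rewrite !lt_min r0 q0.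
rewrite !lt_min => /andP[/andP[/hr {}hr /hq {}hq] /hp {}hp].
set u := f (z + h) - f z in hr hq hp.
have := hs u hp; rewrite (_ : f z + u = f (z + h)); last by rewrite /u; ring.
move=> H.
rewrite (_ : _ - _ = (g (f (z + h)) - g (f z) - d' * u) + d' * (u - d * h)); last by ring.
apply: le_trans (cmodD _ _) _; rewrite cmodM.
have H1 : e / 2 / K * cmod u <= e / 2 * cmod h.
  by rewrite mulrAC ler_pdivrMr// -[leRHS]mulrA ler_wpM2l ?(ltW (halfR_gt0 e0))// [leRHS]mulrC.
have H2 : cmod d' * cmod (u - d * h) <= e / 2 * cmod h.
  have : cmod d' * cmod (u - d * h) <= (cmod d' + 1) * (e / 2 / (cmod d' + 1) * cmod h).
    by apply: ler_pM; rewrite ?cmod_ge0//; lra.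
  by rewrite mulrA mulrCA divff ?mulr1// gt_eqF.
lra.
Qed.

Lemma cderiv_sqr z : cderiv (fun w => w ^+ 2) z (2 * z).
Proof.
move=> e e0; exists e => // h he.
rewrite (_ : _ - _ = h * h); last by ring.
by rewrite cmodM ler_wpM2r ?cmod_ge0// ltW.
Qed.

(** Polarization: [f g = ((f + g)^2 - (f - g)^2) / 4] reduces the product rule to the chain rule for
    the square. *)
Lemma cderivM f g z d d' : cderiv f z d -> cderiv g z d' ->
  cderiv (fun w => f w * g w) z (d * g z + f z * d').
Proof.
move=> hf hg.
have sq F D : cderiv F z D -> cderiv (fun w => F w ^+ 2) z (2 * F z * D).
  by move=> hF; apply: (cderiv_comp hF (cderiv_sqr (F z))).
have hN : cderiv (fun w => f w - g w) z (d - d').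
  have := cderivD hf (cderivZ (-1) hg); rewrite mulN1r.
  by rewrite (_ : (fun w => _) = fun w => f w - g w)//; apply/funext => w; rewrite mulN1r.
have := cderivZ (4^-1) (cderivD (sq _ _ (cderivD hf hg)) (cderivZ (-1) (sq _ _ hN))).
rewrite (_ : (fun w => _) = fun w => f w * g w); last by apply/funext => w; field.
by rewrite (_ : _ * (_ + _) = d * g z + f z * d')//; field.
Qed.

Lemma eq_near_cderiv f g z d r : 0 < r -> (forall h, cmod h < r -> f (z + h) = g (z + h)) ->
  cderiv f z d -> cderiv g z d.
Proof.
move=> r0 fg hf e e0; have [s s0 hs] := hf _ e0.
exists (Num.min r s) => [|h]; first by rewrite lt_min r0.
rewrite lt_min => /andP[/fg <- /hs {}hs].
by have := fg 0; rewrite cmod0 addr0 => <-.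
Qed.

Lemma cderiv_derive1 f z d : cderiv f z d -> derive1 f z = d.
Proof.
move=> hf; rewrite /derive1; apply: cvg_lim; first exact: norm_hausdorff.
apply/cvgrPdist_lt => e e0.
have eE : e = toC (cRe e).
  have : (toC 0 < e) := e0; rewrite (ltcE (toC 0)) => /andP[/eqP /= e1 _].
  by apply: complex_eqP => //; exact: e1.
have e0' : 0 < cRe e by rewrite eE -toC0 toC_lt in e0.
have [s s0 hs] := hf _ (halfR_gt0 e0').
rewrite near_withinE; apply/nearP_cmod; exists s => // h; rewrite subr0 => hh h0.
rewrite distrC cmodE eE toC_lt.
have := hs h hh; rewrite [z + h]addrC.
rewrite (_ : h^-1 *: (f (h + z) - f z) - d = h^-1 * (f (h + z) - f z - d * h)); last first.
  by rewrite [RHS]mulrBr; congr (_ - _); rewrite mulrCA mulVf ?mulr1.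
move=> H; rewrite cmodM cmodV mulrC ltr_pdivrMr ?cmod_gt0//; apply: le_lt_trans H _.
by rewrite ltr_pM2r ?cmod_gt0//; lra.
Qed.

End ComplexDerivative.

(** * Analytic functions and the identity principle *)

Section Analytic.
Variable R : realType.
Local Notation C := (complexField R).
Implicit Types (f g : C -> C) (a b : nat -> C) (x y z w h d : C) (r e K : R).

(** After recentering at [z] the derivative is the coefficient of degree 1 and the tail of order 2
    is the remainder. *)
Lemma PS_cderiv a r z : pscvg a r -> cmod z < r -> cderiv (PS a) z (PS (psder a) z).
Proof.
move=> ar zr e e0; set r1 := (r - cmod z) / 2; have r10 : 0 < r1 by rewrite /r1; lra.
have [b [br <- <- bE]] : exists b, [/\ pscvg b r1, b 0%N = PS a z,
    b 1%N = PS (psder a) z & forall h, cmod h < r1 -> PS a (z + h) = PS b h].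
  by apply: PS_recenter ar r10 _; rewrite /r1; lra.
clearbody r1; have [K K0 hK] := PS_tail 2 br.
exists (Num.min (r1 / 2) (e / K)) => [|h]; first by rewrite lt_min !divr_gt0.
rewrite lt_min => /andP[h1 h2]; rewrite bE; last by apply: lt_le_trans h1 _; rewrite ler_pdivrMr// ler_peMr ?(ltW r10)// ler1n.
have := hK h (ltW h1); rewrite !big_ord_recr big_ord0 /= /psterm !expr0 !expr1 add0r mulr1.
rewrite opprD addrA => H; apply: le_trans H _; rewrite expr2 mulrA ler_wpM2r ?cmod_ge0//.
by rewrite mulrC -ler_pdivlMr// ltW.
Qed.

Lemma pscvg_psder a r r' : 0 < r' -> r' < r -> pscvg a r -> pscvg (psder a) r'.
Proof.
move=> r'0 rr [r0 [K hK]]; split => //; set s := r' / r.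
have s01 : 0 <= s < 1 by rewrite /s divr_ge0 ?ltW//= ltr_pdivrMr// mul1r.
have s1 : 0 < 1 - s by case/andP: s01; lra.
have K0 : 0 <= K by apply: le_trans (hK 0%N); rewrite mulr1 cmod_ge0.
exists (K / r * (1 / (1 - s))) => n.
rewrite /psder cmodM cmod_nat (_ : r' = s * r); last by rewrite /s divfK// gt_eqF.
rewrite exprMn (_ : _ * _ = (cmod (a n.+1) * r ^+ n) * (n.+1%:R * s ^+ n)); last by ring.
apply: ler_pM; rewrite ?mulr_ge0 ?cmod_ge0 ?exprn_ge0 ?(ltW r0)//; first by case/andP: s01.
  by rewrite ler_pdivlMr// -mulrA -exprSr.
(* Since [s < 1], the product [n.+1 * s ^+ n] is at most the geometric sum of the first [n.+1]
   powers, hence at most [1 / (1 - s)]. *)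
have := sum_geo_le 0 n.+1 ler01 s01; rewrite expr0 mulr1; apply: le_trans.
rewrite big_mkord (_ : n.+1%:R * s ^+ n = \sum_(i < n.+1) s ^+ n); last first.
  by rewrite sumr_const card_ord mulr_natl.
apply: ler_sum => i _; rewrite mul1r; case/andP: s01 => s0 /ltW s1'.
by apply: ler_wiXn2l => //; rewrite -ltnS.
Qed.

Definition pseries_on f z a r :=
  pscvg a r /\ forall w, cmod (w - z) < r -> f w = PS a (w - z).

Lemma analytic_atP f z : analytic_at f z <-> exists a r, pseries_on f z a r.
Proof.
have cvgP (u : nat -> C) l : (series u @ \oo --> l) <-> is_csum u l.
  split.
    move=> /cvgrPdist_lt H e e0; have := H (toC e).
    rewrite -toC0 toC_lt => /(_ e0)[N _ hN]; exists N => n /hN /=.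
    by rewrite distrC cmodE toC_lt seriesEord.
  move=> H; apply/cvgrPdist_lt => e e0.
  have eE : e = toC (cRe e).
    have : (toC 0 < e) := e0; rewrite (ltcE (toC 0)) => /andP[/eqP /= e1 _].
    by apply: complex_eqP => //; exact: e1.
  have e0' : 0 < cRe e by rewrite eE -toC0 toC_lt in e0.
  have [N hN] := H _ e0'; exists N => // n /hN /=.
  by rewrite distrC cmodE eE toC_lt seriesEord.
split.
- move=> [a /nearP_cmod[r r0 H]]; exists a, (r / 2).
  (* The definition only gives pointwise convergence. Convergence at the single point [z + r / 2]
     bounds the terms at that radius: late ones as differences of partial sums, the first [N] by
     their sum. *)
  have ha : pscvg a (r / 2).
    split; first lra.
    have := H (z + toC (r / 2)); rewrite addrC addKr cmod_toC gtr0_norm ?divr_gt0//.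
    have -> : r / 2 < r by lra.
    move=> /(_ isT)/cvgP Hs.
    have [N hN] := Hs _ ltr01.
    have hN' n : (N <= n)%N -> cmod (a n) * (r / 2) ^+ n <= 2.
      move=> Nn; have h1 := hN _ Nn; have h2 := hN _ (leqW Nn).
      rewrite big_ord_recr /= in h2.
      set S := \sum_(i < n) _ in h1 h2; set l := f _ in h1 h2.
      have := cmodB (S + a n * toC (r / 2) ^+ n - l) (S - l).
      rewrite (_ : _ - _ - _ = a n * toC (r / 2) ^+ n); last by ring.
      by rewrite cmodM cmodX cmod_toC gtr0_norm ?divr_gt0// => h3; lra.
    exists (2 + \sum_(i < N) cmod (a i) * (r / 2) ^+ i) => n.
    have pos i : 0 <= cmod (a i) * (r / 2) ^+ i.
      by rewrite mulr_ge0 ?cmod_ge0 ?exprn_ge0// divr_ge0 ?ltW.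
    have [Nn|nN] := leqP N n.
      by apply: le_trans (hN' _ Nn) _; rewrite lerDl sumr_ge0.
    rewrite (bigD1 (Ordinal nN))//= addrCA lerDl addr_ge0// sumr_ge0//.
  split => // w wz; apply: (@is_csum_uniq _ (psterm a (w - z))).
    by apply/cvgP; apply: H; lra.
  exact: PS_is_csum ha wz.
- move=> [a [r [ar H]]]; exists a; apply/nearP_cmod; exists r; first by case: ar.
  by move=> w wz; apply/cvgP; rewrite H//; exact: PS_is_csum ar wz.
Qed.

Lemma pseries_on_recenter f z a r w : pseries_on f z a r -> cmod (w - z) < r ->
  exists b, pseries_on f w b ((r - cmod (w - z)) / 2).
Proof.
move=> [ar fE] wz; set r1 := _ / 2; have r10 : 0 < r1 by rewrite /r1; lra.
have [b [br _ _ bE]] : exists b, [/\ pscvg b r1, b 0%N = PS a (w - z),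
    b 1%N = PS (psder a) (w - z) & forall h, cmod h < r1 -> PS a (w - z + h) = PS b h].
  by apply: PS_recenter ar r10 _; rewrite /r1; lra.
exists b; split => // w' h; rewrite -bE// fE; first by congr PS; ring.
rewrite (_ : w' - z = (w' - w) + (w - z)); last by ring.
by apply: le_lt_trans (cmodD _ _) _; rewrite /r1 in h; lra.
Qed.

Lemma pseries_on_le f z a r r' : 0 < r' -> r' <= r -> pseries_on f z a r -> pseries_on f z a r'.
Proof.
move=> r0 rr [ar fE]; split; first exact: pscvg_le ar.
by move=> w wz; apply: fE; apply: lt_le_trans wz rr.
Qed.

Lemma pseries_on_analytic f z a r w : pseries_on f z a r -> cmod (w - z) < r -> analytic_at f w.
Proof.
move=> fz /(pseries_on_recenter fz)[b fw]; apply/analytic_atP.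
by exists b; eexists; exact: fw.
Qed.

Lemma pseries_on_cderiv f z a r w : pseries_on f z a r -> cmod (w - z) < r ->
  cderiv f w (PS (psder a) (w - z)).
Proof.
move=> [ar fE] wz.
have s0 : 0 < r - cmod (w - z) by lra.
apply: (@eq_near_cderiv _ (fun w => PS a (w - z)) f _ _ _ s0).
  move=> h hh; rewrite fE// addrAC; apply: le_lt_trans (cmodD _ _) _; lra.
have hd : cderiv (fun w => w - z) w 1.
  have := cderivD (cderiv_id w) (cderiv_cst (- z) w); rewrite addr0.
  exact.
have := cderiv_comp hd (PS_cderiv ar wz).
by rewrite mulr1.
Qed.

Lemma pseries_onD f g z a b r : pseries_on f z a r -> pseries_on g z b r ->
  pseries_on (fun w => f w + g w) z (fun n => a n + b n) r.
Proof.
move=> [ar fE] [br gE]; split; first exact: pscvgD.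
by move=> w wz; rewrite fE// gE// (PSD ar br wz).
Qed.

Lemma pseries_onZ f z a r k : pseries_on f z a r ->
  pseries_on (fun w => k * f w) z (fun n => k * a n) r.
Proof.
move=> [ar fE]; split; first exact: pscvgZ.
by move=> w wz; rewrite fE// (PSZ _ ar wz).
Qed.

(** The factor [w] of [theta] is expanded as [z + (w - z)]; the derivative costs a little of the
    radius. *)
Lemma pseries_on_theta f z a r r' : 0 < r' -> r' < r -> pseries_on f z a r ->
  pseries_on (theta f) z (fun n => z * psder a n + psshift (psder a) n) r'.
Proof.
move=> r0 rr fz; have [ar fE] := fz; have da := pscvg_psder r0 rr ar.
split; first by apply: pscvgD; [exact: pscvgZ|exact: pscvg_shift].
move=> w wz; have wz' : cmod (w - z) < r by lra.
rewrite /theta (cderiv_derive1 (pseries_on_cderiv fz wz')).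
rewrite (PSD (pscvgZ z da) (pscvg_shift da) wz) (PSZ _ da wz) (PS_shift da wz).
by rewrite -mulrDl; congr (_ * _); ring.
Qed.

Lemma analytic_isolated f g z : analytic_at f z -> analytic_at g z ->
  (forall e, 0 < e -> exists2 w, w != z & cmod (w - z) < e /\ f w = g w) ->
  \forall w \near z, f w = g w.
Proof.
move=> /analytic_atP[a [r fz]] /analytic_atP[b [s gz]] H.
have r0 : 0 < r by case: fz => -[].
have s0 : 0 < s by case: gz => -[].
set q := Num.min r s; have q0 : 0 < q by rewrite lt_min r0.
have {}fz : pseries_on f z a q by apply: pseries_on_le fz; rewrite // ge_min lexx.
have {}gz : pseries_on g z b q by apply: pseries_on_le gz; rewrite // ge_min lexx orbT.
have fg := pseries_onD fz (pseries_onZ (-1) gz).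
have c0 := @PS_isolated _ _ q fg.1.
have {}c0 : forall n, a n + -1 * b n = 0.
  apply: c0 => e e0; have [w wz [we fgw]] := H (Num.min e q) ltac:(by rewrite lt_min e0).
  move: we; rewrite lt_min => /andP[we wq].
  exists (w - z); first by rewrite subr_eq0.
  by split => //; have := fg.2 _ wq; rewrite fgw mulN1r subrr => <-.
apply/nearP_cmod; exists q => // w wq.
rewrite fz.2// gz.2//; congr PS; apply/funext => n.
by have /eqP := c0 n; rewrite mulN1r subr_eq0 => /eqP.
Qed.

End Analytic.

(** * Matrix differential equations *)

Section MatrixCalculus.
Variable R : realType.
Local Notation C := (complexField R).
Implicit Types (x y z w h d : C) (r e K : R).

Definition mnorm m n (A : 'M[C]_(m, n)) : R := \sum_i \sum_j cmod (A i j).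

Lemma mnorm_ge0 m n (A : 'M[C]_(m, n)) : 0 <= mnorm A.
Proof. by apply: sumr_ge0 => i _; apply: sumr_ge0 => j _; exact: cmod_ge0. Qed.

Lemma mnorm_entry m n (A : 'M[C]_(m, n)) i j : cmod (A i j) <= mnorm A.
Proof.
rewrite /mnorm (bigD1 i)//= (bigD1 j)//= -addrA lerDl addr_ge0// sumr_ge0// => *.
  exact: cmod_ge0.
by apply: sumr_ge0 => *; exact: cmod_ge0.
Qed.

Lemma mnormD m n (A B : 'M[C]_(m, n)) : mnorm (A + B) <= mnorm A + mnorm B.
Proof.
rewrite /mnorm -big_split; apply: ler_sum => i _.
by rewrite -big_split; apply: ler_sum => j _; rewrite mxE cmodD.
Qed.

Lemma mnormZ m n k (A : 'M[C]_(m, n)) : mnorm (k *: A) = cmod k * mnorm A.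
Proof.
rewrite /mnorm mulr_sumr; apply: eq_bigr => i _.
by rewrite mulr_sumr; apply: eq_bigr => j _; rewrite mxE cmodM.
Qed.

Lemma mnormN m n (A : 'M[C]_(m, n)) : mnorm (- A) = mnorm A.
Proof. by rewrite -scaleN1r mnormZ cmodN cmod1 mul1r. Qed.

Lemma mnormB m n (A B : 'M[C]_(m, n)) : mnorm (A - B) <= mnorm A + mnorm B.
Proof. by rewrite -(mnormN B) mnormD. Qed.

Lemma mnorm0 m n : mnorm (0 : 'M[C]_(m, n)) = 0.
Proof. by rewrite -(scale0r 0) mnormZ cmod0 mul0r. Qed.

Lemma mnormM m n p (A : 'M[C]_(m, n)) (B : 'M[C]_(n, p)) :
  mnorm (A *m B) <= mnorm A * mnorm B.
Proof.
rewrite /mnorm mulr_suml; apply: ler_sum => i _.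
apply: (@le_trans _ _ (\sum_j \sum_k cmod (A i k) * cmod (B k j))).
  apply: ler_sum => j _; rewrite mxE; apply: le_trans (cmod_sum _ _ _) _.
  by apply: ler_sum => k _; rewrite cmodM.
rewrite exchange_big /= mulr_suml; apply: ler_sum => k _; rewrite -mulr_sumr.
rewrite ler_wpM2l ?cmod_ge0// [leRHS](bigD1 k)//= lerDl; apply: sumr_ge0 => *.
by apply: sumr_ge0 => *; exact: cmod_ge0.
Qed.

Definition mderiv m n (Y : C -> 'M[C]_(m, n)) z (D : 'M[C]_(m, n)) :=
  forall i j, cderiv (fun w => Y w i j) z (D i j).

Lemma mderiv_cst m n (A : 'M[C]_(m, n)) z : mderiv (fun=> A) z 0.
Proof. by move=> i j; rewrite mxE; exact: cderiv_cst. Qed.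

Lemma mderivD m n (Y Z : C -> 'M[C]_(m, n)) z D D' : mderiv Y z D -> mderiv Z z D' ->
  mderiv (fun w => Y w + Z w) z (D + D').
Proof.
move=> hY hZ i j; rewrite mxE (_ : (fun w => _) = fun w => Y w i j + Z w i j).
  exact: cderivD.
by apply/funext => w; rewrite mxE.
Qed.

Lemma mderivZ m n (f : C -> C) (Y : C -> 'M[C]_(m, n)) z d D :
  cderiv f z d -> mderiv Y z D ->
  mderiv (fun w => f w *: Y w) z (d *: Y z + f z *: D).
Proof.
move=> hf hY i j; rewrite !mxE (_ : (fun w => _) = fun w => f w * Y w i j).
  exact: cderivM.
by apply/funext => w; rewrite mxE.
Qed.

Lemma mderivZc m n (f : C -> C) (A : 'M[C]_(m, n)) z d : cderiv f z d ->
  mderiv (fun w => f w *: A) z (d *: A).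
Proof.
move=> hf i j; rewrite mxE mulrC (_ : (fun w => _) = fun w => A i j * f w).
  exact: cderivZ.
by apply/funext => w; rewrite mxE mulrC.
Qed.

Lemma mderivM m n p (Y : C -> 'M[C]_(m, n)) (Z : C -> 'M[C]_(n, p)) z D D' :
  mderiv Y z D -> mderiv Z z D' ->
  mderiv (fun w => Y w *m Z w) z (D *m Z z + Y z *m D').
Proof.
move=> hY hZ i j.
rewrite !mxE -big_split (_ : (fun w => _) = fun w => \sum_k Y w i k * Z w k j).
  by apply: cderiv_sum => k; exact: cderivM.
by apply/funext => w; rewrite mxE.
Qed.

Lemma mderivMr m n p (Y : C -> 'M[C]_(m, n)) (A : 'M[C]_(n, p)) z D :
  mderiv Y z D -> mderiv (fun w => Y w *m A) z (D *m A).
Proof. by move=> h; have := mderivM h (mderiv_cst A z); rewrite mulmx0 addr0. Qed.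

Lemma mderivB m n (Y Z : C -> 'M[C]_(m, n)) z D D' : mderiv Y z D -> mderiv Z z D' ->
  mderiv (fun w => Y w - Z w) z (D - D').
Proof.
move=> hY hZ; have := mderivD hY (mderivZ (cderiv_cst (-1) z) hZ).
rewrite scale0r add0r scaleN1r (_ : (fun w => _) = fun w => Y w - Z w)//.
by apply/funext => w; rewrite scaleN1r.
Qed.

Lemma mderiv_comp m n f (Y : C -> 'M[C]_(m, n)) z d D :
  cderiv f z d -> mderiv Y (f z) D -> mderiv (fun w => Y (f w)) z (d *: D).
Proof. by move=> hf hY i j; rewrite mxE mulrC; exact: cderiv_comp hf (hY i j). Qed.

Lemma eq_near_mderiv m n (Y Z : C -> 'M[C]_(m, n)) z D r : 0 < r ->
  (forall h, cmod h < r -> Y (z + h) = Z (z + h)) -> mderiv Y z D -> mderiv Z z D.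
Proof.
move=> r0 YZ hY i j; apply: eq_near_cderiv r0 _ (hY i j) => h hr.
by rewrite YZ.
Qed.

Definition mPS m n (A : nat -> 'M[C]_(m, n)) z : 'M[C]_(m, n) :=
  \matrix_(i, j) PS (fun k => A k i j) z.

Lemma mPSE m n (A : nat -> 'M[C]_(m, n)) z i j : mPS A z i j = PS (fun k => A k i j) z.
Proof. by rewrite mxE. Qed.

Definition mcvg m n (A : nat -> 'M[C]_(m, n)) r :=
  0 < r /\ exists K, forall k, mnorm (A k) * r ^+ k <= K.

Lemma mcvg_entry m n (A : nat -> 'M[C]_(m, n)) r i j : mcvg A r -> pscvg (fun k => A k i j) r.
Proof.
move=> [r0 [K hK]]; split => //; exists K => k; apply: le_trans (hK k).
by rewrite ler_wpM2r ?exprn_ge0 ?(ltW r0)// mnorm_entry.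
Qed.

Lemma mcvgZ m n (A : nat -> 'M[C]_(m, n)) r c : mcvg A r -> mcvg (fun k => c *: A k) r.
Proof.
move=> [r0 [K hK]]; split => //; exists (cmod c * K) => n'.
by rewrite mnormZ -mulrA ler_wpM2l ?cmod_ge0.
Qed.

Lemma mcvgMl m n p (B : 'M[C]_(m, n)) (A : nat -> 'M[C]_(n, p)) r : mcvg A r ->
  mcvg (fun k => B *m A k) r.
Proof.
move=> [r0 [K hK]]; split => //; exists (mnorm B * K) => k.
apply: (@le_trans _ _ (mnorm B * (mnorm (A k) * r ^+ k))).
  by rewrite mulrA ler_wpM2r ?exprn_ge0 ?(ltW r0)// mnormM.
by rewrite ler_wpM2l ?mnorm_ge0.
Qed.

Lemma mcvgMr m n p (B : 'M[C]_(n, p)) (A : nat -> 'M[C]_(m, n)) r : mcvg A r ->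
  mcvg (fun k => A k *m B) r.
Proof.
move=> [r0 [K hK]]; split => //; exists (K * mnorm B) => k.
apply: (@le_trans _ _ (mnorm (A k) * r ^+ k * mnorm B)).
  by rewrite mulrAC ler_wpM2r ?exprn_ge0 ?(ltW r0)// mnormM.
by rewrite ler_wpM2r ?mnorm_ge0.
Qed.

Definition mshift m n (A : nat -> 'M[C]_(m, n)) k := if k is k'.+1 then A k' else 0.
Definition mder m n (A : nat -> 'M[C]_(m, n)) k := k.+1%:R *: A k.+1.

Lemma mcvg_shift m n (A : nat -> 'M[C]_(m, n)) r : mcvg A r -> mcvg (mshift A) r.
Proof.
move=> [r0 [K hK]]; split => //.
have K0 : 0 <= K by apply: le_trans (hK 0%N); rewrite mulr1 mnorm_ge0.
exists (K * r) => -[|k] /=; first by rewrite mnorm0 mul0r mulr_ge0// ltW.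
by rewrite exprSr mulrA ler_wpM2r ?(ltW r0).
Qed.

Lemma mPSD m n (A B : nat -> 'M[C]_(m, n)) r z : mcvg A r -> mcvg B r -> cmod z < r ->
  mPS (fun k => A k + B k) z = mPS A z + mPS B z.
Proof.
move=> hA hB zr; apply/matrixP => i j; rewrite !mxE.
rewrite -(PSD (mcvg_entry i j hA) (mcvg_entry i j hB) zr).
by congr (PS _ _); apply/funext => k; rewrite mxE.
Qed.

Lemma mPSZ m n (A : nat -> 'M[C]_(m, n)) r z c : mcvg A r -> cmod z < r ->
  mPS (fun k => c *: A k) z = c *: mPS A z.
Proof.
move=> hA zr; apply/matrixP => i j; rewrite !mxE -(PSZ _ (mcvg_entry i j hA) zr).
by congr (PS _ _); apply/funext => k; rewrite mxE.
Qed.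

Lemma PS_sum n (a : 'I_n -> nat -> C) r z : (forall i, pscvg (a i) r) -> 0 < r -> cmod z < r ->
  PS (fun k => \sum_i a i k) z = \sum_i PS (a i) z.
Proof.
move=> ha r0 zr.
suff [_] : pscvg (fun k => \sum_i a i k) r /\ PS (fun k => \sum_i a i k) z = \sum_i PS (a i) z by [].
elim: n a ha => [|n IH] a ha.
  rewrite big_ord0 (_ : (fun k => \sum_i a i k) = fun=> 0).
    split; first exact: pscvg0.
    rewrite -[RHS](mul0r (PS (fun=> 0) z)) -(PSZ 0 (pscvg0 r0) zr).
    by congr (PS _ _); apply/funext => k; rewrite mul0r.
  by apply/funext => k; rewrite big_ord0.
have [h1 h2] := IH (fun i => a (lift ord0 i)) (fun i => ha _).
rewrite (_ : (fun k => _) = fun k => a ord0 k + \sum_i a (lift ord0 i) k).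
  split; first exact: pscvgD.
  by rewrite (PSD (ha ord0) h1 zr) big_ord_recl h2.
by apply/funext => k; rewrite big_ord_recl.
Qed.

Lemma mPSMl m n p (B : 'M[C]_(m, n)) (A : nat -> 'M[C]_(n, p)) r z : mcvg A r -> cmod z < r ->
  mPS (fun k => B *m A k) z = B *m mPS A z.
Proof.
move=> hA zr; have [r0 _] := hA; apply/matrixP => i j; rewrite !mxE.
rewrite (_ : (fun k => _) = fun k => \sum_l B i l * A k l j); last first.
  by apply/funext => k; rewrite mxE.
rewrite (@PS_sum _ (fun l k => B i l * A k l j) r) => //.
  by apply: eq_bigr => l _; rewrite mxE (PSZ _ (mcvg_entry l j hA) zr).
by move=> l; apply: pscvgZ; exact: mcvg_entry.
Qed.

Lemma mPSMr m n p (B : 'M[C]_(n, p)) (A : nat -> 'M[C]_(m, n)) r z : mcvg A r -> cmod z < r ->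
  mPS (fun k => A k *m B) z = mPS A z *m B.
Proof.
move=> hA zr; have [r0 _] := hA; apply/matrixP => i j; rewrite !mxE.
rewrite (_ : (fun k => _) = fun k => \sum_l B l j * A k i l); last first.
  by apply/funext => k; rewrite mxE; apply: eq_bigr => l _; rewrite mulrC.
rewrite (@PS_sum _ (fun l k => B l j * A k i l) r) => //.
  by apply: eq_bigr => l _; rewrite mxE (PSZ _ (mcvg_entry i l hA) zr) mulrC.
by move=> l; apply: pscvgZ; exact: mcvg_entry.
Qed.

Lemma mPS_shift m n (A : nat -> 'M[C]_(m, n)) r z : mcvg A r -> cmod z < r ->
  mPS (mshift A) z = z *: mPS A z.
Proof.
move=> hA zr; apply/matrixP => i j; rewrite !mxE -(PS_shift (mcvg_entry i j hA) zr).
by congr (PS _ _); apply/funext => -[|k]; rewrite //= mxE.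
Qed.

Lemma mPS_deriv m n (A : nat -> 'M[C]_(m, n)) r z : mcvg A r -> cmod z < r ->
  mderiv (mPS A) z (mPS (mder A) z).
Proof.
move=> hA zr i j.
have E1 : (fun w => mPS A w i j) = PS (fun k => A k i j).
  by apply/funext => w; rewrite mPSE.
have E2 : mPS (mder A) z i j = PS (psder (fun k => A k i j)) z.
  by rewrite mPSE; congr (PS _ _); apply/funext => k; rewrite mxE.
by have := PS_cderiv (mcvg_entry i j hA) zr; rewrite -E1 -E2.
Qed.

Lemma mPS0 m n (A : nat -> 'M[C]_(m, n)) : mPS A 0 = A 0%N.
Proof. by apply/matrixP => i j; rewrite mxE PS0. Qed.

Lemma mcvg_der m n (A : nat -> 'M[C]_(m, n)) r r' : 0 < r' -> r' < r -> mcvg A r ->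
  mcvg (mder A) r'.
Proof.
move=> r'0 rr hA.
have hij i j : exists K, forall k, cmod (mder A k i j) * r' ^+ k <= K.
  have [_ [K hK]] := pscvg_psder r'0 rr (mcvg_entry i j hA).
  by exists K => k; have := hK k; rewrite /psder /mder mxE.
pose K i j := sval (cid (hij i j)).
split => //; exists (\sum_i \sum_j K i j) => k.
rewrite /mnorm mulr_suml; apply: ler_sum => i _; rewrite mulr_suml; apply: ler_sum => j _.
exact: (svalP (cid (hij i j))).
Qed.

End MatrixCalculus.

(** * Uniqueness for linear differential equations along a segment *)

Section Gronwall.
Variable R : realType.
Local Notation C := (complexField R).
Implicit Types (x y z w h d v p : C) (r e K : R).

Lemma is_derive_eps (g : R -> R) (s d : R) :
  (forall e, 0 < e -> exists2 dl, 0 < dl & forall h : R, `|h| < dl ->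
     `|g (s + h) - g s - d * h| <= e * `|h|) ->
  is_derive s 1 g d.
Proof.
move=> H.
have lim : (fun h : R => h^-1 *: ((g \o shift s) (h *: 1) - g s)) @ 0^' --> d.
  apply/cvgrPdist_lt => e e0; have [dl dl0 hd] := H _ (halfR_gt0 e0).
  rewrite near_withinE; apply/nbhs_ballP; exists dl => //= h.
  rewrite -ball_normE /= sub0r normrN => /hd {}hd h0.
  rewrite distrC /GRing.scale /= mulr1 [h + s]addrC.
  rewrite (_ : _ - d = h^-1 * (g (s + h) - g s - d * h)); last by field.
  rewrite normrM normfV mulrC ltr_pdivrMr ?normr_gt0//.
  by apply: le_lt_trans hd _; rewrite ltr_pM2r ?normr_gt0//; lra.
by apply: DeriveDef; [apply/cvg_ex; exists d|exact: cvg_lim].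
Qed.

Lemma cderiv_along f p v (s : R) d : cderiv f (p + toC s * v) d ->
  is_derive s 1 (fun s => cRe (f (p + toC s * v))) (cRe (v * d)) /\
  is_derive s 1 (fun s => cIm (f (p + toC s * v))) (cIm (v * d)).
Proof.
move=> hf.
have H e : 0 < e -> exists2 dl, 0 < dl & forall h : R, `|h| < dl ->
    cmod (f (p + toC (s + h) * v) - f (p + toC s * v) - v * d * toC h) <= e * `|h|.
  move=> e0; have v0 : 0 < cmod v + 1 by have := cmod_ge0 v; lra.
  have [dl dl0 hd] := hf _ (divr_gt0 e0 v0); exists (dl / (cmod v + 1)); first exact: divr_gt0.
  move=> h hh; have hv : cmod (toC h * v) <= `|h| * (cmod v + 1).
    by rewrite cmodM cmod_toC ler_wpM2l// lerDl.
  have := hd (toC h * v).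
  rewrite (_ : p + toC s * v + toC h * v = p + toC (s + h) * v); last by rewrite toCD; ring.
  rewrite (_ : d * (toC h * v) = v * d * toC h); last by ring.
  rewrite ltr_pdivlMr// in hh.
  move=> /(_ (le_lt_trans hv hh)) h1; apply: le_trans h1 _.
  apply: le_trans (ler_wpM2l _ hv) _; first by rewrite divr_ge0 ?ltW.
  by rewrite mulrCA mulrC divfK// gt_eqF.
split; apply: is_derive_eps => e /H[dl dl0 hd]; exists dl => // h /hd {}hd; apply: le_trans hd.
  apply: le_trans (cRe_le _); rewrite !cReB [cRe (_ * toC h)]cReM cIm_toC mulr0 subr0.
  by [].
apply: le_trans (cIm_le _); rewrite !cImB [cIm (_ * toC h)]cImM cIm_toC mulr0 add0r.
by [].
Qed.

(** [expR (- c * s) * N s] has a nonpositive derivative and vanishes at 0. *)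
Lemma real_gronwall (N dN : R -> R) (c : R) :
  (forall s : R, s \in `[0, 1] -> is_derive s 1 N (dN s)) ->
  (forall s : R, s \in `[0, 1] -> dN s <= c * N s) -> N 0 = 0 -> N 1 <= 0.
Proof.
move=> hN hc N0.
pose F s := expR (- c * s) * N s.
have hF (s : R) : s \in `[0, 1] -> is_derive s 1 F (expR (- c * s) * (dN s - c * N s)).
  move=> /hN Hs.
  have hE : is_derive s 1 (fun s => expR (- c * s)) (expR (- c * s) * - c).
    have h1 : is_derive s 1 (fun s : R => - c * s) (- c).
      have := @is_deriveZ _ _ _ id (- c) s 1 1 (is_derive_id _ _).
      by rewrite /GRing.scale /= mulr1.
    have := @is_derive1_comp _ expR (fun s => - c * s) s _ _ (is_derive_expR _) h1.
    by [].
  have := is_deriveM hE Hs; rewrite /GRing.scale /=.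
  by rewrite (_ : _ + _ = expR (- c * s) * (dN s - c * N s))//; ring.
have cF : {within `[0, 1], continuous F}.
  by apply: derivable_within_continuous => s /hF[].
have oc (s : R) : s \in `]0, 1[ -> s \in `[0, 1].
  by rewrite !in_itv /= => /andP[h1 h2]; rewrite !ltW.
have [s s01] := @MVT R F (fun s => expR (- c * s) * (dN s - c * N s)) 0 1 ltr01
  (fun s s01 => hF s (oc s s01)) cF.
rewrite /F N0 mulr0 subr0 subr0 !mulr1 => E.
have s01' := oc s s01.
have : expR (- c) * N 1 <= 0.
  by rewrite E pmulr_rle0 ?expR_gt0// subr_le0 hc.
by rewrite pmulr_rle0 ?expR_gt0.
Qed.

Lemma is_derive_sum_pt n (F : 'I_n -> R -> R) (D : 'I_n -> R) (s : R) :
  (forall i, is_derive s 1 (F i) (D i)) -> is_derive s 1 (fun t => \sum_i F i t) (\sum_i D i).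
Proof.
elim: n F D => [|n IH] F D h.
  rewrite big_ord0 (_ : (fun t => _) = cst 0); first exact: is_derive_cst.
  by apply/funext => t; rewrite big_ord0.
rewrite big_ord_recl (_ : (fun t => _) = F ord0 + (fun t => \sum_i F (lift ord0 i) t)).
  exact: is_deriveD (h ord0) (IH _ _ (fun i => h (lift ord0 i))).
by apply/funext => t; rewrite big_ord_recl.
Qed.

Lemma is_derive_sqr_pt (f : R -> R) (s d : R) :
  is_derive s 1 f d -> is_derive s 1 (fun t => f t ^+ 2) (2 * (f s * d)).
Proof.
move=> h; have := is_deriveM h h.
rewrite /GRing.scale /= (_ : _ + _ = 2 * (f s * d)); last by ring.
by rewrite (_ : (f * f)%R = fun t => f t ^+ 2)//; apply/funext => t; rewrite expr2.
Qed.

(** Gronwall's inequality for the squared length of column [j] along the segment. Only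
    differentiability at the points of the segment is used, so the lemma applies on any domain that
    contains it. *)
Lemma ode_unique0 n m (G : C -> 'M[C]_n) (Y : C -> 'M[C]_(n, m)) p v K :
  (forall s : R, s \in `[0, 1] ->
    mderiv Y (p + toC s * v) (G (p + toC s * v) *m Y (p + toC s * v))) ->
  (forall s : R, s \in `[0, 1] -> mnorm (G (p + toC s * v)) <= K) ->
  Y p = 0 -> Y (p + v) = 0.
Proof.
move=> hY hG Yp; apply/matrixP => i j; rewrite mxE.
pose g k s := Y (p + toC s * v) k j.
pose N s := \sum_k (cRe (g k s) ^+ 2 + cIm (g k s) ^+ 2).
pose dg k s := v * (G (p + toC s * v) *m Y (p + toC s * v)) k j.
pose dN s := \sum_k (2 * (cRe (g k s) * cRe (dg k s) + cIm (g k s) * cIm (dg k s))).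
have K0 : 0 <= K by apply: le_trans (hG 0 _); rewrite ?mnorm_ge0// in_itv /= lexx ler01.
suff : N 1 <= 0.
  rewrite /N => h; apply/eqP; rewrite -cmod_eq0 -sqrf_eq0 eq_le sqr_ge0 andbT.
  apply: le_trans h; rewrite (bigD1 i)//= /g toC1 mul1r -cmod_sqr lerDl.
  by apply: sumr_ge0 => k _; rewrite addr_ge0 ?sqr_ge0.
(* The factor [n] comes from [(\sum_k |g_k|)^2 <= n \sum_k |g_k|^2], the other factors from the
   bound of [G] and the direction [v]. *)
apply: (@real_gronwall N dN (2 * (cmod v * K * n%:R))) => [s s01|s s01|].
- apply: is_derive_sum_pt => k.
  have [h1 h2] := cderiv_along (hY s s01 k j).
  rewrite mulrDr; exact: is_deriveD (is_derive_sqr_pt h1) (is_derive_sqr_pt h2).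
- have dgb k : cmod (dg k s) <= cmod v * K * \sum_l cmod (g l s).
    rewrite /dg mxE cmodM -mulrA ler_wpM2l ?cmod_ge0//.
    apply: le_trans (cmod_sum _ _ _) _; rewrite mulr_sumr; apply: ler_sum => l _.
    by rewrite cmodM ler_wpM2r ?cmod_ge0//; apply: le_trans (mnorm_entry _ _ _) (hG s s01).
  set S := \sum_l _ in dgb.
  apply: (@le_trans _ _ (\sum_k 2 * (cmod (g k s) * (cmod v * K * S)))).
    apply: ler_sum => k _; rewrite ler_pM2l//.
    apply: (@le_trans _ _ (cmod (g k s) * cmod (dg k s))); last by rewrite ler_wpM2l ?cmod_ge0.
    exact: cdot_le.
  rewrite -mulr_sumr -mulr_suml -/S -!mulrA ler_pM2l//.
  rewrite [S * _]mulrCA ler_wpM2l ?cmod_ge0// [S * _]mulrCA ler_wpM2l//.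
  rewrite /S /N mulr_suml.
  apply: (@le_trans _ _ (\sum_k \sum_l (cmod (g k s) ^+ 2 + cmod (g l s) ^+ 2) / 2)).
    apply: ler_sum => k _; rewrite mulr_sumr; apply: ler_sum => l _.
    by have := sqr_ge0 (cmod (g k s) - cmod (g l s)); rewrite sqrrB; lra.
  under eq_bigr do rewrite -mulr_suml big_split /= sumr_const card_ord.
  rewrite -mulr_suml big_split /= sumr_const card_ord -sumrMnl.
  under [X in n%:R * X]eq_bigr do rewrite -cmod_sqr.
  by rewrite mulr_natl -sumrMnl; lra.
- rewrite /N big1// => k _; rewrite /g toC0 mul0r addr0 Yp mxE.
  by rewrite cRe0 cIm0 expr0n addr0.
Qed.

Lemma ode_unique n m (G : C -> 'M[C]_n) (Y Z : C -> 'M[C]_(n, m)) p q K :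
  (forall s : R, s \in `[0, 1] ->
    mderiv Y (p + toC s * (q - p)) (G (p + toC s * (q - p)) *m Y (p + toC s * (q - p)))) ->
  (forall s : R, s \in `[0, 1] ->
    mderiv Z (p + toC s * (q - p)) (G (p + toC s * (q - p)) *m Z (p + toC s * (q - p)))) ->
  (forall s : R, s \in `[0, 1] -> mnorm (G (p + toC s * (q - p))) <= K) ->
  Y p = Z p -> Y q = Z q.
Proof.
move=> hY hZ hK YZ; apply/eqP; rewrite -subr_eq0; apply/eqP.
have := @ode_unique0 _ _ G (fun w => Y w - Z w) p (q - p) K; rewrite [p + (q - p)]addrC subrK.
apply => //; last by rewrite YZ subrr.
by move=> s s01; rewrite mulmxBr; apply: mderivB; [exact: hY|exact: hZ].
Qed.

End Gronwall.

(** * Power series solutions at regular and singular points *)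

Section SeriesSolutions.
Variable R : realType.
Local Notation C := (complexField R).
Implicit Types (x y z w h d u t : C) (r e K : R).

(** One convergence criterion for all the series below: [a] measures the coefficients of the
    solution and [v] those of its quotient by [t] or [t - lam]. For large [n] the first inequality
    turns [v n r^n <= K1] into [a (n+1) r^(n+1) <= k K1], and the second one then reproduces the
    bound for [v] because [c k + r = r0]. *)
Lemma majorant (a v : nat -> R) (c r r0 : R) : 0 < c -> 0 < r -> r < r0 ->
  (forall n, 0 <= a n) -> (forall n, 0 <= v n) ->
  (forall n, (n.+1%:R - c) * a n.+1 <= c * v n) ->
  (forall n, r0 * v n.+1 <= c * a n.+1 + v n) ->
  exists K, forall n, a n * r ^+ n <= K /\ v n * r ^+ n <= K.
Proof.
move=> c0 r_0 rr a0 v0 ha hv.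
set k := (r0 - r) / c; have k0 : 0 < k by rewrite /k divr_gt0//; lra.
have ck : c * k = r0 - r by rewrite /k mulrC divfK// gt_eqF.
have [n0 hn0] : exists n0 : nat, c + c * r / k <= n0%:R.
  exists (Num.bound (c + c * r / k)); apply/ltW/archi_boundP.
  by rewrite addr_ge0 ?ltW// divr_gt0// mulr_gt0.
set K1 := v n0 * r ^+ n0.
have K10 : 0 <= K1 by rewrite mulr_ge0// exprn_ge0// ltW.
have pa n : 0 <= a n * r ^+ n by rewrite mulr_ge0// exprn_ge0// ltW.
have pv n : 0 <= v n * r ^+ n by rewrite mulr_ge0// exprn_ge0// ltW.
have stepa n : (n0 <= n)%N -> v n * r ^+ n <= K1 -> a n.+1 * r ^+ n.+1 <= k * K1.
  move=> nn hK; have nc : c * r / k <= n.+1%:R - c.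
    have h1 : (n0%:R : R) <= n.+1%:R by rewrite ler_nat leqW.
    by rewrite lerBrDl; apply: le_trans hn0 h1.
  have nc0 : 0 < n.+1%:R - c by apply: lt_le_trans nc; rewrite divr_gt0// mulr_gt0.
  rewrite ler_pdivrMr// in nc.
  rewrite -(ler_pM2l nc0) mulrA.
  apply: (@le_trans _ _ (c * v n * r ^+ n.+1)).
    by rewrite ler_wpM2r ?exprn_ge0 ?(ltW r_0)//; exact: ha.
  rewrite exprS (_ : _ * _ = c * r * (v n * r ^+ n)); last by ring.
  have cr0 : 0 <= c * r by rewrite mulr_ge0// ltW.
  by rewrite [leRHS]mulrA; exact: (ler_pM cr0 (pv n) nc hK).
have main n : (n0 <= n)%N -> v n * r ^+ n <= K1.
  elim: n => [|n IH]; first by rewrite leqn0 => /eqP n00; rewrite /K1 n00.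
  rewrite leq_eqVlt => /orP[/eqP nn|]; first by rewrite /K1 nn.
  rewrite ltnS => nn; have h1 := IH nn; have h2 := stepa n nn h1.
  have r00 : 0 < r0 by lra.
  rewrite -(ler_pM2l r00) mulrA.
  apply: (@le_trans _ _ ((c * a n.+1 + v n) * r ^+ n.+1)).
    by rewrite ler_wpM2r ?exprn_ge0 ?(ltW r_0)//; exact: hv.
  rewrite mulrDl -mulrA.
  apply: (@le_trans _ _ (c * (k * K1) + r * K1)).
    apply: lerD; first by rewrite ler_pM2l.
    by rewrite exprS mulrCA ler_pM2l.
  by rewrite mulrA ck -mulrDl subrK.
exists (\sum_(i < n0.+1) (a i * r ^+ i + v i * r ^+ i) + (K1 + k * K1)) => n.
have kK : 0 <= k * K1 by rewrite mulr_ge0// ltW.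
have S0 : 0 <= \sum_(i < n0.+1) (a i * r ^+ i + v i * r ^+ i).
  by apply: sumr_ge0 => i _; rewrite addr_ge0.
have [nn|nn] := ltnP n n0.+1.
  have : a n * r ^+ n + v n * r ^+ n <= \sum_(i < n0.+1) (a i * r ^+ i + v i * r ^+ i).
    by rewrite (bigD1 (Ordinal nn))//= lerDl; apply: sumr_ge0 => i _; rewrite addr_ge0.
  by have := pa n; have := pv n; split; lra.
case: n nn => [//|n]; rewrite ltnS => nn.
have := main n.+1 (leqW nn); have := stepa n nn (main n nn); split; lra.
Qed.

Lemma rec_seq (T : Type) (x0 : T) (f : nat -> T -> T) :
  exists x : nat -> T, x 0%N = x0 /\ forall n, x n.+1 = f n (x n).
Proof. by exists (fix x n := if n is n'.+1 then f n' (x n') else x0). Qed.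

(** The system [theta y = (M + t / (t - lam) D) y] divided by [t]: the residues are [M] at 0 and [D]
    at [lam]. *)
Definition fuchs n (M D : 'M[C]_n) (lam t : C) : 'M[C]_n := t^-1 *: M + (t - lam)^-1 *: D.

Lemma fuchs_mul n m (M D : 'M[C]_n) (lam t : C) (X : 'M[C]_(n, m)) :
  fuchs M D lam t *m X = t^-1 *: (M *m X) + (t - lam)^-1 *: (D *m X).
Proof. by rewrite /fuchs mulmxDl -!scalemxAl. Qed.

(* The auxiliary series [U = Y / t] and [V = Y / (t - lam)] turn the equation into
   [Y' = M U + D V] and replace Cauchy products by two-term recurrences. *)
Lemma regular_point_series n m (M D : 'M[C]_n) (lam p : C) (Y0 : 'M[C]_(n, m)) :
  p != 0 -> p != lam ->
  exists Y : nat -> 'M[C]_(n, m), Y 0%N = Y0 /\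
    forall r, 0 < r -> r < cmod p -> r < cmod (p - lam) -> mcvg Y r /\
      forall u, cmod u < r -> mderiv (mPS Y) u (fuchs M D lam (p + u) *m mPS Y u).
Proof.
move=> p0 pl; have pl0 : p - lam != 0 by rewrite subr_eq0.
pose step k (x : 'M[C]_(n, m) * 'M[C]_(n, m) * 'M[C]_(n, m)) :=
  let y := k.+1%:R^-1 *: (M *m x.1.2 + D *m x.2) in
  (y, p^-1 *: (y - x.1.2), (p - lam)^-1 *: (y - x.2)).
have [x [x0 xS]] := rec_seq (Y0, p^-1 *: Y0, (p - lam)^-1 *: Y0) step.
pose Y k := (x k).1.1; pose U k := (x k).1.2; pose V k := (x k).2.
have YS k : k.+1%:R *: Y k.+1 = M *m U k + D *m V k.
  by rewrite /Y xS /= scalerA divff ?scale1r// pnatr_eq0.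
have US k : p *: U k + mshift U k = Y k.
  case: k => [|k]; rewrite /Y /U ?x0 ?xS /= ?addr0 !scalerA divff// scale1r//.
  by rewrite subrK.
have VS k : (p - lam) *: V k + mshift V k = Y k.
  case: k => [|k]; rewrite /Y /V ?x0 ?xS /= ?addr0 !scalerA divff// scale1r//.
  by rewrite subrK.
exists Y; split; first by rewrite /Y x0.
move=> r r0 rp rpl.
set r1 := Num.min (cmod p) (cmod (p - lam)).
have rr1 : r < r1 by rewrite lt_min rp.
have r1p : r1 <= cmod p by rewrite ge_min lexx.
have r1l : r1 <= cmod (p - lam) by rewrite ge_min lexx orbT.
(* The 2 comes from adding the inequalities for [U] and for [V], each of which contributes one
   [mnorm (Y k.+1)]. *)
set c := 2 + mnorm M + mnorm D.
have M0 := mnorm_ge0 M; have D0 := mnorm_ge0 D.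
have c0 : 0 < c by rewrite /c; lra.
have aux (z : C) (W : nat -> 'M[C]_(n, m)) k : r1 <= cmod z ->
  z *: W k.+1 + W k = Y k.+1 -> r1 * mnorm (W k.+1) <= mnorm (Y k.+1) + mnorm (W k).
  move=> rz E; apply: (@le_trans _ _ (mnorm (z *: W k.+1))).
    by rewrite mnormZ ler_wpM2r ?mnorm_ge0.
  by rewrite (_ : z *: _ = Y k.+1 - W k) ?mnormB// -E addrK.
have [K hK] := @majorant (fun k => mnorm (Y k)) (fun k => mnorm (U k) + mnorm (V k)) c r r1
  c0 r0 rr1 (fun k => mnorm_ge0 _) (fun k => addr_ge0 (mnorm_ge0 _) (mnorm_ge0 _))
  ltac:(move=> k; have hY := mnorm_ge0 (Y k.+1); have hU := mnorm_ge0 (U k);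
    have hV := mnorm_ge0 (V k);
    apply: (@le_trans _ _ (mnorm (k.+1%:R *: Y k.+1)));
    [by rewrite mnormZ cmod_nat; rewrite ler_wpM2r//; lra|
     rewrite YS; apply: (le_trans (mnormD _ _));
     have := mnormM M (U k); have := mnormM D (V k); rewrite /c => h1 h2; nra])
  ltac:(move=> k; have h1 := aux _ U k r1p (US k.+1); have h2 := aux _ V k r1l (VS k.+1);
    have := mulr_ge0 M0 (mnorm_ge0 (Y k.+1)); have := mulr_ge0 D0 (mnorm_ge0 (Y k.+1));
    rewrite /c; lra).
have hY : mcvg Y r by split => //; exists K => k; case: (hK k).
have hU : mcvg U r.
  split => //; exists K => k; case: (hK k) => _; apply: le_trans.
  by rewrite ler_wpM2r ?exprn_ge0 ?(ltW r0)// lerDl mnorm_ge0.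
have hV : mcvg V r.
  split => //; exists K => k; case: (hK k) => _; apply: le_trans.
  by rewrite ler_wpM2r ?exprn_ge0 ?(ltW r0)// lerDr mnorm_ge0.
split=> // u ur.
have nz (q : C) : r < cmod q -> q + u != 0.
  move=> rq; apply/eqP => /eqP; rewrite addr_eq0 => /eqP E.
  by move: rq; rewrite E cmodN; lra.
have quot (W : nat -> 'M[C]_(n, m)) (q : C) : mcvg W r -> r < cmod q ->
    (forall k, q *: W k + mshift W k = Y k) -> mPS W u = (q + u)^-1 *: mPS Y u.
  move=> hW rq WS; apply: (scalerI (nz _ rq)); rewrite scalerA divff ?nz// scale1r.
  rewrite (_ : Y = fun k => q *: W k + mshift W k); last by apply/funext => k; rewrite WS.
  by rewrite (mPSD (mcvgZ q hW) (mcvg_shift hW) ur) (mPSZ _ hW ur) (mPS_shift hW ur) scalerDl.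
have := mPS_deriv hY ur.
rewrite (_ : mder Y = fun k => M *m U k + D *m V k); last first.
  by apply/funext => k; rewrite /mder YS.
rewrite (mPSD (mcvgMl M hU) (mcvgMl D hV) ur) (mPSMl M hU ur) (mPSMl D hV ur).
rewrite (quot U p hU rp US) (quot V _ hV rpl VS) fuchs_mul -!scalemxAr.
by rewrite [p + u - lam]addrAC.
Qed.

(** An injective endomorphism of the space of matrices is onto; [L] is its matrix under [mxvec]. *)
Lemma sylvester_solve n (M W : 'M[C]_n) (c : C) :
  (forall H : 'M[C]_n, c *: H + H *m M - M *m H = 0 -> H = 0) ->
  exists H : 'M[C]_n, c *: H + H *m M - M *m H = W.
Proof.
move=> inj; pose L := c%:M + lin_mulmxr M - lin_mulmx M.
have LE (H : 'M[C]_n) : mxvec H *m L = mxvec (c *: H + H *m M - M *m H).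
  rewrite mulmxBr mulmxDr mul_mx_scalar !mul_vec_lin /= (linearB mxvec) (linearD mxvec).
  by rewrite linearZ.
have Lu : L \in unitmx.
  rewrite -row_free_unit -kermx_eq0; apply/eqP/row_matrixP => i; rewrite row0.
  have : row i (kermx L) *m L = 0 by rewrite -row_mul mulmx_ker row0.
  rewrite -[row i _]vec_mxK LE => /(congr1 vec_mx); rewrite mxvecK linear0 => /inj ->.
  by rewrite linear0.
exists (vec_mx (mxvec W *m invmx L)); apply: (can_inj mxvecK).
by rewrite -LE vec_mxK mulmxKV.
Qed.

(** The ansatz [H(t) t^M]. With [V = H / (t - lam)] each degree is a Sylvester equation for
    [H k.+1]; its homogeneous form has only the zero solution when no two eigenvalues of [M] differ
    by a positive integer. *)
Lemma frobenius_series n (M D : 'M[C]_n) (lam : C) : lam != 0 ->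
  (forall k (H : 'M[C]_n), k.+1%:R *: H + H *m M - M *m H = 0 -> H = 0) ->
  exists H V : nat -> 'M[C]_n, [/\ H 0%N = 1%:M,
    forall k, k.+1%:R *: H k.+1 + H k.+1 *m M - M *m H k.+1 = D *m V k,
    forall k, mshift V k - lam *: V k = H k &
    forall r, 0 < r -> r < cmod lam -> mcvg H r /\
      forall t, cmod t < r ->
        t *: mPS (mder H) t + mPS H t *m M = (M + (t / (t - lam)) *: D) *m mPS H t].
Proof.
move=> lam0 inj.
pose slv k W := sval (cid (@sylvester_solve n M W k.+1%:R (inj k))).
have slvP k W : k.+1%:R *: slv k W + slv k W *m M - M *m slv k W = W.
  exact: svalP (cid (@sylvester_solve n M W k.+1%:R (inj k))).
pose step k (x : 'M[C]_n * 'M[C]_n) :=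
  let y := slv k (D *m x.2) in (y, lam^-1 *: (x.2 - y)).
have [x [x0 xS]] := rec_seq (1%:M, - lam^-1 *: 1%:M) step.
pose H k := (x k).1; pose V k := (x k).2.
have HS k : k.+1%:R *: H k.+1 + H k.+1 *m M - M *m H k.+1 = D *m V k.
  by rewrite /H xS /= slvP.
have VS k : mshift V k - lam *: V k = H k.
  case: k => [|k]; rewrite /V /H ?x0 ?xS /= scalerA ?mulrN divff//.
    by rewrite sub0r scaleN1r opprK.
  by rewrite scale1r opprB addrC subrK.
have bd r : 0 < r -> r < cmod lam -> mcvg H r /\ mcvg V r.
  move=> r0 rl; set c := 1 + 2 * mnorm M + mnorm D.
  have M0 := mnorm_ge0 M; have D0 := mnorm_ge0 D.
  have c0 : 0 < c by rewrite /c; lra.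
  have Ha k : (k.+1%:R - c) * mnorm (H k.+1) <= c * mnorm (V k).
    have hH := mnorm_ge0 (H k.+1); have hV := mnorm_ge0 (V k).
    have h1 := mnormM (H k.+1) M; have h2 := mnormM M (H k.+1); have h3 := mnormM D (V k).
    have : k.+1%:R * mnorm (H k.+1) <= mnorm D * mnorm (V k) + 2 * (mnorm M * mnorm (H k.+1)).
      rewrite -[k.+1%:R]cmod_nat -mnormZ.
      rewrite (_ : k.+1%:R *: _ = D *m V k - H k.+1 *m M + M *m H k.+1).
        have := mnormD (D *m V k - H k.+1 *m M) (M *m H k.+1).
        by have := mnormB (D *m V k) (H k.+1 *m M); lra.
      by rewrite -HS addrAC subrK addrK.
    by rewrite /c; nra.
  have Hv k : cmod lam * mnorm (V k.+1) <= c * mnorm (H k.+1) + mnorm (V k).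
    rewrite -mnormZ (_ : lam *: _ = V k - H k.+1).
      have := mnormB (V k) (H k.+1); have := mulr_ge0 M0 (mnorm_ge0 (H k.+1)).
      by have := mulr_ge0 D0 (mnorm_ge0 (H k.+1)); rewrite /c; lra.
    by rewrite -VS /= opprB addrC subrK.
  have [K hK] := majorant c0 r0 rl (fun k => mnorm_ge0 _) (fun k => mnorm_ge0 _) Ha Hv.
  by split; split => //; exists K => k; case: (hK k).
exists H, V; split => //; first by rewrite /H x0.
move=> r r0 rl; have [hH hV] := bd r r0 rl.
split => // t tr.
have tl : t - lam != 0.
  by rewrite subr_eq0; apply: contraTneq rl => <-; rewrite -leNgt ltW.
have hd : mcvg (mder H) r.
  have rl1 : 0 < (r + cmod lam) / 2 by lra.
  have rl2 : (r + cmod lam) / 2 < cmod lam by lra.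
  have rl3 : r < (r + cmod lam) / 2 by lra.
  exact: mcvg_der r0 rl3 (bd _ rl1 rl2).1.
have VH : mPS V t = (t - lam)^-1 *: mPS H t.
  apply: (scalerI tl); rewrite scalerA divff// scale1r.
  rewrite (_ : H = fun k => mshift V k + (- lam) *: V k); last first.
    by apply/funext => k; rewrite -VS scaleNr.
  rewrite (mPSD (mcvg_shift hV) (mcvgZ _ hV) tr) (mPSZ _ hV tr) (mPS_shift hV tr).
  by rewrite scalerBl scaleNr.
rewrite -(mPS_shift hd tr) -(mPSMr M hH tr) -(mPSD (mcvg_shift hd) (mcvgMr M hH) tr).
rewrite (_ : (fun k => _) = fun k => M *m H k + D *m mshift V k); last first.
  apply/funext => -[|k] /=; first by rewrite /H x0 mulmx0 add0r addr0 mul1mx mulmx1.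
  by rewrite /mder -HS addrCA subrr addr0.
rewrite (mPSD (mcvgMl M hH) (mcvgMl D (mcvg_shift hV)) tr) (mPSMl M hH tr).
rewrite (mPSMl D (mcvg_shift hV) tr) (mPS_shift hV tr) VH scalerA.
by rewrite mulmxDl -scalemxAl scalemxAr.
Qed.

(** A holomorphic solution at [lam] must start in the kernel of the residue [D], and each later
    coefficient is then determined through the inverse of [k.+1 - D]. The centre [u = 0] is excluded
    from the equation because the coefficient matrix has its pole there. *)
Lemma apparent_point_series n m (M D : 'M[C]_n) (lam : C) (Z : 'M[C]_(n, m)) : lam != 0 ->
  (forall k, k.+1%:R%:M - D \in unitmx) -> D *m Z = 0 ->
  exists Y : nat -> 'M[C]_(n, m), Y 0%N = Z /\
    forall r, 0 < r -> r < cmod lam -> mcvg Y r /\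
      forall u, u != 0 -> cmod u < r ->
        mderiv (mPS Y) u (fuchs M D lam (lam + u) *m mPS Y u).
Proof.
move=> lam0 Du DZ.
pose step k (x : 'M[C]_(n, m) * 'M[C]_(n, m)) :=
  let y := invmx (k.+1%:R%:M - D) *m (M *m x.2) in (y, lam^-1 *: (y - x.2)).
have [x [x0 xS]] := rec_seq (Z, lam^-1 *: Z) step.
pose Y k := (x k).1; pose V k := (x k).2.
have YS k : k.+1%:R *: Y k.+1 = M *m V k + D *m Y k.+1.
  apply/eqP; rewrite -subr_eq -mul_scalar_mx -mulmxBl; apply/eqP.
  by rewrite /Y xS /= mulmxA mulmxV// mul1mx.
have VS k : lam *: V k + mshift V k = Y k.
  case: k => [|k]; rewrite /V /Y ?x0 ?xS /= scalerA divff ?scale1r ?addr0//.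
  by rewrite subrK.
have bd r : 0 < r -> r < cmod lam -> mcvg Y r /\ mcvg V r.
  move=> r0 rl; set c := 1 + mnorm M + mnorm D.
  have M0 := mnorm_ge0 M; have D0 := mnorm_ge0 D.
  have c0 : 0 < c by rewrite /c; lra.
  have Ha k : (k.+1%:R - c) * mnorm (Y k.+1) <= c * mnorm (V k).
    have hY := mnorm_ge0 (Y k.+1); have hV := mnorm_ge0 (V k).
    have h2 := mnormM M (V k); have h3 := mnormM D (Y k.+1).
    have : k.+1%:R * mnorm (Y k.+1) <= mnorm M * mnorm (V k) + mnorm D * mnorm (Y k.+1).
      rewrite -[k.+1%:R]cmod_nat -mnormZ YS.
      by have := mnormD (M *m V k) (D *m Y k.+1); lra.
    by rewrite /c; nra.
  have Hv k : cmod lam * mnorm (V k.+1) <= c * mnorm (Y k.+1) + mnorm (V k).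
    rewrite -mnormZ (_ : lam *: _ = Y k.+1 - V k).
      have := mnormB (Y k.+1) (V k); have := mulr_ge0 M0 (mnorm_ge0 (Y k.+1)).
      by have := mulr_ge0 D0 (mnorm_ge0 (Y k.+1)); rewrite /c; lra.
    by rewrite -VS /= addrK.
  have [K hK] := majorant c0 r0 rl (fun k => mnorm_ge0 _) (fun k => mnorm_ge0 _) Ha Hv.
  by split; split => //; exists K => k; case: (hK k).
exists Y; split; first by rewrite /Y x0.
move=> r r0 rl; have [hY hV] := bd r r0 rl; split => // u u0 ur.
have lu : lam + u != 0.
  apply/eqP => /eqP; rewrite addr_eq0 => /eqP E.
  by move: rl; rewrite E cmodN; lra.
have hd : mcvg (mder Y) r.
  have rl1 : 0 < (r + cmod lam) / 2 by lra.
  have rl2 : (r + cmod lam) / 2 < cmod lam by lra.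
  have rl3 : r < (r + cmod lam) / 2 by lra.
  exact: mcvg_der r0 rl3 (bd _ rl1 rl2).1.
have VY : mPS V u = (lam + u)^-1 *: mPS Y u.
  apply: (scalerI lu); rewrite scalerA divff// scale1r.
  rewrite (_ : Y = fun k => lam *: V k + mshift V k); last first.
    by apply/funext => k; rewrite VS.
  by rewrite (mPSD (mcvgZ _ hV) (mcvg_shift hV) ur) (mPSZ _ hV ur) (mPS_shift hV ur) scalerDl.
suff E : u *: mPS (mder Y) u = u *: (M *m mPS V u) + D *m mPS Y u.
  have := mPS_deriv hY ur.
  rewrite (_ : mPS (mder Y) u = fuchs M D lam (lam + u) *m mPS Y u)//.
  apply: (scalerI u0); rewrite E VY fuchs_mul [lam + u - lam]addrAC subrr add0r.
  move: (mPS Y u) => PY.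
  by rewrite scalerDr -(scalemxAr (lam + u)^-1 M PY) (scalerA u u^-1) divff// scale1r.
rewrite -(mPS_shift hd ur) -(mPSMl M hV ur) -(mPS_shift (mcvgMl M hV) ur) -(mPSMl D hY ur).
rewrite -(mPSD (mcvg_shift (mcvgMl M hV)) (mcvgMl D hY) ur).
congr (mPS _ _); apply/funext => -[|k] /=; first by rewrite /Y x0 DZ addr0.
exact: YS.
Qed.

(** The coefficients [M^k / k!] of [exp (z M)]; in recursive form their growth falls under
    [majorant]. *)
Fixpoint mexp_coef n (M : 'M[C]_n) k : 'M[C]_n :=
  if k is k'.+1 then k'.+1%:R^-1 *: (M *m mexp_coef M k') else 1%:M.

Definition mexp n (M : 'M[C]_n) z := mPS (mexp_coef M) z.

Lemma mexp_coef_cvg n (M : 'M[C]_n) r : 0 < r -> mcvg (mexp_coef M) r.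
Proof.
move=> r0; have r1 : r < r + 1 by lra.
set c := mnorm M + r + 1; have M0 := mnorm_ge0 M; have c0 : 0 < c by rewrite /c; lra.
pose a k := mnorm (mexp_coef M k).
have a0 k : 0 <= a k by exact: mnorm_ge0.
have Ha k : (k.+1%:R - c) * a k.+1 <= c * a k.
  have -> : (k.+1%:R - c) * a k.+1 = mnorm (M *m mexp_coef M k) - c * a k.+1.
    by rewrite mulrBl /a /= mnormZ cmodV cmod_nat mulVKf// pnatr_eq0.
  have := mnormM M (mexp_coef M k); have := mulr_ge0 (ltW c0) (a0 k.+1).
  by have := a0 k; rewrite /c /a; nra.
have Hv k : (r + 1) * a k.+1 <= c * a k.+1 + a k.
  by have := a0 k; have := a0 k.+1; rewrite /c; nra.
have [K hK] := majorant c0 r0 r1 a0 a0 Ha Hv.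
by split => //; exists K => k; case: (hK k).
Qed.

Lemma mexp_deriv n (M : 'M[C]_n) z : mderiv (mexp M) z (M *m mexp M z).
Proof.
have r0 : 0 < cmod z + 1 by have := cmod_ge0 z; lra.
have zr : cmod z < cmod z + 1 by lra.
have := mPS_deriv (mexp_coef_cvg M r0) zr.
rewrite -(mPSMl M (mexp_coef_cvg M r0) zr) (_ : mder _ = fun k => M *m mexp_coef M k)//.
by apply/funext => k; rewrite /mder /= scalerA divff ?scale1r// pnatr_eq0.
Qed.

Lemma mexp0 n (M : 'M[C]_n) : mexp M 0 = 1%:M.
Proof. by rewrite /mexp mPS0. Qed.

Lemma mexp_comm n (M : 'M[C]_n) z : M *m mexp M z = mexp M z *m M.
Proof.
have r0 : 0 < cmod z + 1 by have := cmod_ge0 z; lra.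
have zr : cmod z < cmod z + 1 by lra.
rewrite /mexp -(mPSMl M (mexp_coef_cvg M r0) zr) -(mPSMr M (mexp_coef_cvg M r0) zr).
congr (mPS _ _); apply/funext; elim=> [|k IH] /=; first by rewrite mulmx1 mul1mx.
by rewrite -(scalemxAr _ M (M *m _)) -(scalemxAl _ (M *m _) M) -(mulmxA M _ M) IH.
Qed.

End SeriesSolutions.

(** * The exponential of a matrix and of a complex number *)

Section Exponential.
Variable R : realType.
Local Notation C := (complexField R).
Implicit Types (x y z w h d u t p q : C) (r e K : R).

Lemma ode_unique_cst n m (M : 'M[C]_n) (Y Z : C -> 'M[C]_(n, m)) p q :
  (forall z, mderiv Y z (M *m Y z)) -> (forall z, mderiv Z z (M *m Z z)) ->
  Y p = Z p -> Y q = Z q.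
Proof. by move=> hY hZ; apply: (@ode_unique _ _ _ (fun=> M) Y Z p q (mnorm M)). Qed.

Lemma cderiv_addl p z : cderiv (fun w => p + w) z 1.
Proof. by have := cderivD (cderiv_cst p z) (cderiv_id z); rewrite add0r. Qed.

(** In the variable [w] both sides solve [Y' = M Y], and they agree at [w = 0]. *)
Lemma mexpD n (M : 'M[C]_n) z w : mexp M (z + w) = mexp M w *m mexp M z.
Proof.
apply: (@ode_unique_cst _ _ M (fun w => mexp M (z + w)) (fun w => mexp M w *m mexp M z) 0 w).
- move=> v; have := mderiv_comp (cderiv_addl z v) (mexp_deriv M (z + v)).
  by rewrite scale1r.
- by move=> v; rewrite mulmxA; apply: mderivMr; exact: mexp_deriv.
- by rewrite addr0 mexp0 mul1mx.
Qed.

Lemma mexp_unit n (M : 'M[C]_n) z : mexp M z \in unitmx.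
Proof.
have := mexpD M z (- z); rewrite subrr mexp0 => /esym /mulmx1_unit[] //.
Qed.

(** As the case of size 1, it inherits its derivative and its addition law from [mexp]. *)
Definition cexp z : C := mexp (1%:M : 'M[C]_1) z ord0 ord0.

Lemma cexp_deriv z : cderiv cexp z (cexp z).
Proof. by have := mexp_deriv (1%:M : 'M[C]_1) z ord0 ord0; rewrite mul1mx. Qed.

Lemma cexp0 : cexp 0 = 1.
Proof. by rewrite /cexp mexp0 mxE. Qed.

Lemma mulmx11 (A B : 'M[C]_1) : (A *m B) ord0 ord0 = A ord0 ord0 * B ord0 ord0.
Proof. by rewrite mxE big_ord1. Qed.

Lemma cexpD z w : cexp (z + w) = cexp z * cexp w.
Proof.
rewrite mulrC; apply: etrans (mulmx11 _ _).
exact: (congr1 (fun A : 'M[C]_1 => A ord0 ord0) (mexpD _ z w)).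
Qed.

Lemma cexp_neq0 z : cexp z != 0.
Proof.
apply/eqP => z0; have := cexpD z (- z); rewrite subrr cexp0 z0 mul0r.
by move=> /eqP; rewrite oner_eq0.
Qed.

Lemma derive0_cst (f : R -> R) (s : R) : (forall x : R, is_derive x 1 f 0) -> f s = f 0.
Proof. by move=> h; exact: is_derive_0_is_cst. Qed.

Lemma cexp_along v (s : R) :
  is_derive s 1 (fun s => cRe (cexp (toC s * v))) (cRe (v * cexp (toC s * v))) /\
  is_derive s 1 (fun s => cIm (cexp (toC s * v))) (cIm (v * cexp (toC s * v))).
Proof.
have E (f : C -> R) : (fun s => f (cexp (toC s * v))) = fun s => f (cexp (0 + toC s * v)).
  by apply/funext => x; rewrite add0r.
rewrite (E (@cRe R)) (E (@cIm R)); apply: cderiv_along; rewrite add0r; exact: cexp_deriv.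
Qed.

Lemma cexp_real (s : R) : cexp (toC s) = toC (expR s).
Proof.
have E (s' : R) : is_derive s' 1 (fun s => expR (- s)) (- expR (- s')).
  have := @is_derive1_comp _ expR -%R s' _ _ (is_derive_expR _) (is_deriveNid _ _).
  by rewrite mulrN1.
have aux (f : R -> R) : (forall x : R, is_derive x 1 f (f x)) -> f s = f 0 * expR s.
  move=> hf.
  have hP (x : R) : is_derive x 1 (fun s => f s * expR (- s)) 0.
    have := is_deriveM (hf x) (E x); rewrite /GRing.scale /=.
    by rewrite (_ : _ + _ = 0)//; ring.
  have := derive0_cst s hP; rewrite /= oppr0 expR0 mulr1 => <-.
  by rewrite -mulrA -expRD addNr expR0 mulr1.
have h1 (x : R) : is_derive x 1 (fun s => cRe (cexp (toC s * 1))) (cRe (cexp (toC x * 1))).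
  by have [h _] := cexp_along 1 x; rewrite mul1r in h.
have h2 (x : R) : is_derive x 1 (fun s => cIm (cexp (toC s * 1))) (cIm (cexp (toC x * 1))).
  by have [_ h] := cexp_along 1 x; rewrite mul1r in h.
have := aux _ h1; have := aux _ h2; rewrite toC0 mul0r cexp0 mulr1 => e2 e1.
by apply: complex_eqP; rewrite ?e1 ?e2 ?mul1r ?mul0r.
Qed.

Definition cI : C := 0 +i* 1.

(** The squared distance [F] between the two sides has derivative 0 and vanishes at 0. *)
Lemma cexp_imag (s : R) : cexp (toC s * cI) = cos s +i* sin s.
Proof.
pose u s := cRe (cexp (toC s * cI)); pose w s := cIm (cexp (toC s * cI)).
have hu (x : R) : is_derive x 1 u (- w x).
  have [h _] := cexp_along cI x; apply: is_derive_eq h _.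
  by rewrite cReM /cI /= mul0r mul1r sub0r.
have hw (x : R) : is_derive x 1 w (u x).
  have [_ h] := cexp_along cI x; apply: is_derive_eq h _.
  by rewrite cImM /cI /= mul0r mul1r add0r.
pose F s := (u s - cos s) ^+ 2 + (w s - sin s) ^+ 2.
have hF (x : R) : is_derive x 1 F 0.
  have h1 := is_derive_sqr_pt (is_deriveB (hu x) (is_derive_cos x)).
  have h2 := is_derive_sqr_pt (is_deriveB (hw x) (is_derive_sin x)).
  have := is_deriveD h1 h2; rewrite (_ : 2 * _ + _ = 0)//.
  by rewrite !fctE; ring.
have : F s = 0.
  rewrite (derive0_cst s hF) /F /u /w toC0 mul0r cexp0 cos0 sin0 /= !subrr.
  by rewrite expr0n addr0.
move=> /eqP; rewrite /F paddr_eq0 ?sqr_ge0// !sqrf_eq0 !subr_eq0 => /andP[/eqP h1 /eqP h2].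
exact: complex_eqP.
Qed.

Lemma cexpE (a b : R) : cexp (a +i* b) = (expR a * cos b) +i* (expR a * sin b).
Proof.
have -> : (a +i* b : C) = toC a + toC b * cI.
  by apply: complex_eqP; rewrite ?cReD ?cImD ?cReM ?cImM /=; ring.
rewrite cexpD cexp_real cexp_imag.
by apply: complex_eqP; rewrite ?cReM ?cImM /=; ring.
Qed.

Lemma cmod_cexp z : cmod (cexp z) = expR (cRe z).
Proof.
case: z => a b; rewrite cexpE cmod_def /= !exprMn -mulrDr cos2Dsin2 mulr1.
by rewrite sqrtr_sqr ger0_norm ?expR_ge0.
Qed.

(** Applied to [t], [t - lam] and [cexp x - lam], it bounds the coefficient matrix along a segment
    that avoids the poles, as [ode_unique] requires. *)
Lemma segment_min (f : C -> C) p q :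
  (forall s : R, s \in `[0, 1] -> exists d, cderiv f (p + toC s * (q - p)) d) ->
  (forall s : R, s \in `[0, 1] -> f (p + toC s * (q - p)) != 0) ->
  exists2 e : R, 0 < e & forall s : R, s \in `[0, 1] -> e <= cmod (f (p + toC s * (q - p))).
Proof.
move=> hf f0.
pose N (s : R) := cRe (f (p + toC s * (q - p))) ^+ 2 + cIm (f (p + toC s * (q - p))) ^+ 2.
have cN : {within `[0, 1], continuous N}.
  apply: derivable_within_continuous => s s01; have [d hd] := hf s s01.
  have [h1 h2] := cderiv_along hd.
  by have [] := is_deriveD (is_derive_sqr_pt h1) (is_derive_sqr_pt h2).
have [c c01 hc] := @EVT_min R N 0 1 ler01 cN.
exists (cmod (f (p + toC c * (q - p)))); first by rewrite cmod_gt0 f0.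
by move=> s /hc; rewrite /N -!cmod_sqr ler_sqr ?nnegrE ?cmod_ge0.
Qed.

End Exponential.

(** * The Fuchsian system on convex domains *)

Section FuchsianSystem.
Variable R : realType.
Local Notation C := (complexField R).
Implicit Types (x y z w h d u t p q : C) (r e K : R).

Definition is_sol n m (G : C -> 'M[C]_n) (Om : C -> Prop) (Y : C -> 'M[C]_(n, m)) :=
  forall t, Om t -> mderiv Y t (G t *m Y t).

Lemma is_sol_sub n m (G : C -> 'M[C]_n) (Om Om' : C -> Prop) (Y : C -> 'M[C]_(n, m)) :
  (forall t, Om' t -> Om t) -> is_sol G Om Y -> is_sol G Om' Y.
Proof. by move=> h hY t /h; exact: hY. Qed.

Lemma is_solMr n m k (G : C -> 'M[C]_n) (Om : C -> Prop) (Y : C -> 'M[C]_(n, m))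
  (X : 'M[C]_(m, k)) : is_sol G Om Y -> is_sol G Om (fun t => Y t *m X).
Proof. by move=> hY t Ot; rewrite mulmxA; apply: mderivMr; exact: hY. Qed.

Definition on_segment p q (Om : C -> Prop) :=
  forall s : R, s \in `[0, 1] -> Om (p + toC s * (q - p)).

Definition convex_dom (Om : C -> Prop) := forall p q, Om p -> Om q -> on_segment p q Om.

Variables (n : nat) (M D : 'M[C]_n) (lam : C).
Local Notation G := (fuchs M D lam).

Lemma fuchs_unique m (Om : C -> Prop) (Y Z : C -> 'M[C]_(n, m)) p q :
  (forall t, Om t -> t != 0 /\ t != lam) -> on_segment p q Om ->
  is_sol G Om Y -> is_sol G Om Z -> Y p = Z p -> Y q = Z q.
Proof.
move=> O0 Opq hY hZ.
have [e1 e10 he1] := @segment_min _ (fun w => w) p q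
  (fun s _ => ex_intro _ _ (cderiv_id _)) (fun s s01 => (O0 _ (Opq s s01)).1).
have [e2 e20 he2] := @segment_min _ (fun w => w - lam) p q
  (fun s _ => ex_intro _ _ (cderivD (cderiv_id _) (cderiv_cst (- lam) _)))
  (fun s s01 => ltac:(rewrite subr_eq0; exact: (O0 _ (Opq s s01)).2)).
apply: (@ode_unique _ _ _ G Y Z p q (e1^-1 * mnorm M + e2^-1 * mnorm D)).
- by move=> s s01; apply: hY; exact: Opq.
- by move=> s s01; apply: hZ; exact: Opq.
move=> s s01; rewrite /fuchs; apply: le_trans (mnormD _ _) _.
have inv (e c : R) : 0 < e -> e <= c -> c^-1 <= e^-1.
  by move=> e0 ec; rewrite lef_pV2// posrE (lt_le_trans e0 ec).
rewrite !mnormZ !cmodV lerD// ler_wpM2r ?mnorm_ge0//; apply: inv => //.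
  exact: he1.
exact: he2.
Qed.

(** The system in the coordinate [x = log t], in which [t^M] is [mexp M x] and the pole at [t = 0]
    has disappeared. *)
Definition xfuchs (x : C) : 'M[C]_n := M + (cexp x / (cexp x - lam)) *: D.

Lemma xfuchs_unique m (Om : C -> Prop) (Y Z : C -> 'M[C]_(n, m)) p q :
  (forall x, Om x -> cexp x != lam) -> on_segment p q Om ->
  is_sol xfuchs Om Y -> is_sol xfuchs Om Z -> Y p = Z p -> Y q = Z q.
Proof.
move=> O0 Opq hY hZ.
have [e e0 he] := @segment_min _ (fun w => cexp w - lam) p q
  (fun s _ => ex_intro _ _ (cderivD (cexp_deriv _) (cderiv_cst (- lam) _)))
  (fun s s01 => ltac:(rewrite subr_eq0; exact: (O0 _ (Opq s s01)))).
apply: (@ode_unique _ _ _ xfuchs Y Z p q (mnorm M + (1 + cmod lam / e) * mnorm D)).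
- by move=> s s01; apply: hY; exact: Opq.
- by move=> s s01; apply: hZ; exact: Opq.
move=> s s01; rewrite /xfuchs; apply: le_trans (mnormD _ _) _.
rewrite lerD2l mnormZ ler_wpM2r ?mnorm_ge0//.
set E := cexp _; have E0 : E - lam != 0 by rewrite subr_eq0; exact: (O0 _ (Opq s s01)).
rewrite (_ : E / (E - lam) = 1 + lam / (E - lam)); last by field.
apply: le_trans (cmodD _ _) _; rewrite cmod1 lerD2l cmodM ler_wpM2l ?cmod_ge0//.
by rewrite cmodV lef_pV2 ?posrE ?cmod_gt0//; exact: he.
Qed.

Lemma is_sol_cexp m (Om : C -> Prop) (Y : C -> 'M[C]_(n, m)) :
  is_sol G Om Y -> is_sol xfuchs (fun x => Om (cexp x)) (fun x => Y (cexp x)).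
Proof.
move=> hY x Ox; have := mderiv_comp (cexp_deriv x) (hY _ Ox).
rewrite fuchs_mul scalerDr !scalerA divff ?cexp_neq0// scale1r.
by rewrite /xfuchs mulmxDl -scalemxAl.
Qed.

Lemma mulmx_inj_unit (A : 'M[C]_n) :
  (forall c : 'cV[C]_n, A *m c = 0 -> c = 0) -> A \in unitmx.
Proof.
move=> h; rewrite -unitmx_tr -row_free_unit -kermx_eq0; apply/eqP/row_matrixP => i.
rewrite row0; apply: trmx_inj; rewrite trmx0; apply: h; apply: trmx_inj.
by rewrite trmx_mul trmxK -row_mul mulmx_ker row0 trmx0.
Qed.

(** If [Y q *m c = 0], the solution [Y t *m c] vanishes at [q], hence at [p]. *)
Lemma is_sol_unit (Om : C -> Prop) (Y : C -> 'M[C]_n) p q :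
  (forall t, Om t -> t != 0 /\ t != lam) -> convex_dom Om -> is_sol G Om Y ->
  Om p -> Om q -> Y p \in unitmx -> Y q \in unitmx.
Proof.
move=> O0 cO hY Op Oq Yp; apply: mulmx_inj_unit => c Yc.
have := @fuchs_unique _ Om (fun t => Y t *m c) (fun=> 0) q p O0 (cO _ _ Oq Op)
  (is_solMr c hY).
rewrite Yc => /(_ _ erefl) H.
have : Y p *m c = 0 by apply: H => t _; rewrite mulmx0; exact: mderiv_cst.
by move=> /(congr1 (mulmx (invmx (Y p)))); rewrite mulKmx// mulmx0.
Qed.

Definition in_ball (c : C) (r : R) (t : C) : Prop := cmod (t - c) < r.

Lemma convex_ball c r : convex_dom (in_ball c r).
Proof.
move=> p q hp hq s; rewrite in_itv /= => /andP[s0 s1]; rewrite /in_ball in hp hq *.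
rewrite (_ : _ - c = toC (1 - s) * (p - c) + toC s * (q - c)); last first.
  by rewrite toCB toC1; ring.
apply: le_lt_trans (cmodD _ _) _; rewrite !cmodM !cmod_toC !ger0_norm//; last lra.
have [->|s0'] := eqVneq s 0; first by rewrite subr0 mul1r mul0r addr0.
have {}s0 : 0 < s by rewrite lt_neqAle eq_sym s0'.
apply: (@lt_le_trans _ _ ((1 - s) * r + s * r)); last by rewrite -mulrDl subrK mul1r.
by apply: ler_ltD; [rewrite ler_wpM2l ?subr_ge0// ltW|rewrite ltr_pM2l].
Qed.

Lemma ball_regular c r t : r <= cmod c -> r <= cmod (c - lam) -> in_ball c r t ->
  t != 0 /\ t != lam.
Proof.
rewrite /in_ball => rc rl tc; split; apply/eqP => E; move: tc; rewrite E.
  by rewrite sub0r cmodN ltNge rc.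
by rewrite cmod_dist ltNge rl.
Qed.

Lemma disc_series m (Y0 : 'M[C]_(n, m)) c r : 0 < r -> r <= cmod c -> r <= cmod (c - lam) ->
  exists A : nat -> 'M[C]_(n, m), [/\ A 0%N = Y0,
    is_sol G (in_ball c r) (fun t => mPS A (t - c)) &
    forall r', 0 < r' -> r' < r -> mcvg A r'].
Proof.
move=> r0 rc rl.
have c0 : c != 0 by rewrite -cmod_gt0 (lt_le_trans r0 rc).
have cl : c != lam by rewrite -subr_eq0 -cmod_gt0 (lt_le_trans r0 rl).
have [A [A0 hA]] := regular_point_series M D Y0 c0 cl.
exists A; split => //; last first.
  by move=> r' r'0 rr; have [] := hA r' r'0 (lt_le_trans rr rc) (lt_le_trans rr rl).
move=> t; rewrite /in_ball => tc; set r' := (cmod (t - c) + r) / 2.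
have t0 := cmod_ge0 (t - c).
have r'0 : 0 < r' by rewrite /r'; lra.
have rr : r' < r by rewrite /r'; lra.
have tr : cmod (t - c) < r' by rewrite /r'; lra.
have [_ /(_ _ tr) h] := hA r' r'0 (lt_le_trans rr rc) (lt_le_trans rr rl).
have ct : c + (t - c) = t by ring.
rewrite ct in h.
by have := mderiv_comp (cderivD (cderiv_id t) (cderiv_cst (- c) t)) h; rewrite addr0 scale1r.
Qed.

(** [is_sol] asks only for complex derivatives; analyticity follows by uniqueness, from comparison
    with the series solution that has the same value at [p]. *)
Lemma sol_pseries m (Om : C -> Prop) (Y : C -> 'M[C]_(n, m)) p r : 0 < r ->
  (forall t, Om t -> t != 0 /\ t != lam) -> (forall t, in_ball p r t -> Om t) -> is_sol G Om Y ->
  exists2 r', 0 < r' & forall i j, exists a, pseries_on (fun t => Y t i j) p a r'.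
Proof.
move=> r0 O0 pO hY; have Op : Om p by apply: pO; rewrite /in_ball subrr cmod0.
have [p0 pl] := O0 p Op.
set r1 := Num.min r (Num.min (cmod p) (cmod (p - lam))).
have r10 : 0 < r1 by rewrite !lt_min r0 !cmod_gt0 subr_eq0 p0.
have [A [A0 hA hc]] := @disc_series _ (Y p) p r1 r10 ltac:(by rewrite !ge_min lexx orbT)
  ltac:(by rewrite !ge_min lexx !orbT).
have YA t : in_ball p r1 t -> Y t = mPS A (t - p).
  move=> tp; have pp : in_ball p r1 p by rewrite /in_ball subrr cmod0.
  have reg w : in_ball p r1 w -> w != 0 /\ w != lam.
    by apply: ball_regular; rewrite !ge_min lexx !orbT.
  have sub : is_sol G (in_ball p r1) Y.
    apply: is_sol_sub hY => w wp; apply: pO; rewrite /in_ball in wp *.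
    by apply: lt_le_trans wp _; rewrite ge_min lexx.
  apply: (fuchs_unique reg (@convex_ball p r1 p t pp tp) sub hA).
  by rewrite subrr mPS0.
exists (r1 / 2); first by rewrite divr_gt0.
move=> i j; exists (fun k => A k i j); split.
  by apply: mcvg_entry; apply: hc; [rewrite divr_gt0|rewrite ltr_pdivrMr// ltr_pMr// ltr1n].
move=> w wp; rewrite YA ?mPSE// /in_ball; apply: lt_trans wp _.
by rewrite ltr_pdivrMr// ltr_pMr// ltr1n.
Qed.

(** A half plane is an increasing union of discs, on each of which one power series converges;
    normalized at [p0], the solutions on these discs extend each other by uniqueness. *)
Lemma exhaustion_solution m (c : nat -> C) (rho : nat -> R) p0 (X0 : 'M[C]_(n, m)) :
  (forall k, 0 < rho k) -> (forall k, rho k <= cmod (c k)) ->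
  (forall k, rho k <= cmod (c k - lam)) ->
  (forall k t, in_ball (c k) (rho k) t -> in_ball (c k.+1) (rho k.+1) t) ->
  in_ball (c 0%N) (rho 0%N) p0 ->
  exists E : C -> 'M[C]_(n, m), E p0 = X0 /\
    is_sol G (fun t => exists k, in_ball (c k) (rho k) t) E.
Proof.
move=> r0 rc rl sub p00.
have subl k l t : (k <= l)%N -> in_ball (c k) (rho k) t -> in_ball (c l) (rho l) t.
  by elim: l => [|l IH]; [rewrite leqn0 => /eqP ->|
    rewrite leq_eqVlt => /orP[/eqP -> //|]; rewrite ltnS => /IH h /h; exact: sub].
have p0k k : in_ball (c k) (rho k) p0 := subl _ _ _ (leq0n k) p00.
have loc k : exists Y : C -> 'M[C]_(n, m), Y p0 = X0 /\ is_sol G (in_ball (c k) (rho k)) Y.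
  have [A [A0 hA _]] := @disc_series _ (1%:M : 'M[C]_n) (c k) (rho k) (r0 k) (rc k) (rl k).
  set F := (fun t => mPS A (t - c k)) in hA.
  have Fu : F p0 \in unitmx.
    have cc : in_ball (c k) (rho k) (c k) by rewrite /in_ball subrr cmod0.
    apply: (is_sol_unit _ (@convex_ball _ _) hA cc (p0k k)).
      by move=> t; exact: ball_regular.
    by rewrite /F subrr mPS0 A0 unitmx1.
  exists (fun t => F t *m (invmx (F p0) *m X0)); split; first by rewrite mulKVmx.
  exact: is_solMr.
pose Y k := sval (cid (loc k)).
have Y0 k : Y k p0 = X0 := (svalP (cid (loc k))).1.
have hY k : is_sol G (in_ball (c k) (rho k)) (Y k) := (svalP (cid (loc k))).2.
have agree k l t : (k <= l)%N -> in_ball (c k) (rho k) t -> Y k t = Y l t.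
  move=> kl tk; have reg w : in_ball (c k) (rho k) w -> w != 0 /\ w != lam.
    exact: ball_regular.
  have sub' : is_sol G (in_ball (c k) (rho k)) (Y l).
    by apply: is_sol_sub (hY l) => w; exact: subl.
  apply: (fuchs_unique reg (@convex_ball _ _ _ _ (p0k k) tk) (hY k) sub').
  by rewrite !Y0.
pose E t := if pselect (exists k, in_ball (c k) (rho k) t) is left h then Y (sval (cid h)) t else 0.
have EY k t : in_ball (c k) (rho k) t -> E t = Y k t.
  move=> tk; rewrite /E; case: pselect => [h|]; last by case; exists k.
  case: (cid h) => l /= tl.
  by case/orP: (leq_total k l) => kl; [rewrite (agree k l)|rewrite (agree l k)].
exists E; split; first by rewrite (EY 0%N)// Y0.
move=> t [k tk]; rewrite (EY k)//.
have s0 : 0 < rho k - cmod (t - c k) by rewrite subr_gt0.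
apply: (eq_near_mderiv s0 _ (hY k t tk)) => h hh; rewrite (EY k)// /in_ball addrAC.
by apply: le_lt_trans (cmodD _ _) _; lra.
Qed.

End FuchsianSystem.

(** * Charts and fundamental matrices *)

(* All charts are convex and every path of continuation is followed through their overlaps,
   so that no fundamental group is needed. *)
Inductive chart := ChartUp | ChartDown | ChartLeft | ChartMid | ChartRight.

Section Charts.
Variable R : realType.
Local Notation C := (complexField R).
Implicit Types (x y z w h d u t p q : C) (r e K m : R) (c : chart).
Variable l : R.
Hypothesis l0 : 0 < l.
Local Notation lam := (toC l).

Definition cdom c t : Prop :=
  match c with
  | ChartUp => 0 < cIm t
  | ChartDown => cIm t < 0
  | ChartLeft => cRe t < 0
  | ChartMid => in_ball (toC (l / 2)) (l / 2) t
  | ChartRight => l < cRe t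
  end.

(** The discs of radius [m] centred at [m (a, b)] all touch the boundary line of the half plane at
    0. The right side grows linearly in [m] where the linear form is positive, so the discs increase
    to the half plane. *)
Lemma half_plane_ball (s : C) (a b m : R) : a ^+ 2 + b ^+ 2 = 1 -> 0 < m ->
  cmod (s - (a * m +i* (b * m) : C)) < m <-> cmod s ^+ 2 < 2 * m * (a * cRe s + b * cIm s).
Proof.
move=> ab m0; rewrite -(@ltr_pXn2r _ 2)// ?nnegrE ?cmod_ge0 ?(ltW m0)//.
rewrite !cmod_sqr cReB cImB /=.
have E : (cRe s - a * m) ^+ 2 + (cIm s - b * m) ^+ 2 =
  cRe s ^+ 2 + cIm s ^+ 2 - 2 * m * (a * cRe s + b * cIm s) + m ^+ 2.
  rewrite [LHS](_ : _ = cRe s ^+ 2 + cIm s ^+ 2 - 2 * m * (a * cRe s + b * cIm s) +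
    (a ^+ 2 + b ^+ 2) * m ^+ 2); last by ring.
  by rewrite ab mul1r.
by rewrite E; split; lra.
Qed.

Lemma cmod_lt_sqr z r : 0 <= r -> (cmod z < r) = (cRe z ^+ 2 + cIm z ^+ 2 < r ^+ 2).
Proof. by move=> r0; rewrite -cmod_sqr ltr_pXn2r// nnegrE// cmod_ge0. Qed.

Lemma mid_bounds t : in_ball (toC (l / 2)) (l / 2) t -> 0 < cRe t < l.
Proof.
rewrite /in_ball => h; have := le_lt_trans (cRe_le _) h.
by rewrite cReB /= ltr_norml => /andP[h1 h2]; apply/andP; split; lra.
Qed.

Lemma cdom_regular c t : cdom c t -> t != 0 /\ t != lam.
Proof.
case: c => /= h.
- by split; apply: contraTneq h => ->; rewrite /= ltxx.
- by split; apply: contraTneq h => ->; rewrite /= ltxx.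
- by split; apply: contraTneq h => ->; rewrite /= ?ltxx// ltNge (ltW l0).
- by have /andP[h1 h2] := mid_bounds h; split; [apply: contraTneq h1|apply: contraTneq h2] => ->;
     rewrite /= ltxx.
- by split; apply: contraTneq h => ->; rewrite /= ?ltxx// ltNge (ltW l0).
Qed.

Lemma cdom_cover t : t != 0 -> t != lam -> exists c, cdom c t.
Proof.
move=> t0 tl; have [h|h|h] := ltgtP (cIm t) 0; [by exists ChartDown|by exists ChartUp|].
have tE : t = toC (cRe t) by apply: complex_eqP.
have [h1|h1|h1] := ltgtP (cRe t) 0; [by exists ChartLeft| |by move: t0; rewrite tE h1 eqxx].
have [h2|h2|h2] := ltgtP (cRe t) l; [|by exists ChartRight|by move: tl; rewrite tE h2 eqxx].
exists ChartMid; rewrite /= /in_ball tE -toCB cmod_toC ltr_norml; apply/andP; split; lra.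
Qed.

Lemma segment_Re p q (s : R) : cRe (p + toC s * (q - p)) = (1 - s) * cRe p + s * cRe q.
Proof. by rewrite cReD cReM cReB /= mul0r subr0; ring. Qed.

Lemma segment_Im p q (s : R) : cIm (p + toC s * (q - p)) = (1 - s) * cIm p + s * cIm q.
Proof. by rewrite cImD cImM cImB /= mul0r addr0; ring. Qed.

Lemma lt_convex_comb (s x y z : R) : 0 <= s <= 1 -> z < x -> z < y -> z < (1 - s) * x + s * y.
Proof.
move=> /andP[s0 s1] zx zy; have [->|s0'] := eqVneq s 0; first by rewrite subr0 mul1r mul0r addr0.
have {}s0 : 0 < s by rewrite lt_neqAle eq_sym s0'.
rewrite (_ : z = (1 - s) * z + s * z); last by ring.
by apply: ler_ltD; [rewrite ler_wpM2l ?subr_ge0// ltW|rewrite ltr_pM2l].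
Qed.

Lemma cdom_convex c : convex_dom (cdom c).
Proof.
case: c => p q hp hq s; last 2 first.
- by move=> s01; exact: (convex_ball hp hq).
- by rewrite in_itv /= => s01; rewrite segment_Re; apply: lt_convex_comb.
- by rewrite in_itv /= => s01; rewrite segment_Im; apply: lt_convex_comb.
- rewrite in_itv /= => s01; rewrite segment_Im /= in hp hq *.
  have := @lt_convex_comb s (- cIm p) (- cIm q) 0 s01; rewrite !oppr_gt0 => /(_ hp hq); lra.
- rewrite in_itv /= => s01; rewrite segment_Re /= in hp hq *.
  have := @lt_convex_comb s (- cRe p) (- cRe q) 0 s01; rewrite !oppr_gt0 => /(_ hp hq); lra.
Qed.

Lemma cdom_open c t : cdom c t -> exists2 r, 0 < r & forall w, in_ball t r w -> cdom c w.
Proof.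
have hR w : `|cRe w - cRe t| <= cmod (w - t) by rewrite -cReB cRe_le.
have hI w : `|cIm w - cIm t| <= cmod (w - t) by rewrite -cImB cIm_le.
case: c => /= h.
- exists (cIm t) => // w hw; have := le_lt_trans (hI w) hw.
  by rewrite ltr_norml => /andP[h1 h2]; lra.
- exists (- cIm t); first lra.
  by move=> w hw; have := le_lt_trans (hI w) hw; rewrite ltr_norml => /andP[h1 h2]; lra.
- exists (- cRe t); first lra.
  by move=> w hw; have := le_lt_trans (hR w) hw; rewrite ltr_norml => /andP[h1 h2]; lra.
- exists (l / 2 - cmod (t - toC (l / 2))); first by rewrite subr_gt0.
  move=> w; rewrite /in_ball => hw.
  rewrite (_ : w - _ = (w - t) + (t - toC (l / 2))); last by ring.
  by apply: le_lt_trans (cmodD _ _) _; lra.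
- exists (cRe t - l); first lra.
  by move=> w hw; have := le_lt_trans (hR w) hw; rewrite ltr_norml => /andP[h1 h2]; lra.
Qed.

Variables (n : nat) (M D : 'M[C]_n).
Local Notation G := (fuchs M D lam).

(** Here [w0] is the boundary point where all the discs are tangent and [(a, b)] the inward unit
    normal; the two inequalities say that no disc contains 0 or [lam]. *)
Lemma half_plane_solution k (a b : R) (w0 p0 : C) (X0 : 'M[C]_(n, k)) : a ^+ 2 + b ^+ 2 = 1 ->
  (forall m, 0 < m -> m <= cmod (w0 + (a * m +i* (b * m) : C))) ->
  (forall m, 0 < m -> m <= cmod (w0 + (a * m +i* (b * m) : C) - lam)) ->
  0 < a * cRe (p0 - w0) + b * cIm (p0 - w0) ->
  exists E : C -> 'M[C]_(n, k), E p0 = X0 /\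
    is_sol G (fun t => 0 < a * cRe (t - w0) + b * cIm (t - w0)) E.
Proof.
move=> ab h1 h2 hp.
have inb t m : 0 < m -> in_ball (w0 + (a * m +i* (b * m) : C)) m t <->
    cmod (t - w0) ^+ 2 < 2 * m * (a * cRe (t - w0) + b * cIm (t - w0)).
  by move=> m0; rewrite /in_ball opprD addrA; exact: half_plane_ball.
have large t (m1 : R) : 0 < m1 -> 0 < a * cRe (t - w0) + b * cIm (t - w0) ->
    exists j : nat, cmod (t - w0) ^+ 2 < 2 * (m1 + j%:R) * (a * cRe (t - w0) + b * cIm (t - w0)).
  move=> m10 ht; set L := _ + _ in ht *.
  exists (Num.bound (cmod (t - w0) ^+ 2 / (2 * L))).
  have : cmod (t - w0) ^+ 2 / (2 * L) < (Num.bound (cmod (t - w0) ^+ 2 / (2 * L)))%:R.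
    by apply: archi_boundP; rewrite divr_ge0 ?sqr_ge0// mulr_ge0// ltW.
  rewrite ltr_pdivrMr; last by rewrite mulr_gt0.
  move=> H; apply: lt_le_trans H _; set N := _%:R; have N0 : 0 <= N by rewrite ler0n.
  by nra.
have [j0 hj0] := large p0 1 ltr01 hp.
pose rho (j : nat) : R := 1 + j0%:R + j%:R.
have rho0 j : 0 < rho j by rewrite /rho -addrA -natrD ltr_pwDl.
have := @exhaustion_solution _ n M D lam k (fun j => w0 + (a * rho j +i* (b * rho j) : C)) rho p0 X0
  rho0 (fun j => h1 _ (rho0 j)) (fun j => h2 _ (rho0 j)).
case.
- move=> j t /(inb _ _ (rho0 j)) H; apply/(inb _ _ (rho0 j.+1)).
  have L0 : 0 < a * cRe (t - w0) + b * cIm (t - w0).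
    have := le_lt_trans (sqr_ge0 _) H; rewrite pmulr_rgt0// mulr_gt0//.
  apply: lt_le_trans H _; rewrite ler_wpM2r ?(ltW L0)// ler_pM2l//.
  by rewrite /rho -natr1; lra.
- apply/(inb _ _ (rho0 0%N)); rewrite /rho addr0; exact: hj0.
- move=> E [E0 hE]; exists E; split => // t ht; apply: hE.
  have r0' : 0 < 1 + j0%:R :> R by have := rho0 0%N; rewrite /rho addr0.
  have [j hj] := large t _ r0' ht.
  by exists j; apply/(inb _ _ (rho0 j)); exact: hj.
Qed.

Lemma chart_solution k c p0 (X0 : 'M[C]_(n, k)) : cdom c p0 ->
  exists E : C -> 'M[C]_(n, k), E p0 = X0 /\ is_sol G (cdom c) E.
Proof.
have HP (a b : R) (w0 : C) :
  (forall t, cdom c t <-> 0 < a * cRe (t - w0) + b * cIm (t - w0)) -> a ^+ 2 + b ^+ 2 = 1 ->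
  (forall m, 0 < m -> m <= cmod (w0 + (a * m +i* (b * m) : C))) ->
  (forall m, 0 < m -> m <= cmod (w0 + (a * m +i* (b * m) : C) - lam)) ->
  cdom c p0 -> exists E : C -> 'M[C]_(n, k), E p0 = X0 /\ is_sol G (cdom c) E.
  move=> hdom ab h1 h2 /hdom hp.
  have [E [E0 hE]] := half_plane_solution X0 ab h1 h2 hp.
  by exists E; split => //; apply: is_sol_sub hE => t /hdom.
have le_Re z m : m <= `|cRe z| -> m <= cmod z by move=> h; exact: le_trans h (cRe_le _).
have le_Im z m : m <= `|cIm z| -> m <= cmod z by move=> h; exact: le_trans h (cIm_le _).
case: c HP => HP.
- apply: (HP 0 1 0) => [t||m m0|m m0]; first by rewrite subr0 /=; split; lra.
  + by rewrite expr0n expr1n add0r.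
  + by apply: le_Im; rewrite add0r /= mul1r ler_norm.
  + by apply: le_Im; rewrite add0r cImB /= mul1r subr0 ler_norm.
- apply: (HP 0 (-1) 0) => [t||m m0|m m0]; first by rewrite subr0 /=; split; lra.
  + by rewrite expr0n sqrrN expr1n add0r.
  + by apply: le_Im; rewrite add0r /= mulN1r normrN ler_norm.
  + by apply: le_Im; rewrite add0r cImB /= mulN1r subr0 normrN ler_norm.
- apply: (HP (-1) 0 0) => [t||m m0|m m0]; first by rewrite subr0 /=; split; lra.
  + by rewrite expr0n sqrrN expr1n addr0.
  + by apply: le_Re; rewrite add0r /= mulN1r normrN ler_norm.
  + apply: le_Re; rewrite add0r cReB /= mulN1r -opprD normrN; apply: le_trans (ler_norm _).
    by rewrite lerDl ltW.
(* This chart is itself a disc, exhausted by the constant sequence. *)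
- move=> hp; have := @exhaustion_solution _ n M D lam k (fun=> toC (l / 2)) (fun=> l / 2) p0 X0.
  have l20 : 0 < l / 2 by rewrite divr_gt0.
  case => // [j|j|E [E0 hE]].
  + by rewrite cmod_toC ler_norm.
  + by rewrite -toCB cmod_toC distrC; apply: le_trans (ler_norm _); have := l0; lra.
  + by exists E; split => // t ht; apply: hE; exists 0%N.
- apply: (HP 1 0 lam) => [t||m m0|m m0].
  + by rewrite cReB /= mul1r mul0r addr0 subr_gt0.
  + by rewrite expr0n expr1n addr0.
  + by apply: le_Re; rewrite cReD /= mul1r; apply: le_trans (ler_norm _); rewrite lerDr ltW.
  + by apply: le_Re; rewrite addrAC subrr add0r /= mul1r ler_norm.
Qed.

(** The two half planes do not meet, so the lower solution can still be normalized by [atlas_LD],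
    across the negative axis. This leaves exactly the two crossings of the positive axis to be
    nontrivial. *)
Record atlas (E : chart -> C -> 'M[C]_n) (a b : 'M[C]_n) : Prop := Atlas {
  atlas_sol : forall c, is_sol G (cdom c) (E c);
  atlas_unit : forall c t, cdom c t -> E c t \in unitmx;
  atlas_LU : forall t, cdom ChartLeft t -> cdom ChartUp t -> E ChartLeft t = E ChartUp t;
  atlas_MU : forall t, cdom ChartMid t -> cdom ChartUp t -> E ChartMid t = E ChartUp t;
  atlas_RU : forall t, cdom ChartRight t -> cdom ChartUp t -> E ChartRight t = E ChartUp t;
  atlas_LD : forall t, cdom ChartLeft t -> cdom ChartDown t -> E ChartLeft t = E ChartDown t;
  atlas_MD : forall t, cdom ChartMid t -> cdom ChartDown t -> E ChartMid t = E ChartDown t *m a;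
  atlas_RD : forall t, cdom ChartRight t -> cdom ChartDown t -> E ChartRight t = E ChartDown t *m b
}.

Lemma cdom_agree k c c' p q (Y Z : C -> 'M[C]_(n, k)) :
  is_sol G (cdom c) Y -> is_sol G (cdom c') Z ->
  cdom c p -> cdom c' p -> cdom c q -> cdom c' q -> Y p = Z p -> Y q = Z q.
Proof.
move=> hY hZ p1 p2 q1 q2.
apply: (@fuchs_unique _ _ M D lam _ (fun t => cdom c t /\ cdom c' t)).
- by move=> t [/cdom_regular].
- by move=> s s01; split; apply: cdom_convex.
- by apply: is_sol_sub hY => t [].
- by apply: is_sol_sub hZ => t [].
Qed.

Lemma atlas_exists : exists E a b, atlas E a b.
Proof.
(* The upper solution is the identity at [pU]. The other points lie one in each overlap: without
   prime with the upper half plane, with prime with the lower one. *)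
pose pU : C := 0 +i* 1; pose pL : C := (-1) +i* 1; pose pL' : C := (-1) +i* (-1).
pose pM : C := (l / 2) +i* (l / 4); pose pM' : C := (l / 2) +i* (- (l / 4)).
pose pR : C := (l + 1) +i* 1; pose pR' : C := (l + 1) +i* (-1).
have [l4 l1] : 0 < l / 4 /\ l < l + 1 by have := l0; split; lra.
have dM : cdom ChartMid pM.
  rewrite /= /in_ball cmod_lt_sqr; last by rewrite divr_ge0// ltW.
  by rewrite cReB cImB /= subrr subr0 expr0n /= add0r; have := l0; nra.
have dM' : cdom ChartMid pM'.
  rewrite /= /in_ball cmod_lt_sqr; last by rewrite divr_ge0// ltW.
  by rewrite cReB cImB /= subrr subr0 sqrrN expr0n /= add0r; have := l0; nra.
have [EU [EU0 hU]] := chart_solution (1%:M : 'M[C]_n) (ltr01 : cdom ChartUp pU).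
have [EL [EL0 hL]] := chart_solution (EU pL) (ltrN10 R : cdom ChartLeft pL).
have [EM [EM0 hM]] := chart_solution (EU pM) dM.
have [ER [ER0 hR]] := chart_solution (EU pR) (l1 : cdom ChartRight pR).
have [ED [ED0 hD]] := chart_solution (EL pL') (ltrN10 R : cdom ChartDown pL').
have un c c' (Y Z : C -> 'M[C]_n) p q : is_sol G (cdom c) Y -> is_sol G (cdom c') Z ->
    cdom c p -> cdom c q -> cdom c' q -> Y p \in unitmx -> Z q = Y q ->
    forall t, cdom c' t -> Z t \in unitmx.
  move=> hY hZ dp dq dq' Yp YZ t dt.
  apply: (is_sol_unit (@cdom_regular c') (@cdom_convex c') hZ dq' dt).
  rewrite YZ; exact: (is_sol_unit (@cdom_regular c) (@cdom_convex c) hY dp dq).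
have EU1 : EU pU \in unitmx by rewrite EU0 unitmx1.
have dU : cdom ChartUp pU := ltr01.
have dUL : cdom ChartUp pL := ltr01.
have dUR : cdom ChartUp pR := ltr01.
have dDL : cdom ChartDown pL' := ltrN10 R.
have dDM : cdom ChartDown pM' by rewrite /= oppr_lt0.
have uU : forall t, cdom ChartUp t -> EU t \in unitmx := un _ _ _ _ pU pU hU hU dU dU dU EU1 erefl.
have uL : forall t, cdom ChartLeft t -> EL t \in unitmx :=
  un _ _ _ _ pU pL hU hL dU dUL (ltrN10 R : cdom ChartLeft pL) EU1 EL0.
have uM : forall t, cdom ChartMid t -> EM t \in unitmx := un _ _ _ _ pU pM hU hM dU l4 dM EU1 EM0.
have uR : forall t, cdom ChartRight t -> ER t \in unitmx :=
  un _ _ _ _ pU pR hU hR dU dUR l1 EU1 ER0.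
have uD : forall t, cdom ChartDown t -> ED t \in unitmx :=
  un _ _ _ _ pL' pL' hL hD (ltrN10 R : cdom ChartLeft pL') (ltrN10 R : cdom ChartLeft pL')
    dDL (uL pL' (ltrN10 R)) ED0.
pose E c := match c with ChartUp => EU | ChartDown => ED | ChartLeft => EL
  | ChartMid => EM | ChartRight => ER end.
exists E, (invmx (ED pM') *m EM pM'), (invmx (ED pR') *m ER pR'); split => /=.
- by case.
- by case.
- move=> t d1 d2.
  exact: (@cdom_agree _ ChartLeft ChartUp pL t _ _ hL hU (ltrN10 R) ltr01 d1 d2 EL0).
- by move=> t d1 d2; exact: (@cdom_agree _ ChartMid ChartUp pM t _ _ hM hU dM l4 d1 d2 EM0).
- by move=> t d1 d2; exact: (@cdom_agree _ ChartRight ChartUp pR t _ _ hR hU l1 ltr01 d1 d2 ER0).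
- move=> t d1 d2.
  by apply: (@cdom_agree _ ChartLeft ChartDown pL' t _ _ hL hD (ltrN10 R) (ltrN10 R) d1 d2).
- move=> t d1 d2; apply: (@cdom_agree _ ChartMid ChartDown pM' t _
    (fun t => ED t *m (invmx (ED pM') *m EM pM')) hM _ dM' dDM d1 d2).
    exact: is_solMr.
  by rewrite mulKVmx// uD.
- move=> t d1 d2; apply: (@cdom_agree _ ChartRight ChartDown pR' t _
    (fun t => ED t *m (invmx (ED pR') *m ER pR')) hR _ l1 (ltrN10 R) d1 d2).
    exact: is_solMr.
  by rewrite mulKVmx// uD//=; exact: ltrN10.
Qed.

Lemma atlas_transition_unit E a b : atlas E a b -> a \in unitmx /\ b \in unitmx.
Proof.
move=> h.
pose pM' : C := (l / 2) +i* (- (l / 4)); pose pR' : C := (l + 1) +i* (-1).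
have dM' : cdom ChartMid pM'.
  rewrite /= /in_ball cmod_lt_sqr; last by rewrite divr_ge0// ltW.
  by rewrite cReB cImB /= subrr subr0 sqrrN expr0n /= add0r; have := l0; nra.
have dDM : cdom ChartDown pM' by rewrite /= oppr_lt0 divr_gt0.
have dR' : cdom ChartRight pR' by rewrite /=; lra.
have dDR : cdom ChartDown pR' := ltrN10 R.
split.
  by have := atlas_unit h dM'; rewrite (atlas_MD h dM' dDM) unitmx_mul => /andP[].
by have := atlas_unit h dR'; rewrite (atlas_RD h dR' dDR) unitmx_mul => /andP[].
Qed.

End Charts.

(** * Local monodromy *)

Section LinearFactors.
Variables (F : fieldType) (n : nat).
Implicit Types (A B T : 'M[F]_n) (s : seq F) (x y c : F).

(** The product of the [A - x] for [x] in the list [s], applied to [w]; multiplicities of exponents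
    are repetitions in the list. *)
Definition lfact m A s (w : 'M[F]_(n, m)) := foldr (fun x v => A *m v - x *: v) w s.

Lemma lfact_comm m A B s (w : 'M[F]_(n, m)) : A *m B = B *m A ->
  lfact A s (B *m w) = B *m lfact A s w.
Proof.
move=> AB; elim: s => //= x s ->.
by rewrite mulmxBr !mulmxA AB scalemxAr.
Qed.

Lemma lfactB m A s (v w : 'M[F]_(n, m)) : lfact A s (v - w) = lfact A s v - lfact A s w.
Proof.
elim: s => //= x s ->; rewrite mulmxBr scalerBr !opprB addrACA [RHS]addrACA.
by congr (_ + _); rewrite addrC.
Qed.

Lemma lfactZ m A s c (w : 'M[F]_(n, m)) : lfact A s (c *: w) = c *: lfact A s w.
Proof. by elim: s => //= x s ->; rewrite -scalemxAr scalerBr !scalerA mulrC. Qed.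

Lemma lfact_shift m A s x (w : 'M[F]_(n, m)) :
  lfact A s (A *m w - x *: w) = A *m lfact A s w - x *: lfact A s w.
Proof. by rewrite lfactB lfactZ lfact_comm. Qed.

Lemma lfact_eigen m A s x (w : 'M[F]_(n, m)) : A *m w = x *: w ->
  lfact A s w = (\prod_(y <- s) (x - y)) *: w.
Proof.
move=> h; elim: s => [|y s IH] /=; first by rewrite big_nil scale1r.
by rewrite IH big_cons -scalemxAr h !scalerA -scalerBl [_ * x]mulrC -mulrBl.
Qed.

Lemma lfact_eigen_mem m A s x (w : 'M[F]_(n, m)) : lfact A s w = 0 -> A *m w = x *: w ->
  w != 0 -> x \in s.
Proof.
move=> As h w0; move: As; rewrite (lfact_eigen s h) => /eqP.
rewrite scaler_eq0 (negbTE w0) orbF.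
elim: s => [|y s IH]; rewrite ?big_nil ?oner_eq0// big_cons mulf_eq0 subr_eq0 inE.
by case: (x == y) => //= /IH.
Qed.

Lemma lfact_conj A B P s : P \in unitmx -> P *m A = B *m P ->
  forall m (w : 'M[F]_(n, m)), P *m lfact A s w = lfact B s (P *m w).
Proof.
move=> Pu h m w; elim: s => //= x s <-.
by rewrite mulmxBr mulmxA h -scalemxAr mulmxA.
Qed.

(** The equation reads [H A = (A - c) H], so [prod (A - x) = 0] becomes [prod (A - (c + x)) H = 0].
    No [c + x] is an eigenvalue of [A], and the factors can be cancelled one by one. *)
Lemma nonresonant A s c : (forall m (w : 'M[F]_(n, m)), lfact A s w = 0) ->
  (forall x y, x \in s -> y \in s -> c + x != y) ->
  forall H, c *: H + H *m A - A *m H = 0 -> H = 0.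
Proof.
move=> hA hs H E.
have {}E : H *m A = A *m H - c *: H.
  by apply/eqP; rewrite -subr_eq0 opprB addrCA addrA E.
have step s' : H *m lfact A s' 1%:M = lfact A (map (fun x => c + x) s') H.
  elim: s' => [|x s' IH] /=; first by rewrite mulmx1.
  rewrite -IH [LHS]mulmxBr (mulmxA H A) E mulmxBl -(mulmxA A) -(scalemxAl c) -(scalemxAr x).
  by rewrite scalerDl opprD addrA.
have := step s; rewrite hA mulmx0 => /esym.
have : {subset s <= s} by [].
elim: {-2}s => //= x s' IH sub h.
apply: IH; first by move=> y ys; apply: sub; rewrite inE ys orbT.
apply/eqP; apply: contraT => v0.
have hv : A *m lfact A [seq c + x | x <- s'] H = (c + x) *: lfact A [seq c + x | x <- s'] H.
  by apply/eqP; rewrite -subr_eq0 h.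
have := lfact_eigen_mem (hA _ _) hv v0.
by move=> /(hs x _ (sub x (mem_head _ _))); rewrite eqxx.
Qed.

End LinearFactors.

Opaque cexp mexp mPS PS.

(** * Eigenvectors of a matrix and of its exponential *)

Section ExponentialSpectrum.
Variable R : realType.
Local Notation C := (complexField R).
Variables (n : nat) (M : 'M[C]_n).
Implicit Types (z x : C) (s : seq C) (u w : 'cV[C]_n).

Lemma mexp_eigen z x w : M *m w = x *: w -> mexp M z *m w = cexp (x * z) *: w.
Proof.
move=> h; apply: (@ode_unique_cst _ _ _ M (fun z => mexp M z *m w) (fun z => cexp (x * z) *: w) 0 z).
- by move=> v; rewrite mulmxA; apply: mderivMr; exact: mexp_deriv.
- move=> v; have E k : (k * (x * 1)) *: w = M *m (k *: w).
    by rewrite mulr1 -scalemxAr h scalerA.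
  rewrite -E; apply: mderivZc.
  exact: cderiv_comp (cderivZ x (cderiv_id v)) (cexp_deriv _).
- by rewrite mulr0 mexp0 cexp0 mul1mx scale1r.
Qed.

Lemma mexp_jordan z x w : M *m (M *m w - x *: w) = x *: (M *m w - x *: w) ->
  mexp M z *m w = cexp (x * z) *: (w + z *: (M *m w - x *: w)).
Proof.
set v := M *m w - x *: w => h.
have Mw : M *m w = x *: w + v by rewrite /v addrC subrK.
apply: (@ode_unique_cst _ _ _ M (fun z => mexp M z *m w)
  (fun z => cexp (x * z) *: (w + z *: v)) 0 z).
- by move=> t; rewrite mulmxA; apply: mderivMr; exact: mexp_deriv.
- move=> t; have E k : (k * (x * 1)) *: (w + t *: v) + k *: (0 + 1 *: v) = M *m (k *: (w + t *: v)).
    rewrite mulr1 add0r scale1r -scalemxAr mulmxDr -scalemxAr h Mw -scalerA -scalerDr.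
    by congr (_ *: _); rewrite scalerDr addrAC !scalerA [x * t]mulrC.
  rewrite -E; apply: mderivZ; first exact: cderiv_comp (cderivZ x (cderiv_id t)) (cexp_deriv _).
  by apply: mderivD; [exact: mderiv_cst|apply: mderivZc; exact: cderiv_id].
- by rewrite mulr0 mexp0 cexp0 mul1mx scale1r scale0r addr0.
Qed.

(** [lfact M s w] is an eigenvector for [x] or zero, and [mexp M z] commutes with [M]; hence
    [mexp M z *m w - cexp (x * z) *: w] is annihilated by the shorter list. *)
Lemma lfact_mexp z s w : lfact M s w = 0 ->
  lfact (mexp M z) (map (fun x => cexp (x * z)) s) w = 0.
Proof.
elim: s w => [//|x s IH] w /= h.
have hv : M *m lfact M s w = x *: lfact M s w by apply/eqP; rewrite -subr_eq0 h.
have E : lfact M s (mexp M z *m w - cexp (x * z) *: w) = 0.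
  by rewrite lfactB lfactZ (lfact_comm _ _ (mexp_comm M z)) (mexp_eigen z hv) subrr.
by have := IH _ E; rewrite lfact_shift.
Qed.

(** By induction [u = (M - y) v] is zero or an eigenvector of [M], for some [y']. If [y' = y], then
    [v] and [u] form a Jordan chain, and [mexp M z] has no eigenvector on it except multiples of
    [u]. If [y' != y], then [(M - y') v] is zero, or an eigenvector for [y]; in the latter case [y]
    and [y'] have the same exponential, against injectivity. *)
Lemma mexp_eigenvector z s x w : z != 0 ->
  {in s &, forall y y', cexp (y * z) = cexp (y' * z) -> y = y'} ->
  lfact M s w = 0 -> mexp M z *m w = x *: w -> w != 0 ->
  exists2 y, y \in s & M *m w = y *: w.
Proof.
move=> z0; move=> inj h Tw w0.
suff H : forall s', {subset s' <= s} -> forall v : 'cV[C]_n, lfact M s' v = 0 -> mexp M z *m v = x *: v -> v != 0 ->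
    exists2 y, y \in s & M *m v = y *: v.
  exact: (H s (fun y ys => ys) w h Tw w0).
elim=> [|y s' IH] sub v /= hv Tv v0; first by rewrite hv eqxx in v0.
have ys : y \in s by apply: sub; exact: mem_head.
have sub' : {subset s' <= s} by move=> y' ys'; apply: sub; rewrite inE ys' orbT.
have [E|u0] := eqVneq (M *m v - y *: v) 0.
  by exists y => //; apply/eqP; rewrite -subr_eq0 E.
set u := M *m v - y *: v in u0.
have Tu : mexp M z *m u = x *: u.
  by rewrite mulmxBr mulmxA -mexp_comm -mulmxA -scalemxAr Tv -scalemxAr scalerBr !scalerA mulrC.
have [y' ys' hu] := IH sub' u (etrans (lfact_shift _ _ _ _) hv) Tu u0.
have eigx c (t : 'cV[C]_n) : t != 0 -> M *m t = c *: t -> mexp M z *m t = x *: t ->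
    x = cexp (c * z).
  move=> t0 /(mexp_eigen z) -> /eqP; rewrite -subr_eq0 -scalerBl scaler_eq0 (negbTE t0) orbF.
  by rewrite subr_eq0 => /eqP.
have xy' := eigx _ _ u0 hu Tu.
have [yy|yy] := eqVneq y y'.
  have := mexp_jordan z (_ : M *m (M *m v - y *: v) = y *: (M *m v - y *: v)).
  rewrite -/u hu yy => /(_ erefl); rewrite Tv xy' => /eqP.
  rewrite -subr_eq0 -scalerBr scaler_eq0 (negbTE (cexp_neq0 _)) /= opprD addrA subrr sub0r.
  by rewrite oppr_eq0 scaler_eq0 (negbTE z0) (negbTE u0).
have [E|t0] := eqVneq (M *m v - y' *: v) 0.
  by exists y' => //; apply/eqP; rewrite -subr_eq0 E.
set t := M *m v - y' *: v in t0.
have Tt : mexp M z *m t = x *: t.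
  by rewrite mulmxBr mulmxA -mexp_comm -mulmxA -scalemxAr Tv -scalemxAr scalerBr !scalerA mulrC.
have ht : M *m t = y *: t.
  apply/eqP; rewrite -subr_eq0; apply/eqP.
  transitivity (M *m u - y' *: u); last by rewrite hu subrr.
  rewrite /t /u !mulmxBr !scalerBr -!scalemxAr !scalerA [y' * y]mulrC !opprB.
  move: (M *m (M *m v)) (y *: (M *m v)) (y' *: (M *m v)) (_ *: v) => A1 A2 A3 A4.
  by rewrite addrACA [RHS]addrACA; congr (_ + _); rewrite addrC.
have xy := eigx _ _ t0 ht Tt.
by case/eqP: yy; exact: (inj _ _ ys ys' (etrans (esym xy) xy')).
Qed.

End ExponentialSpectrum.

(** * Frobenius solutions in the logarithmic coordinate *)

Section FrobeniusSolutions.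
Variable R : realType.
Local Notation C := (complexField R).
Implicit Types (x z t : C).

Lemma finite_delta (I : finType) (P : I -> R -> Prop) :
  (forall i, exists2 dl, 0 < dl & forall h, h < dl -> P i h) ->
  exists2 dl, 0 < dl & forall h, h < dl -> forall i, P i h.
Proof.
move=> H; suff [dl dl0 hd] : exists2 dl, 0 < dl & forall h, h < dl ->
    forall i, i \in enum I -> P i h.
  by exists dl => // h hh i; apply: hd => //; rewrite mem_enum.
elim: (enum I) => [|i s [dl dl0 hd]]; first by exists 1.
have [d2 d20 hd2] := H i; exists (Num.min dl d2); first by rewrite lt_min dl0.
move=> h; rewrite lt_min => /andP[h1 h2] j; rewrite inE => /orP[/eqP ->|js].
  exact: hd2.
exact: hd.
Qed.

Lemma mnorm_eq0 m n (A : 'M[C]_(m, n)) : mnorm A <= 0 -> A = 0.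
Proof.
move=> h; apply/matrixP => i j; apply/eqP; rewrite mxE -cmod_eq0 eq_le cmod_ge0 andbT.
exact: le_trans (mnorm_entry A i j) h.
Qed.

Lemma mPS_unit_near0 n (A : nat -> 'M[C]_n) r : mcvg A r -> A 0%N = 1%:M ->
  exists2 dl, 0 < dl & forall t, cmod t < dl -> mPS A t \in unitmx.
Proof.
move=> hA A0; have [r0 _] := hA.
(* The [n * n] entries of [1 - mPS A t], each at most [e], make its norm at most 1/2, so [mPS A t]
   is injective. *)
set e : R := 2^-1 / (n * n + 1)%:R.
have e0 : 0 < e by rewrite /e divr_gt0// ltr0n addn1.
have [ij|dl dl0 hd] := @finite_delta ('I_n * 'I_n)%type (fun ij (s : R) =>
    forall t, cmod t = s -> cmod ((1%:M - mPS A t) ij.1 ij.2) <= e).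
  have hr : cmod (0 : C) < r by rewrite cmod0.
  have [d d0 h] := cderiv_cont (mPS_deriv hA hr ij.1 ij.2) e0.
  exists d => // s sd t ts; rewrite -ts in sd; have := h t sd.
  by rewrite add0r mPS0 A0 cmod_dist !mxE => /ltW.
exists dl => // t td; apply: mulmx_inj_unit => c Ac.
have cE : c = (1%:M - mPS A t) *m c by rewrite mulmxBl Ac mul1mx subr0.
apply: mnorm_eq0; have cn := mnorm_ge0 c.
have := mnormM (1%:M - mPS A t) c; rewrite -cE.
have : mnorm (1%:M - mPS A t) <= 2^-1.
  apply: (@le_trans _ _ (\sum_(i < n) \sum_(j < n) e)).
    apply: ler_sum => i _; apply: ler_sum => j _; exact: (hd (cmod t) td (i, j) t erefl).
  have -> : \sum_(i < n) \sum_(j < n) e = 2^-1 * ((n * n)%:R / (n * n + 1)%:R).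
    by rewrite !sumr_const !card_ord -mulrnA -[LHS]mulr_natr /e mulrAC -mulrA.
  by rewrite ler_piMr// ler_pdivrMr ?ltr0n ?addn1// mul1r ler_nat leqnSn.
by move=> h1 h2; have : mnorm c <= 2^-1 * mnorm c;
  [apply: le_trans h2 _; rewrite ler_wpM2r|lra].
Qed.

Lemma cexp_2pi : cexp (toC (2 * pi) * cI R) = 1.
Proof. by rewrite cexp_imag mulr2n mulrDl mul1r -mulr2n cos2pi sin2pi. Qed.

Lemma cexp_periodic x : cexp (x + toC (2 * pi) * cI R) = cexp x.
Proof. by rewrite cexpD cexp_2pi mulr1. Qed.

(** The solution [H(t) t^M] at [t = cexp x]. *)
Definition frob n (M : 'M[C]_n) (H : nat -> 'M[C]_n) x : 'M[C]_n := mPS H (cexp x) *m mexp M x.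

Lemma frobenius_solution n (M D : 'M[C]_n) (l : R) : 0 < l ->
  (forall k (H : 'M[C]_n), k.+1%:R *: H + H *m M - M *m H = 0 -> H = 0) ->
  exists H V : nat -> 'M[C]_n, [/\ H 0%N = 1%:M,
    forall k, k.+1%:R *: H k.+1 + H k.+1 *m M - M *m H k.+1 = D *m V k,
    forall k, mshift V k - toC l *: V k = H k,
    forall r, 0 < r -> r < l -> mcvg H r &
    is_sol (xfuchs M D (toC l)) (fun x => expR (cRe x) < l) (frob M H) /\
    exists u0 : R, forall x, cRe x <= u0 -> frob M H x \in unitmx].
Proof.
move=> l0 nonres.
have lam0 : toC l != 0 by rewrite toC_eq0 gt_eqF.
have [H [V [H0 HS VS hH]]] := frobenius_series D lam0 nonres.
have hc r : 0 < r -> r < l -> mcvg H r.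
  by move=> r0 rl; case: (hH r r0) => //; rewrite cmod_toC ger0_norm// ltW.
exists H, V; split => //; split.
- move=> x xl; set t := cexp x; have tl : cmod t < l by rewrite /t cmod_cexp.
  have t0 := cmod_ge0 t.
  have r0 : 0 < (cmod t + l) / 2 by lra.
  have rl : (cmod t + l) / 2 < cmod (toC l) by rewrite cmod_toC ger0_norm ?(ltW l0)//; lra.
  have tr : cmod t < (cmod t + l) / 2 by lra.
  have [hHr ode] := hH _ r0 rl.
  have hd := mderivM (mderiv_comp (cexp_deriv x) (mPS_deriv hHr tr)) (mexp_deriv M x).
  have E : xfuchs M D (toC l) x *m frob M H x =
      cexp x *: mPS (mder H) (cexp x) *m mexp M x + mPS H (cexp x) *m (M *m mexp M x).
    rewrite /frob (mulmxA _ (mPS H _)) (mulmxA (mPS H _)) -mulmxDl; congr (_ *m _).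
    by rewrite (ode _ tr).
  by rewrite E.
- have l2 : 0 < l / 2 by rewrite divr_gt0.
  have [dl dl0 hd] := mPS_unit_near0 (hc (l / 2) l2 ltac:(lra)) H0.
  exists (ln (dl / 2)) => x xu; rewrite /frob unitmx_mul.
  apply/andP; split; last exact: mexp_unit; apply: hd.
  rewrite cmod_cexp; apply: (@le_lt_trans _ _ (dl / 2)); last lra.
  by rewrite -[leRHS]lnK ?posrE ?divr_gt0// ler_expR.
Qed.

Lemma frob_mul n m (M : 'M[C]_n) H x (w : 'M[C]_(n, m)) :
  frob M H x *m w = mPS H (cexp x) *m (mexp M x *m w).
Proof. by rewrite /frob mulmxA. Qed.

Lemma frob_periodic n (M : 'M[C]_n) H x :
  frob M H (x + toC (2 * pi) * cI R) = frob M H x *m mexp M (toC (2 * pi) * cI R).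
Proof. by rewrite /frob cexp_periodic [x + _]addrC mexpD mulmxA. Qed.

End FrobeniusSolutions.

(** * Transport around a circle through the charts *)

Section CircleMonodromy.
Variable R : realType.
Local Notation C := (complexField R).
Implicit Types (x z t : C) (u v : R).

Lemma vertical_segment u v v' (s : R) :
  (u +i* v : C) + toC s * ((u +i* v') - (u +i* v)) = (u +i* ((1 - s) * v + s * v')).
Proof.
by apply: complex_eqP; rewrite ?segment_Re ?segment_Im /=; ring.
Qed.

Lemma convex_comb_itv (s v v' a b : R) : 0 <= s <= 1 -> a <= v <= b -> a <= v' <= b ->
  a <= (1 - s) * v + s * v' <= b.
Proof. by move=> /andP[? ?] /andP[? ?] /andP[? ?]; apply/andP; split; nra. Qed.

Variables (n : nat) (M D : 'M[C]_n) (l : R).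
Hypothesis l0 : 0 < l.
Variables (E : chart -> C -> 'M[C]_n) (a b : 'M[C]_n).
Hypothesis at_ab : atlas l M D E a b.

(* Going once around the circle [|t| = exp u] through the charts [c], up, left and down. *)
Lemma circle_monodromy c (g T : 'M[C]_n) u (Y : C -> 'M[C]_n) :
  (forall t, cdom l c t -> cdom l ChartUp t -> E c t = E ChartUp t) ->
  (forall t, cdom l c t -> cdom l ChartDown t -> E c t = E ChartDown t *m g) ->
  (forall v, - (pi / 4) <= v <= pi / 4 -> cdom l c (cexp (u +i* v))) ->
  is_sol (xfuchs M D (toC l)) (fun x => cRe x = u) Y ->
  (forall x, cRe x = u -> Y x \in unitmx) ->
  (forall x, Y (x + toC (2 * pi) * cI R) = Y x *m T) ->
  exists w, [/\ w \in unitmx, T *m w *m g = w & E c (cexp (toC u)) = Y (toC u) *m w].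
Proof.
move=> cU cD cdm hY Yu YT.
have pi0 : 0 < pi :> R := pi_gt0 R.
have eu := expR_gt0 u.
have transp c' v v' w lo hi : lo <= v <= hi -> lo <= v' <= hi ->
    (forall v, lo <= v <= hi -> cdom l c' (cexp (u +i* v))) ->
    E c' (cexp (u +i* v)) = Y (u +i* v) *m w -> E c' (cexp (u +i* v')) = Y (u +i* v') *m w.
  move=> vI vI' dom.
  apply: (@xfuchs_unique _ _ M D (toC l) _
    (fun x => cRe x = u /\ cdom l c' (cexp x)) (fun x => E c' (cexp x)) (fun x => Y x *m w)).
  - by move=> x [_ /(cdom_regular l0)[]].
  - move=> s; rewrite in_itv => s01; rewrite vertical_segment; split => //.
    by apply: dom; exact: convex_comb_itv.
  - by apply: is_sol_sub (is_sol_cexp (atlas_sol at_ab (c := c'))) => x [].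
  - by apply: is_sol_sub (is_solMr w hY) => x [].
have dU v : pi / 4 <= v <= 3 * pi / 4 -> cdom l ChartUp (cexp (u +i* v)).
  by move=> /andP[h1 h2]; rewrite cexpE /= mulr_gt0// sin_gt0_pi//; apply/andP; split; lra.
have dL v : 3 * pi / 4 <= v <= 5 * pi / 4 -> cdom l ChartLeft (cexp (u +i* v)).
  move=> /andP[h1 h2]; rewrite cexpE /= pmulr_rlt0//.
  have -> : v = (v - pi) + pi by ring.
  by rewrite cosDpi oppr_lt0 cos_gt0_pihalf//; apply/andP; split; lra.
have dD v : 5 * pi / 4 <= v <= 7 * pi / 4 -> cdom l ChartDown (cexp (u +i* v)).
  move=> /andP[h1 h2]; rewrite cexpE /= pmulr_rlt0//.
  have -> : v = (v - pi) + pi by ring.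
  by rewrite sinDpi oppr_lt0 sin_gt0_pi//; apply/andP; split; lra.
(* The constant matrix relating the local solutions to [Y]. Uniqueness keeps it the same on the four
   arcs of a quarter turn each, as long as the gluing is trivial. *)
pose w := invmx (Y (u +i* (pi / 4))) *m E ChartUp (cexp (u +i* (pi / 4))).
have I (p q r : R) : p <= q -> q <= r -> p <= q <= r by move=> -> ->.
have w1 : E ChartUp (cexp (u +i* (pi / 4))) = Y (u +i* (pi / 4)) *m w.
  by rewrite /w mulKVmx// Yu.
have c1 : cdom l c (cexp (u +i* (pi / 4))) by apply: cdm; apply: I; lra.
have U1 : cdom l ChartUp (cexp (u +i* (pi / 4))) by apply: dU; apply: I; lra.
have wc : E c (cexp (u +i* (pi / 4))) = Y (u +i* (pi / 4)) *m w by rewrite cU.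
have wc0 : E c (cexp (u +i* (- (pi / 4)))) = Y (u +i* (- (pi / 4))) *m w.
  by apply: (transp _ (pi / 4) _ _ (- (pi / 4)) (pi / 4)) => //; apply: I; lra.
have wr : E c (cexp (u +i* 0)) = Y (u +i* 0) *m w.
  by apply: (transp _ (pi / 4) _ _ (- (pi / 4)) (pi / 4)) => //; apply: I; lra.
have w2 : E ChartUp (cexp (u +i* (3 * pi / 4))) = Y (u +i* (3 * pi / 4)) *m w.
  by apply: (transp _ (pi / 4) _ _ (pi / 4) (3 * pi / 4)) => //; apply: I; lra.
have U2 : cdom l ChartUp (cexp (u +i* (3 * pi / 4))) by apply: dU; apply: I; lra.
have L2 : cdom l ChartLeft (cexp (u +i* (3 * pi / 4))) by apply: dL; apply: I; lra.
have w2' : E ChartLeft (cexp (u +i* (3 * pi / 4))) = Y (u +i* (3 * pi / 4)) *m w.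
  exact: etrans (atlas_LU at_ab L2 U2) w2.
have w3 : E ChartLeft (cexp (u +i* (5 * pi / 4))) = Y (u +i* (5 * pi / 4)) *m w.
  by apply: (transp _ (3 * pi / 4) _ _ (3 * pi / 4) (5 * pi / 4)) => //; apply: I; lra.
have L3 : cdom l ChartLeft (cexp (u +i* (5 * pi / 4))) by apply: dL; apply: I; lra.
have D3 : cdom l ChartDown (cexp (u +i* (5 * pi / 4))) by apply: dD; apply: I; lra.
have w3' : E ChartDown (cexp (u +i* (5 * pi / 4))) = Y (u +i* (5 * pi / 4)) *m w.
  exact: etrans (esym (atlas_LD at_ab L3 D3)) w3.
have w4 : E ChartDown (cexp (u +i* (7 * pi / 4))) = Y (u +i* (7 * pi / 4)) *m w.
  by apply: (transp _ (5 * pi / 4) _ _ (5 * pi / 4) (7 * pi / 4)) => //; apply: I; lra.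
(* The last angle is the first one, [- pi / 4], after a full turn. There [Y] has acquired the factor
   [T], and the passage from the lower half plane back to [c] adds [g]; comparison gives
   [T w g = w], so [g] is conjugate to the inverse of [T]. *)
have xE : (u +i* (7 * pi / 4) : C) = (u +i* (- (pi / 4))) + toC (2 * pi) * cI R.
  by apply: complex_eqP; rewrite ?cReD ?cImD ?cReM ?cImM /=; field.
rewrite xE cexp_periodic YT in w4.
have D0 : cdom l ChartDown (cexp (u +i* (- (pi / 4)))).
  rewrite -cexp_periodic -xE; apply: dD; apply: I; lra.
have c0 : cdom l c (cexp (u +i* (- (pi / 4)))) by apply: cdm; apply: I; lra.
exists w; split => //.
- by rewrite /w unitmx_mul unitmx_inv Yu//= (atlas_unit at_ab U1).
- have := cD _ c0 D0; rewrite wc0 w4 => /(congr1 (mulmx (invmx (Y (u +i* (- (pi / 4))))))).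
  by rewrite -!mulmxA !mulKmx ?Yu// => <-.
Qed.

End CircleMonodromy.

(** * Companion matrices and Levelt's argument *)

Section CompanionMatrices.
Variables (F : fieldType) (n' : nat).
Local Notation n := n'.+1.
Implicit Types (A a b : 'M[F]_n) (p : {poly F}) (s : seq F).

(** The form with the coefficients in the last row describes [theta] on jets; [ccomp], with the
    coefficients in the last column, is the form of the generators of the hypergeometric group. *)
Definition rcomp p : 'M[F]_n :=
  \matrix_(i, j) if i == n' :> nat then - p`_j else (j == i.+1 :> nat)%:R.

Definition ccomp p : 'M[F]_n :=
  \matrix_(i, j) if j == n' :> nat then - p`_i else (i == j.+1 :> nat)%:R.

Lemma horner_mxE A p : horner_mx A p = \sum_(i < size p) p`_i *: A ^+ i.
Proof.
rewrite -[X in horner_mx A X]coefK poly_def rmorph_sum; apply: eq_bigr => i _.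
by rewrite /= horner_mxZ rmorphXn /= horner_mx_X.
Qed.

Lemma lfactE m A s (w : 'M[F]_(n, m)) :
  lfact A s w = horner_mx A (\prod_(x <- s) ('X - x%:P)) *m w.
Proof.
elim: s => [|x s IH] /=; first by rewrite big_nil rmorph1 mul1mx.
rewrite IH big_cons rmorphM rmorphB /= horner_mx_X horner_mx_C -mulmxE mulmxA.
by rewrite -!mulmxA mulmxBl mul_scalar_mx.
Qed.

Lemma rcomp_mul m p (w : 'M[F]_(n, m)) (i : 'I_n) (k : 'I_m) (lt : (i.+1 < n)%N) :
  (rcomp p *m w) i k = w (Ordinal lt) k.
Proof.
rewrite mxE (bigD1 (Ordinal lt))//= mxE /= eqxx.
have /negbTE -> : nat_of_ord i != n' by rewrite neq_ltn -ltnS lt.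
rewrite mul1r big1 ?addr0// => j /eqP ji; rewrite mxE.
have /negbTE -> : nat_of_ord i != n' by rewrite neq_ltn -ltnS lt.
by case: eqP => [E|_]; rewrite ?mul0r//; case: ji; apply: val_inj.
Qed.

Lemma rcomp_mul_last m p (w : 'M[F]_(n, m)) (k : 'I_m) :
  (rcomp p *m w) ord_max k = - \sum_(j < n) p`_j * w j k.
Proof.
by rewrite mxE -sumrN; apply: eq_bigr => j _; rewrite mxE /= eqxx mulNr.
Qed.

(** The first basis row [e ord0] is cyclic and is annihilated by [p(A)], which commutes with the
    powers of [A]. *)
Lemma rcomp_annihilated p : p \is monic -> size p = n.+1 -> horner_mx (rcomp p) p = 0.
Proof.
move=> pm sp; set A := rcomp p.
pose e (i : 'I_n) : 'rV[F]_n := delta_mx 0 i.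
have eS (i : 'I_n) (lt : (i.+1 < n)%N) : e i *m A = e (Ordinal lt).
  apply/rowP => j; rewrite -rowE !mxE /=.
  have /negbTE -> : nat_of_ord i != n' by rewrite neq_ltn -ltnS lt.
  by [].
have eX k (lt : (k < n)%N) : e ord0 *m A ^+ k = e (Ordinal lt).
  elim: k lt => [|k IH] lt; first by rewrite expr0 mulmx1; congr e; apply: val_inj.
  by rewrite exprSr -mulmxE mulmxA (IH (ltnW lt)) (eS (Ordinal (ltnW lt)) lt).
have e0 : e ord0 *m horner_mx A p = 0.
  rewrite horner_mxE sp big_ord_recr /= mulmxDr mulmx_sumr.
  have lt : (n' < n)%N by [].
  have -> : p`_n = 1 by have := monicP pm; rewrite lead_coefE sp.
  rewrite scale1r exprSr -mulmxE mulmxA (eX n' lt).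
  apply/rowP => j; rewrite mxE summxE [X in _ + X](_ : _ = - p`_j); last first.
    by rewrite -rowE !mxE /= eqxx.
  rewrite (bigD1 j)//= -scalemxAr (eX j (ltn_ord j)) !mxE /= big1 ?addr0 => [|i /eqP ij].
    by rewrite (_ : j == _ = true) ?mulr1 ?subrr//; apply/eqP/val_inj.
  rewrite -scalemxAr (eX i (ltn_ord i)) !mxE /=.
  by case: eqP => [E|_]; rewrite ?mulr0//; case: ij; rewrite E; apply: val_inj.
apply/row_matrixP => i; rewrite row0 rowE.
have := eX i (ltn_ord i); rewrite (_ : Ordinal _ = i); last exact: val_inj.
rewrite /e => <-; rewrite -mulmxA mulmxE.
have -> : A ^+ i * horner_mx A p = horner_mx A p * A ^+ i.
  by rewrite -{1 4}(horner_mx_X A) -rmorphXn /= -!rmorphM mulrC.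
by rewrite -mulmxE mulmxA e0 mul0mx.
Qed.

Lemma rcomp_lfact s m (w : 'M[F]_(n, m)) : size s = n ->
  lfact (rcomp (\prod_(x <- s) ('X - x%:P))) s w = 0.
Proof.
move=> sn; rewrite lfactE rcomp_annihilated ?mul0mx ?monic_prod_XsubC//.
by rewrite size_prod_XsubC sn.
Qed.

(** The kernel of [W] lies in the last coordinate line, so the image of [W] has codimension at most
    1 and contains the kernel of a covector. *)
Lemma hyperplane_covector (W : 'M[F]_n) :
  (forall c : 'cV[F]_n, W *m c = 0 -> forall i, i != ord_max -> c i 0 = 0) ->
  exists k : 'rV[F]_n, forall v : 'cV[F]_n, k *m v = 0 -> exists c, v = W *m c.
Proof.
move=> hW; pose A := W^T.
have kerA : (kermx A <= (delta_mx 0 ord_max : 'rV[F]_n))%MS.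
  apply/row_subP => i; set x := row i (kermx A).
  have xA : x *m A = 0 by rewrite /x -row_mul mulmx_ker row0.
  have Wx : W *m x^T = 0 by apply: trmx_inj; rewrite trmx_mul trmxK xA trmx0.
  have := hW _ Wx => hx.
  have -> : x = x 0 ord_max *: delta_mx 0 ord_max.
    apply/rowP => j; rewrite !mxE /=.
    have [->|jm] := eqVneq j ord_max; first by rewrite mulr1.
    by have := hx j jm; rewrite !mxE mulr0.
  exact: scalemx_sub.
have rA : (n - 1 <= \rank A)%N.
  have := mxrankS kerA; rewrite mxrank_ker mxrank_delta.
  by have := rank_leq_row A; lia.
pose K := cokermx A.
have rK : (\rank K <= 1)%N by rewrite mxrank_coker; have := rank_leq_row A; lia.
(* [col_base K] has at most one column; the sum is this column, or 0 when [W] is onto. *)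
pose k : 'cV[F]_n := \col_i \sum_j col_base K i j.
exists k^T => v kv.
have {}kv : v^T *m k = 0 by apply: trmx_inj; rewrite trmx_mul trmxK trmx0.
have vK : v^T *m col_base K = 0.
  apply/rowP => j; have := congr1 (fun B : 'M[F]_1 => B 0 0) kv; rewrite !mxE.
  rewrite (eq_bigr (fun i => \sum_j v^T 0 i * col_base K i j)); last first.
    by move=> i _; rewrite [k _ _]mxE mulr_sumr.
  have uniqj (j' : 'I_(\rank K)) : j' = j.
    by apply: val_inj => /=; have := ltn_ord j; have := ltn_ord j'; lia.
  rewrite exchange_big /= (bigD1 j)//= [X in _ + X = 0]big1 ?addr0; last first.
    by move=> j'; rewrite (uniqj j') eqxx.
  by [].
have : (v^T <= A)%MS by rewrite submxE -/K -(mulmx_base K) mulmxA vK mul0mx.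
by case/submxP => c vc; exists c^T; apply: trmx_inj; rewrite trmx_mul trmxK.
Qed.

(** The last nonzero partial product is an eigenvector. Being a polynomial in [a] applied to [v], it
    stays in every [a]-stable subspace that contains [v]. *)
Lemma lfact_find_eigenvector a s (v : 'cV[F]_n) : v != 0 -> lfact a s v = 0 ->
  exists f x, horner_mx a f *m v != 0 /\ a *m (horner_mx a f *m v) = x *: (horner_mx a f *m v).
Proof.
move=> v0; elim: s => [|x s IH] /= h; first by rewrite h eqxx in v0.
have [/IH//|u0] := eqVneq (lfact a s v) 0.
exists (\prod_(x <- s) ('X - x%:P)), x; rewrite -lfactE; split => //.
by apply/eqP; rewrite -subr_eq0 h.
Qed.

(** Let [k] be a covector whose kernel lies in the image of [W]. A nonzero vector killed by all
    [k a^i] would generate an [a]-stable subspace of this kernel, which would contain an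
    eigenvector; so the [k a^i] with [i < n] form a basis of covectors, the rows of [O]. This basis
    yields a vector that is cyclic for [a] and for [b] at once. *)
Lemma common_cyclic_vector a b (W : 'M[F]_n) s (p1 : {poly F}) :
  let p0 := \prod_(x <- s) ('X - x%:P) in
  size s = n -> (forall w : 'cV[F]_n, lfact a s w = 0) ->
  p1 \is monic -> size p1 = n.+1 -> horner_mx b p1 = 0 ->
  a *m W = b *m W ->
  (forall c : 'cV[F]_n, W *m c = 0 -> forall i, i != ord_max -> c i 0 = 0) ->
  (forall x (c : 'cV[F]_n), a *m (W *m c) = x *: (W *m c) -> W *m c = 0) ->
  exists2 T : 'M[F]_n, T \in unitmx & a *m T = T *m ccomp p0 /\ b *m T = T *m ccomp p1.
Proof.
move=> p0 sn ha p1m sp1 hb abW hW noeig.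
have sp0 : size p0 = n.+1 by rewrite size_prod_XsubC sn.
have p0m : p0 \is monic by exact: monic_prod_XsubC.
have [k hk] := hyperplane_covector hW.
pose O : 'M[F]_n := \matrix_(i, j) (k *m a ^+ i) 0 j.
have OE (v : 'cV[F]_n) (i : 'I_n) : (O *m v) i 0 = (k *m (a ^+ i *m v)) 0 0.
  by rewrite mulmxA !mxE; apply: eq_bigr => j _; rewrite mxE.
have Ou : O \in unitmx.
  rewrite -unitmx_tr -row_free_unit -kermx_eq0; apply/eqP/row_matrixP => i0; rewrite row0.
  set x := row i0 _; have xO : x *m O^T = 0 by rewrite /x -row_mul mulmx_ker row0.
  pose v := x^T; have Ov : O *m v = 0 by apply: trmx_inj; rewrite trmx_mul trmxK xO trmx0.
  suff v0 : v = 0 by apply: trmx_inj; rewrite trmx0.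
  apply/eqP; apply: contraT => v0.
  have [f [x' [u0 hu]]] := lfact_find_eigenvector v0 (ha v).
  have ku : k *m (horner_mx a f *m v) = 0.
    rewrite (divp_eq f p0) rmorphD rmorphM /= -mulmxE mulmxDl.
    rewrite -(mulmxA (horner_mx a (divp f p0))) -(lfactE a s v) ha mulmx0 add0r.
    have sr : (size (modp f p0) <= n)%N.
      by have := ltn_modp f p0; rewrite sp0 ltnS => ->; exact: monic_neq0.
    rewrite horner_mxE mulmx_suml mulmx_sumr big1// => i _.
    have lt : (i < n)%N := leq_trans (ltn_ord i) sr.
    rewrite -scalemxAl -scalemxAr; have := OE v (Ordinal lt); rewrite Ov mxE /= => E.
    by rewrite (_ : k *m _ = 0) ?scaler0//; apply/matrixP => i1 i2; rewrite !ord1 -E mxE.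
  have [c vc] := hk _ ku.
  by move: u0; rewrite vc (noeig x' c) ?eqxx// -vc.
(* Chosen so that [k a^i v] is 0 for [i < n'] and 1 for [i = n']. Thus [a^i v] with [i < n'] lies in
   the kernel of [k], where [a] and [b] agree, and the powers of [a] and of [b] below [n] coincide
   on [v]. *)
pose v : 'cV[F]_n := invmx O *m delta_mx ord_max 0.
have kv i (lt : (i < n)%N) : (k *m (a ^+ i *m v)) 0 0 = (i == n')%:R.
  rewrite -(OE v (Ordinal lt)) /v mulKVmx// !mxE /= andbT; congr (_%:R).
pose T : 'M[F]_n := \matrix_(i, j) (a ^+ j *m v) i 0.
have TE (c : 'cV[F]_n) : T *m c = \sum_j c j 0 *: (a ^+ j *m v).
  apply/colP => i; rewrite mxE summxE; apply: eq_bigr => j _.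
  by rewrite !mxE mulrC; congr (_ * _); rewrite mxE.
have colT (j : 'I_n) : col j T = a ^+ j *m v by apply/colP => i; rewrite !mxE.
have Tu : T \in unitmx.
  rewrite -unitmx_tr -row_free_unit -kermx_eq0; apply/eqP/row_matrixP => i0; rewrite row0.
  set x := row i0 _; have xT : x *m T^T = 0 by rewrite /x -row_mul mulmx_ker row0.
  pose c := x^T; have Tc : T *m c = 0 by apply: trmx_inj; rewrite trmx_mul trmxK xT trmx0.
  (* The matrix of the numbers [k a^(m + j) v] is triangular with respect to the antidiagonal, on
     which it is 1, so the coordinates of [c] vanish from the last one down. *)
  suff H m : forall j : 'I_n, (n' - j = m)%N -> c j 0 = 0.
    by apply/rowP => j; have := H _ j erefl; rewrite !mxE.
  elim/ltn_ind: m => m IH j jm.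
  have : (k *m (a ^+ m *m (T *m c))) 0 0 = 0 by rewrite Tc !mulmx0 mxE.
  rewrite TE !mulmx_sumr summxE (bigD1 j)//= big1 ?addr0 => [|i ij].
    rewrite -!scalemxAr mxE (mulmxA (a ^+ m)) mulmxE -exprD (_ : (m + j = n')%N); last first.
      by have := ltn_ord j; lia.
    by rewrite kv// eqxx mulr1.
  rewrite -!scalemxAr mxE; have [lt|le] := ltnP i j.
    rewrite (mulmxA (a ^+ m)) mulmxE -exprD kv; last by have := ltn_ord j; lia.
    by rewrite (_ : (m + i == n') = false) ?mulr0//; have := ltn_ord j; lia.
  rewrite (IH (n' - i)%N) ?mul0r//; move/eqP: ij => ij.
  have : nat_of_ord i <> j by move=> E; apply: ij; apply: val_inj.
  by have := ltn_ord i; lia.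
have colccomp (p : {poly F}) (j : 'I_n) : col j (T *m ccomp p) =
    if j == n' :> nat then - \sum_(i < n) p`_i *: (a ^+ i *m v) else a ^+ j.+1 *m v.
  rewrite colE -mulmxA -colE TE; case: eqP => jn.
    by rewrite -sumrN; apply: eq_bigr => i _; rewrite !mxE jn eqxx scaleNr.
  have lt : (j.+1 < n)%N by have := ltn_ord j; lia.
  rewrite (bigD1 (Ordinal lt))//= big1 ?addr0 => [|i ij].
    by rewrite !mxE /= eqxx; case: eqP jn => // _ _; rewrite scale1r.
  rewrite !mxE; case: eqP jn => // _ _; case: eqP => [E|_]; rewrite ?scale0r//.
  by case/eqP: ij; apply: val_inj.
have top (A : 'M[F]_n) (p : {poly F}) : p \is monic -> size p = n.+1 -> horner_mx A p = 0 ->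
    A ^+ n *m v = - \sum_(i < n) p`_i *: (A ^+ i *m v).
  move=> pm sp; rewrite horner_mxE sp big_ord_recr /=.
  have -> : p`_n = 1 by have := monicP pm; rewrite lead_coefE sp.
  rewrite scale1r => /eqP; rewrite addrC addr_eq0 => /eqP ->.
  by rewrite mulNmx mulmx_suml; congr (- _); apply: eq_bigr => i _; rewrite scalemxAl.
have stepb j : (j < n')%N -> b *m (a ^+ j *m v) = a *m (a ^+ j *m v).
  move=> lt; have [|c ->] := hk (a ^+ j *m v).
    apply/matrixP => i1 i2; rewrite !ord1 [RHS]mxE kv; last exact: leqW.
    by rewrite (ltn_eqF lt).
  by rewrite !mulmxA abW.
have powb j : (j < n)%N -> b ^+ j *m v = a ^+ j *m v.
  elim: j => [|j IH] lt; first by rewrite !expr0.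
  by rewrite !exprS -!mulmxE -!mulmxA IH ?(ltnW lt)// stepb.
have p0a : horner_mx a p0 = 0.
  apply/row_matrixP => i; apply/rowP => j; rewrite row0 !mxE.
  have := ha (delta_mx j 0); rewrite lfactE -colE => /colP/(_ i); rewrite !mxE.
  by rewrite /p0.
exists T => //; split; apply: trmx_inj; apply/row_matrixP => j; rewrite -!tr_col; congr (_^T);
  rewrite colccomp colE -mulmxA -colE colT.
- case: eqP => [->|_]; last by rewrite mulmxA exprS mulmxE.
  by rewrite -(top a p0)// exprS -mulmxE mulmxA.
- case: eqP => [->|jn].
    have -> : \sum_(i < n) p1`_i *: (a ^+ i *m v) = \sum_(i < n) p1`_i *: (b ^+ i *m v).
      by apply: eq_bigr => i _; rewrite powb.
    by rewrite -(top b p1)// exprS -mulmxE -mulmxA powb.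
  rewrite stepb; last by have := ltn_ord j; lia.
  by rewrite mulmxA exprS mulmxE.
Qed.

End CompanionMatrices.

(** * Solutions holomorphic at lambda *)

Section ApparentHyperplane.
Variable R : realType.
Local Notation C := (complexField R).
Implicit Types (x z t u : C).

Lemma mPS_bounded m n (A : nat -> 'M[C]_(m, n)) r : mcvg A r ->
  exists K, forall z, cmod z <= r / 2 -> mnorm (mPS A z) <= K.
Proof.
move=> hA.
have hij i j : exists K, forall z, cmod z <= r / 2 -> cmod (mPS A z i j) <= K.
  have [K _ hK] := PS_tail 0 (mcvg_entry i j hA); exists K => z zr.
  by have := hK z zr; rewrite big_ord0 subr0 expr0 mulr1 -mPSE.
exists (\sum_i \sum_j sval (cid (hij i j))) => z zr.
by apply: ler_sum => i _; apply: ler_sum => j _; apply: (svalP (cid (hij i j))).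
Qed.

Lemma mPS_eq0_isolated m n (A : nat -> 'M[C]_(m, n)) r : mcvg A r ->
  (forall e, 0 < e -> exists2 z, z != 0 & cmod z < e /\ mPS A z = 0) -> A 0%N = 0.
Proof.
move=> hA h; apply/matrixP => i j; rewrite [RHS]mxE.
apply: (PS_isolated (mcvg_entry i j hA)) => e /h[z z0 [ze Az]].
by exists z => //; split => //; rewrite -mPSE Az mxE.
Qed.

Variables (n : nat) (M D : 'M[C]_n) (l : R).
Hypothesis l0 : 0 < l.
Variables (E : chart -> C -> 'M[C]_n) (a b : 'M[C]_n).
Hypothesis at_ab : atlas l M D E a b.
Local Notation G := (fuchs M D (toC l)).

Lemma small_ball_pt (eta : R) (s s' : R) : 0 < eta -> eta <= l / 8 -> `|s| <= eta -> `|s'| <= eta ->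
  in_ball (toC l) (l / 2) ((l + s) +i* s').
Proof.
move=> e0 el hs hs'; rewrite /in_ball; apply: le_lt_trans (cmod_le _) _.
rewrite cReB cImB /= subr0 addrAC subrr add0r; have := l0; lra.
Qed.

(* A solution holomorphic at [lam] continues to the same function on the lower half plane
   whether one passes to the left or to the right of [lam]. *)
Lemma apparent_hyperplane m (Z : 'M[C]_(n, m)) :
  (forall k, k.+1%:R%:M - D \in unitmx) -> D *m Z = 0 ->
  exists W : 'M[C]_(n, m), [/\ a *m W = b *m W,
    forall c : 'cV[C]_m, W *m c = 0 -> Z *m c = 0 &
    exists2 e : R, 0 < e & exists K : R, forall s, l - e < s < l ->
      mnorm (E ChartMid (toC s) *m W) <= K].
Proof.
move=> Du DZ; have lam0 : toC l != 0 by rewrite toC_eq0 gt_eqF.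
have [A [A0 hA]] := apparent_point_series M lam0 Du DZ.
have l2 : 0 < l / 2 by rewrite divr_gt0.
have l2' : l / 2 < cmod (toC l) by rewrite cmod_toC ger0_norm ?(ltW l0)//; have := l0; lra.
have [hAc hAd] := hA _ l2 l2'.
pose Y t := mPS A (t - toC l).
pose Om c t := cdom l c t /\ in_ball (toC l) (l / 2) t.
have Oreg c t : Om c t -> t != 0 /\ t != toC l by move=> [/(cdom_regular l0)].
have Ocvx c p q : Om c p -> Om c q -> on_segment p q (Om c).
  by move=> [p1 p2] [q1 q2] s s01; split; [exact: cdom_convex|exact: (convex_ball p2 q2)].
have hY c : is_sol G (Om c) Y.
  move=> t Ot; have [_ tb] := Ot; have [_ tl] := Oreg c t Ot.
  have tl0 : t - toC l != 0 by rewrite subr_eq0.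
  have ct : toC l + (t - toC l) = t by ring.
  have := hAd _ tl0 tb; rewrite ct => h.
  have := mderiv_comp (cderivD (cderiv_id t) (cderiv_cst (- toC l) t)) h.
  by rewrite addr0 scale1r.
have hE c (X : 'M[C]_(n, m)) : is_sol G (Om c) (fun t => E c t *m X).
  by apply: is_sol_sub (is_solMr X (atlas_sol at_ab (c := c))) => t [].
have tr c (X : 'M[C]_(n, m)) p q : Om c p -> Om c q -> E c p *m X = Y p -> E c q *m X = Y q.
  move=> Op Oq; exact: (fuchs_unique (Oreg c) (Ocvx c p q Op Oq) (hE c X) (hY c)).
(* Small enough for the square of half side [eta] about [lam] to lie in the disc where [Y]
   converges, and for its left side to lie in the middle chart. *)
set eta := l / 8; have eta0 : 0 < eta by rewrite /eta divr_gt0.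
pose pt (s s' : R) : C := (l + s) +i* s'.
have inb s s' : `|s| <= eta -> `|s'| <= eta -> in_ball (toC l) (l / 2) (pt s s').
  exact: small_ball_pt.
have mid s' : `|s'| <= eta -> cdom l ChartMid (pt (- eta) s').
  move=> hs; rewrite /= /in_ball cmod_lt_sqr ?(ltW l2)// cReB cImB /= subr0.
  have : s' ^+ 2 <= eta ^+ 2 by rewrite -(real_normK (num_real s')) lerXn2r ?nnegrE ?(ltW eta0).
  by have := l0; rewrite /eta; nra.
have right s' : cdom l ChartRight (pt eta s') by rewrite /= ltrDl.
have n0 : `|0 : R| <= eta by rewrite normr0 ltW.
have np : `|eta| <= eta by rewrite gtr0_norm.
have nm : `|- eta| <= eta by rewrite normrN.
have O1 : Om ChartMid (pt (- eta) 0) by split; [exact: mid|exact: inb].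
have O2 : Om ChartMid (pt (- eta) eta) by split; [exact: mid|exact: inb].
have O5 : Om ChartMid (pt (- eta) (- eta)) by split; [exact: mid|exact: inb].
have U2 : Om ChartUp (pt (- eta) eta) by split; [exact: eta0|exact: inb].
have U3 : Om ChartUp (pt eta eta) by split; [exact: eta0|exact: inb].
have R3 : Om ChartRight (pt eta eta) by split; [exact: right|exact: inb].
have R4 : Om ChartRight (pt eta (- eta)) by split; [exact: right|exact: inb].
have dn s : cdom l ChartDown (pt s (- eta)) by rewrite /= oppr_lt0.
have D4 : Om ChartDown (pt eta (- eta)) by split; [exact: dn|exact: inb].
have D5 : Om ChartDown (pt (- eta) (- eta)) by split; [exact: dn|exact: inb].
pose W := invmx (E ChartMid (pt (- eta) 0)) *m Y (pt (- eta) 0).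
have W1 : E ChartMid (pt (- eta) 0) *m W = Y (pt (- eta) 0).
  by rewrite mulKVmx// (atlas_unit at_ab O1.1).
have W2 := tr _ _ _ _ O1 O2 W1.
have W5 := tr _ _ _ _ O1 O5 W1.
rewrite (atlas_MU at_ab O2.1 U2.1) in W2.
have W3 := tr _ _ _ _ U2 U3 W2.
rewrite -(atlas_RU at_ab R3.1 U3.1) in W3.
have W4 := tr _ _ _ _ R3 R4 W3.
rewrite (atlas_RD at_ab R4.1 D4.1) -mulmxA in W4.
have W45 := tr _ _ _ _ D4 D5 W4.
rewrite (atlas_MD at_ab O5.1 D5.1) -mulmxA in W5.
have ptl s : pt (- s) 0 - toC l = toC (- s).
  by apply: complex_eqP; rewrite ?cReB ?cImB /= ?subr0// addrAC subrr add0r.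
have Omid s : 0 < s -> s <= eta -> Om ChartMid (pt (- s) 0).
  move=> s0 se; split; last by apply: inb; rewrite // normrN gtr0_norm.
  rewrite /= /in_ball (_ : pt (- s) 0 - _ = toC (l / 2 - s)).
    by rewrite cmod_toC ltr_norml; apply/andP; split; have := l0; rewrite /eta in se; lra.
  by apply: complex_eqP; rewrite ?cReB ?cImB /= ?subr0//; field.
exists W; split.
(* At the lower left corner the left route has produced the coordinates [a W] in the lower half
   plane and the route around the right side [b W]; both represent the same value of [Y]. *)
- have := etrans W5 (esym W45).
  move=> /(congr1 (mulmx (invmx (E ChartDown (pt (- eta) (- eta)))))).
  by rewrite !mulKmx// (atlas_unit at_ab D5.1).
- move=> c Wc.
  (* The function [Y c] vanishes on a segment that ends at [lam]; its zeros accumulate there, which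
     kills its constant term [Z c]. *)
  have Yc s : 0 < s -> s <= eta -> Y (pt (- s) 0) *m c = 0.
    by move=> s0 se; rewrite -(tr _ _ _ _ O1 (Omid s s0 se) W1) -mulmxA Wc mulmx0.
  rewrite -A0; apply: (mPS_eq0_isolated (mcvgMr c hAc)) => e e0.
  set s := Num.min (e / 2) eta; have s0 : 0 < s by rewrite lt_min eta0 divr_gt0.
  have se : s <= eta by rewrite ge_min lexx orbT.
  have se2 : s < e by rewrite (@le_lt_trans _ _ (e / 2)) ?ge_min ?lexx//; lra.
  exists (toC (- s)); first by rewrite toC_eq0 oppr_eq0 gt_eqF.
  have cs : cmod (toC (- s)) < e by rewrite cmod_toC normrN gtr0_norm.
  split => //; have cl : cmod (toC (- s)) < l / 2.
    by rewrite cmod_toC normrN gtr0_norm//; have := l0; rewrite /eta in se; lra.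
  by rewrite (mPSMr c hAc cl); have := Yc s s0 se; rewrite /Y ptl.
- have [K hK] := mPS_bounded hAc; exists eta => //; exists K => s /andP[s1 s2].
  have sE : toC s = pt (- (l - s)) 0.
    by apply: complex_eqP => //=; rewrite opprB addrC subrK.
  have ls0 : 0 < l - s by lra.
  have lse : l - s <= eta by lra.
  rewrite sE (tr _ _ _ _ O1 (Omid _ ls0 lse) W1) /Y ptl; apply: hK.
  by rewrite cmod_toC normrN gtr0_norm//; have := l0; rewrite /eta in lse; lra.
Qed.

End ApparentHyperplane.

(** * Lower bounds for series with nonnegative terms *)

Section PositiveSeries.
Variable R : realType.
Local Notation C := (complexField R).

Lemma prod_sub_le (s : seq R) (X : R) : (forall y, y \in s -> 0 <= y <= X) ->
  0 <= \prod_(y <- s) (X - y) <= X ^+ size s.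
Proof.
elim: s => [|y s IH] h; first by rewrite big_nil lexx ler01.
have /andP[y0 yX] := h y (mem_head _ _).
have /andP[h1 h2] := IH (fun z zs => h z (mem_behead (s := y :: s) zs)).
rewrite big_cons /= exprS mulr_ge0 ?subr_ge0//=; apply: ler_pM => //; rewrite ?subr_ge0//.
by rewrite gerBl.
Qed.

Lemma prod_add_ge (s : seq R) (X : R) : 0 <= X -> (forall y, y \in s -> 0 <= y) ->
  X ^+ size s <= \prod_(y <- s) (X + y).
Proof.
move=> X0; elim: s => [|y s IH] h; first by rewrite big_nil.
have y0 := h y (mem_head _ _).
have h1 := IH (fun z zs => h z (mem_behead (s := y :: s) zs)).
by rewrite big_cons /= exprS; apply: ler_pM; rewrite ?exprn_ge0// lerDl.
Qed.

Lemma prod_gt0 (I : eqType) (s : seq I) (f : I -> R) : (forall y, y \in s -> 0 < f y) ->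
  0 < \prod_(y <- s) f y.
Proof. by move=> h; rewrite big_seq; apply: prodr_gt0 => y /h. Qed.

Lemma bernoulli_sub (d : R) k : 0 <= d <= 1 -> 1 - k%:R * d <= (1 - d) ^+ k.
Proof.
move=> /andP[d0 d1]; elim: k => [|k IH]; first by rewrite mul0r subr0.
have k0 : 0 <= k%:R :> R by rewrite ler0n.
rewrite exprS; apply: (@le_trans _ _ ((1 - d) * (1 - k%:R * d))).
  by rewrite -natr1; nra.
by rewrite ler_wpM2l// subr_ge0.
Qed.

Lemma harmonic_unbounded (B : R) : exists m, B < \sum_(k < m) (k.+2%:R)^-1.
Proof.
apply: contrapT => H; have {}H m : \sum_(k < m) (k.+2%:R)^-1 <= B.
  by rewrite leNgt; apply/negP => h; apply: H; exists m.
apply: (@dvg_harmonic R); apply: nondecreasing_is_cvgn.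
  by apply: nondecreasing_series => k _ _; rewrite /harmonic /= invr_ge0.
exists (1 + B) => _ [m _ <-]; rewrite seriesEord /=.
case: m => [|m]; first by rewrite big_ord0; have := H 0%N; rewrite big_ord0; lra.
by rewrite big_ord_recl /harmonic /= invr1 lerD2l; exact: H.
Qed.

(** Turns growth of the coefficients into growth of the function: with nonnegative terms every
    partial sum lies below the limit. *)
Lemma PS_real_ge (g : nat -> R) (r t : R) m : pscvg (fun k => toC (g k)) r ->
  (forall k, 0 <= g k) -> 0 <= t -> t < r ->
  \sum_(k < m) g k * t ^+ k <= cmod (PS (fun k => toC (g k)) (toC t)).
Proof.
move=> hg g0 t0 tr; have tr' : cmod (toC t) < r by rewrite cmod_toC ger0_norm.
have hs := PS_is_csum hg tr'.
apply/ler_addgt0Pr => e e0; have [N hN] := hs _ e0.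
have := hN (maxn m N) (leq_maxr _ _).
have -> : \sum_(i < maxn m N) psterm (fun k => toC (g k)) (toC t) i =
    toC (\sum_(i < maxn m N) g i * t ^+ i).
  rewrite (big_morph (@toC R) (@toCD R) (toC0 R)); apply: eq_bigr => i _.
  by rewrite /psterm toCM toCX.
set S := \sum_(i < maxn m N) _; set P := PS _ _ => h.
have mS : \sum_(k < m) g k * t ^+ k <= S.
  rewrite /S -!(big_mkord xpredT (fun k => g k * t ^+ k)).
  rewrite [leRHS](@big_cat_nat _ _ _ m)//= ?leq_maxl// lerDl.
  by apply: sumr_ge0 => i _; rewrite mulr_ge0 ?exprn_ge0.
apply: (le_trans mS); have := cmodD (toC S - P) P; rewrite subrK cmod_toC => h2.
by have := ler_norm S; lra.
Qed.

End PositiveSeries.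

(** * The hypergeometric system and the growth of its Frobenius solutions *)

Section HypergeometricSystem.
Variable R : realType.
Local Notation C := (complexField R).
Variables (n' : nat) (rho al : seq R) (l : R).
Local Notation n := n'.+1.
Hypotheses (l0 : 0 < l) (size_rho : size rho = n) (size_al : size al = n).
Hypotheses (rho01 : forall x, x \in rho -> 0 <= x < 1) (al01 : forall x, x \in al -> 0 < x <= 1).

Definition indicial0 : {poly C} := \prod_(x <- map (@toC R) rho) ('X - x%:P).
Definition indicialoo : {poly C} := \prod_(x <- map (fun x => toC (- x)) al) ('X - x%:P).
Local Notation p := indicial0.
Local Notation r := indicialoo.

(* [fuchs sysM sysD (toC l)] is the system satisfied by the jets of the solutions of
   [l p(theta) f = t r(theta) f]. *)
Definition sysM : 'M[C]_n := rcomp n' p.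
Definition sysD : 'M[C]_n := rcomp n' r - rcomp n' p.

Lemma size_indicial0 : size p = n.+1.
Proof. by rewrite size_prod_XsubC size_map size_rho. Qed.
Lemma size_indicialoo : size r = n.+1.
Proof. by rewrite size_prod_XsubC size_map size_al. Qed.
Lemma monic_indicial0 : p \is monic. Proof. exact: monic_prod_XsubC. Qed.
Lemma monic_indicialoo : r \is monic. Proof. exact: monic_prod_XsubC. Qed.

Lemma horner_monic_split (q : {poly C}) x : q \is monic -> size q = n.+1 ->
  q.[x] = \sum_(i < n) q`_i * x ^+ i + x ^+ n.
Proof.
move=> qm sq; rewrite horner_coef sq big_ord_recr /=; congr (_ + _).
by have := monicP qm; rewrite lead_coefE sq /= => ->; rewrite mul1r.
Qed.

Lemma sysD_mul m (w : 'M[C]_(n, m)) i k : i != ord_max -> (sysD *m w) i k = 0.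
Proof.
move=> im; have lt : (i.+1 < n)%N.
  have := ltn_ord i; rewrite ltnS leq_eqVlt => /orP[/eqP E|//].
  by case/eqP: im; apply: val_inj.
by rewrite mulmxBl [LHS]mxE [X in _ + X]mxE !(rcomp_mul _ _ _ lt) subrr.
Qed.

Lemma sysD_row i j : i != ord_max -> sysD i j = 0.
Proof. by move=> im; have := sysD_mul (1%:M : 'M[C]_n) j im; rewrite mulmx1. Qed.

Lemma sysD_mul_last m (w : 'M[C]_(n, m)) k :
  (sysD *m w) ord_max k = \sum_(j < n) (p`_j - r`_j) * w j k.
Proof.
rewrite mulmxBl [LHS]mxE [X in _ + X]mxE !rcomp_mul_last opprK addrC -sumrN -big_split.
by apply: eq_bigr => j _; rewrite mulrBl.
Qed.

(** Such a [w] is the jet of a multiple of [t^x] at [t = 1], on which the system acts through the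
    indicial polynomials; both are monic, so the terms of degree [n] cancel. *)
Lemma sysD_geometric (w : 'cV[C]_n) x : (forall i, w i 0 = x ^+ i * w ord0 0) ->
  (sysD *m w) ord_max 0 = (p.[x] - r.[x]) * w ord0 0.
Proof.
move=> hw; rewrite sysD_mul_last.
rewrite (horner_monic_split _ monic_indicial0 size_indicial0).
rewrite (horner_monic_split _ monic_indicialoo size_indicialoo).
rewrite opprD addrACA subrr addr0 -sumrB mulr_suml; apply: eq_bigr => j _.
by rewrite hw -mulrBl mulrA.
Qed.

Lemma sysM_geometric (w : 'cV[C]_n) x : (forall i, w i 0 = x ^+ i * w ord0 0) ->
  (x *: w - sysM *m w) ord_max 0 = p.[x] * w ord0 0.
Proof.
move=> hw; rewrite [LHS]mxE [X in _ + X]mxE rcomp_mul_last opprK mxE (hw ord_max).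
rewrite (horner_monic_split _ monic_indicial0 size_indicial0) mulrDl addrC mulr_suml.
congr (_ + _); last by rewrite mulrA -exprS.
by apply: eq_bigr => j _; rewrite (hw j) mulrA.
Qed.

Lemma geometric_of_rows (w v : 'cV[C]_n) x : (forall i, i != ord_max -> v i 0 = 0) ->
  x *: w - sysM *m w = v -> forall i, w i 0 = x ^+ i * w ord0 0.
Proof.
move=> hv E [i lt]; elim: i lt => [|i IH] lt.
  by rewrite expr0 mul1r; congr (w _ _); apply: val_inj.
have lt' : (i < n)%N := ltnW lt.
have := congr1 (fun u : 'cV[C]_n => u (Ordinal lt') 0) E.
rewrite (hv (Ordinal lt')); last by rewrite neq_ltn /= -ltnS lt.
rewrite [LHS]mxE [X in _ + X]mxE (@rcomp_mul _ _ _ _ _ (Ordinal lt') _ lt) mxE (IH lt') => /eqP.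
by rewrite subr_eq0 => /eqP <-; rewrite /= exprS mulrA.
Qed.

(** [D] is zero outside its last row, so this entry is its trace and its only possible nonzero
    eigenvalue. By Vieta it is minus the sum of all entries of [rho] and [al]; being negative, it is
    neither 0 nor a positive integer. *)
Lemma sysD_trace : exists2 dl : R, dl < 0 & sysD ord_max ord_max = toC dl.
Proof.
exists (- (\sum_(x <- rho) x + \sum_(x <- al) x)).
  rewrite oppr_lt0; apply: ltr_wpDl.
    by rewrite big_seq; apply: sumr_ge0 => x /rho01/andP[].
  have : (0 < size al)%N by rewrite size_al.
  move: al01; case: al => // x s h _; rewrite big_cons; apply: ltr_wpDr.
    by rewrite big_seq; apply: sumr_ge0 => y ys; have /andP[/ltW] := h y (mem_behead (s := x :: s) ys).
  by have /andP[] := h x (mem_head _ _).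
rewrite mxE [X in _ + X]mxE !mxE /= eqxx opprK.
have s1 : size (map (@toC R) rho) != 0%N by rewrite size_map size_rho.
have s2 : size (map (fun x => toC (- x)) al) != 0%N by rewrite size_map size_al.
have := coefPn_prod_XsubC s1; rewrite size_map size_rho /= -/p => ->.
have := coefPn_prod_XsubC s2; rewrite size_map size_al /= -/r => ->.
rewrite opprK !big_map toCN toCD opprD addrC; congr (_ + _).
  by rewrite (big_morph (@toC R) (@toCD R) (toC0 R)).
rewrite (big_morph (@toC R) (@toCD R) (toC0 R)) -sumrN.
by apply: eq_bigr => x _; rewrite toCN.
Qed.

Lemma sysD_resolvent k : k.+1%:R%:M - sysD \in unitmx.
Proof.
have [dl dl0 hdl] := sysD_trace.
apply: mulmx_inj_unit => c; rewrite mulmxBl mul_scalar_mx => E.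
have ci i : i != ord_max -> c i 0 = 0.
  move=> im; have := congr1 (fun u : 'cV[C]_n => u i 0) E.
  rewrite [LHS]mxE [X in _ + X]mxE (sysD_mul _ _ im) oppr0 addr0 !mxE => /eqP.
  by rewrite mulf_eq0 pnatr_eq0 => /orP[//|/eqP].
apply/colP => i; rewrite [RHS]mxE; have [->|/ci//] := eqVneq i ord_max.
have := congr1 (fun u : 'cV[C]_n => u ord_max 0) E.
rewrite [LHS]mxE [X in _ + X]mxE [(sysD *m c) _ _]mxE (bigD1 ord_max)//= big1 => [|j jm]; last first.
  by rewrite ci// mulr0.
rewrite addr0 hdl !mxE -mulrBl -toC_nat -toCB => /eqP; rewrite mulf_eq0 toC_eq0.
have k0 : 0 <= k.+1%:R :> R by rewrite ler0n.
by rewrite gt_eqF ?subr_gt0 ?(lt_le_trans dl0)//= => /eqP.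
Qed.

(** As [D^2 = dl D] with [dl != 0], the matrix [1 - D / dl] projects onto the kernel of [D] along
    the image of [D], which is the last coordinate line. *)
Lemma sysD_projection : exists Z : 'M[C]_n, sysD *m Z = 0 /\
  forall c : 'cV[C]_n, Z *m c = 0 -> forall i, i != ord_max -> c i 0 = 0.
Proof.
have [dl dl0 hdl] := sysD_trace.
have d0 : toC dl != 0 by rewrite toC_eq0 lt_eqF.
exists (1%:M - (toC dl)^-1 *: sysD); split.
  have DD : sysD *m sysD = toC dl *: sysD.
    apply/matrixP => i j; rewrite [RHS]mxE.
    have [->|im] := eqVneq i ord_max.
      rewrite mxE (bigD1 ord_max)//= big1 ?addr0 ?hdl// => k km.
      by rewrite (sysD_row _ km) mulr0.
    by rewrite sysD_mul// sysD_row// mulr0.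
  by rewrite mulmxBr mulmx1 -scalemxAr DD scalerA mulVf// scale1r subrr.
move=> c; rewrite mulmxBl mul1mx -scalemxAl => /eqP; rewrite subr_eq0 => /eqP E i im.
by rewrite E mxE (sysD_mul _ _ im) mulr0.
Qed.

Lemma sysM_lfact m (w : 'M[C]_(n, m)) : lfact sysM (map (@toC R) rho) w = 0.
Proof. by rewrite rcomp_lfact// size_map. Qed.

Definition rho_poly (x : R) := \prod_(y <- rho) (x - y).
Definition al_poly (x : R) := \prod_(y <- al) (x + y).

Lemma indicial0_real x : p.[toC x] = toC (rho_poly x).
Proof.
rewrite horner_prod big_map (big_morph (@toC R) (@toCM R) (toC1 R)).
by apply: eq_bigr => y _; rewrite hornerXsubC toCB.
Qed.

Lemma indicialoo_real x : r.[toC x] = toC (al_poly x).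
Proof.
rewrite horner_prod big_map (big_morph (@toC R) (@toCM R) (toC1 R)).
by apply: eq_bigr => y _; rewrite hornerXsubC toCN opprK toCD.
Qed.

(* The Frobenius solution [t^x0 \sum_k c_k t^k] attached to an exponent [x0] has positive
   coefficients with [(k + x0)^n' c_k l^k >= const / k], so its last component blows up at [l]. *)
Lemma frob_unbounded (H V : nat -> 'M[C]_n) (w : 'cV[C]_n) (x0 : R) :
  H 0%N = 1%:M ->
  (forall k, k.+1%:R *: H k.+1 + H k.+1 *m sysM - sysM *m H k.+1 = sysD *m V k) ->
  (forall k, mshift V k - toC l *: V k = H k) ->
  (forall s, 0 < s -> s < l -> mcvg H s) ->
  x0 \in rho -> sysM *m w = toC x0 *: w -> w != 0 ->
  forall e K : R, 0 < e -> ~ (forall x : R, l - e < expR x < l ->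
    mnorm (frob sysM H (toC x) *m w) <= K).
Proof.
move=> H0 HS VS hc x0r Mw w0 e K e0 bnd.
have /andP[x00 x01] := rho01 x0r.
pose h k := H k *m w; pose c k := h k ord0 0.
pose X k : R := k%:R + x0.
have XC k : toC (X k) = k%:R + toC x0 by rewrite toCD toC_nat.
have eqh k : toC (X k.+1) *: h k.+1 - sysM *m h k.+1 = sysD *m (V k *m w).
  rewrite mulmxA -HS mulmxBl mulmxDl -scalemxAl -!mulmxA Mw -scalemxAr XC scalerDl.
  by rewrite mulmxA.
have eqh0 : toC (X 0%N) *: h 0%N - sysM *m h 0%N = 0.
  by rewrite /h H0 mul1mx XC add0r Mw subrr.
(* [D] only reaches the last row; the other rows of [eqh] say that each entry of [h k] is [X k]
   times the preceding one, so [h k] is determined by [c k]. *)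
have geo k i : h k i 0 = toC (X k) ^+ i * c k.
  case: k => [|k].
    by apply: (geometric_of_rows _ eqh0) => j _; rewrite mxE.
  by apply: (geometric_of_rows _ (eqh k)) => j jm; rewrite sysD_mul.
have c0E : c 0%N = w ord0 0 by rewrite /c /h H0 mul1mx.
have w00 : w ord0 0 != 0.
  apply: contraNneq w0 => w00; apply/eqP/colP => i.
  by have := geo 0%N i; rewrite /h H0 mul1mx c0E w00 mulr0 mxE.
have l0C : toC l != 0 by rewrite toC_eq0 gt_eqF.
have rec1 k : p.[toC (X k.+1)] * c k.+1 = (sysD *m (V k *m w)) ord_max 0.
  by rewrite -eqh (sysM_geometric (geo k.+1)).
(* By [VS] the left side is the last row of [D (V (k-1) w) - D h k]. The first term is [p(X k) c k]
   by the equation of degree [k], the second is [(p(X k) - r(X k)) c k]. Together with [rec1] this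
   is the two-term recurrence of the hypergeometric series. *)
have recV k : toC l * (sysD *m (V k *m w)) ord_max 0 = r.[toC (X k)] * c k.
  have Dh j : (sysD *m h j) ord_max 0 = (p.[toC (X j)] - r.[toC (X j)]) * c j.
    exact: sysD_geometric (geo j).
  have VE j : toC l *: (V j *m w) = mshift V j *m w - h j.
    by rewrite /h -VS mulmxBl scalemxAl opprB addrC subrK.
  have -> : toC l * (sysD *m (V k *m w)) ord_max 0 = (sysD *m (toC l *: (V k *m w))) ord_max 0.
    by rewrite -scalemxAr [RHS]mxE.
  rewrite VE mulmxBr [LHS]mxE [X in _ + X]mxE Dh.
  case: k => [|k].
    rewrite /= mul0mx mulmx0 mxE add0r mulrBl opprB.
    have := sysM_geometric (geo 0%N); rewrite -/(c 0%N) eqh0 mxE => <-.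
    by rewrite subr0.
  by rewrite /= -rec1 mulrBl opprB addrCA subrr addr0.
have recc k : toC l * (p.[toC (X k.+1)] * c k.+1) = r.[toC (X k)] * c k by rewrite rec1 recV.
have X0 k : 0 <= X k by rewrite /X addr_ge0.
have X1 k : 1 <= X k.+1 by rewrite /X -natr1; have : 0 <= k%:R :> R by []; lra.
have ppos k : 0 < rho_poly (X k.+1).
  by apply: prod_gt0 => y /rho01/andP[_ y1]; rewrite subr_gt0 (lt_le_trans y1).
have rpos k : 0 < al_poly (X k).
  by apply: prod_gt0 => y /al01/andP[y1 _]; rewrite ltr_wpDl.
(* The solution of the recurrence with initial value 1. It is positive because [X k.+1 >= 1] exceeds
   every entry of [rho] and [X k >= 0]. *)
pose kap := fix kap k := if k is j.+1 then al_poly (X j) / (l * rho_poly (X k)) * kap j else 1.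
have kapS k : kap k.+1 = al_poly (X k) / (l * rho_poly (X k.+1)) * kap k by [].
have kap0 k : 0 < kap k.
  by elim: k => [|k IH]; rewrite ?ltr01// kapS mulr_gt0// divr_gt0// mulr_gt0.
have cE k : c k = toC (kap k) * w ord0 0.
  elim: k => [|k IH]; first by rewrite mul1r.
  have pl0 : toC (l * rho_poly (X k.+1)) != 0 by rewrite toC_eq0 gt_eqF// mulr_gt0.
  apply: (mulfI pl0); rewrite toCM -indicial0_real -mulrA recc IH indicialoo_real.
  rewrite kapS indicial0_real -toCM !mulrA -!toCM; congr (toC _ * _).
  by rewrite mulrA mulrCA divff ?mulr1// gt_eqF// mulr_gt0.
pose g k := X k ^+ n' * kap k.
have g0 k : 0 <= g k by rewrite mulr_ge0 ?exprn_ge0// ltW.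
have hlast k : h k ord_max 0 = w ord0 0 * toC (g k).
  by rewrite geo cE -toCX toCM mulrA mulrC.
have gcvg s : 0 < s -> s < l -> pscvg (fun k => toC (g k)) s.
  move=> s0 sl; have := pscvgZ (w ord0 0)^-1 (mcvg_entry ord_max 0 (mcvgMr w (hc s s0 sl))).
  rewrite (_ : (fun k => _) = fun k => toC (g k))//; apply/funext => k.
  by have := hlast k; rewrite /h => ->; rewrite mulKf.
(* A lower bound of [t^x0] for [t > l / 2]: it is at least 1 if [t >= 1], and at least [t] if
   [t < 1], as [0 <= x0 < 1]. *)
set E0 := Num.min 1 (l / 2).
have E00 : 0 < E0 by rewrite lt_min ltr01 divr_gt0.
have cw0 : 0 < cmod (w ord0 0) by rewrite cmod_gt0.
set B := K / (E0 * cmod (w ord0 0)).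
have bd1 m t : l - e < t -> l / 2 < t -> t < l -> \sum_(k < m) g k * t ^+ k <= B.
  move=> te t2 tl; have t0 : 0 < t by apply: lt_trans t2; rewrite divr_gt0.
  set s := (t + l) / 2; have [s0 [ts sl]] : 0 < s /\ (t < s /\ s < l) by rewrite /s; split; [|split]; lra.
  have tE : expR (ln t) = t by rewrite lnK.
  have := bnd (ln t); rewrite tE te tl => /(_ isT).
  have -> : frob sysM H (toC (ln t)) *m w = toC (expR (x0 * ln t)) *: (mPS H (toC t) *m w).
    have hM : mexp sysM (toC (ln t)) *m w = toC (expR (x0 * ln t)) *: w.
      by rewrite (mexp_eigen (toC (ln t)) Mw) -toCM cexp_real.
    have hC : cexp (toC (ln t)) = toC t by rewrite cexp_real tE.
    apply: etrans (frob_mul sysM H (toC (ln t)) w) _.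
    apply: etrans (f_equal2 mulmx (f_equal (mPS H) hC) hM) _.
    exact: esym (scalemxAr (toC (expR (x0 * ln t))) (mPS H (toC t)) w).
  rewrite mnormZ cmod_toC => hb.
  have tr' : cmod (toC t) < s by rewrite cmod_toC gtr0_norm.
  have lastE : (mPS H (toC t) *m w) ord_max 0 = w ord0 0 * PS (fun k => toC (g k)) (toC t).
    rewrite -(mPSMr w (hc s s0 sl) tr') mPSE -(PSZ _ (gcvg s s0 sl) tr').
    by congr (PS _ _); apply/funext => k; exact: hlast.
  have hE : E0 <= `|expR (x0 * ln t)|.
    rewrite ger0_norm ?expR_ge0//; have [t1|t1] := leP 1 t.
      rewrite ge_min; apply/orP; left; rewrite -[leLHS]expR0 ler_expR mulr_ge0//.
      by rewrite ln_ge0.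
    rewrite ge_min; apply/orP; right; apply: (le_trans (ltW t2)); rewrite -[leLHS]tE ler_expR.
    have lt0 : ln t <= 0 by apply: ln_le0; exact: ltW.
    by nra.
  have := PS_real_ge m (gcvg s s0 sl) g0 (ltW t0) ts; set S := \sum_(k < m) _; set P := PS _ _ => SP.
  rewrite /B ler_pdivlMr ?mulr_gt0//.
  apply: le_trans hb; rewrite mulrCA; apply: ler_pM => //; first exact: ltW.
    by rewrite mulr_ge0 ?cmod_ge0//; apply: sumr_ge0 => k _; rewrite mulr_ge0 ?exprn_ge0 ?(ltW t0).
  apply: le_trans (mnorm_entry _ ord_max 0); rewrite lastE cmodM mulrC.
  by rewrite ler_wpM2l ?cmod_ge0.
(* The bound passes to [t = l] for each fixed number of terms: at [t = l (1 - d)] with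
   [d <= 1 / (2 (m + 1))] Bernoulli's inequality gives [(1 - d)^k >= 1/2] for [k < m]. The other two
   terms of the minimum keep [t] above [l / 2] and [l - e]. *)
have bd2 m : \sum_(k < m) g k * l ^+ k <= 2 * B.
  set d := Num.min (2 * (m.+1)%:R)^-1 (Num.min (4^-1) (e / (2 * l))).
  have dA : 0 < (2 * (m.+1)%:R : R)^-1 by rewrite invr_gt0 mulr_gt0// ltr0n.
  have dC : 0 < e / (2 * l) by rewrite divr_gt0// mulr_gt0.
  have d0 : 0 < d by rewrite !lt_min dA dC andbT /= invr_gt0 ltr0n.
  have d1 : d <= (2 * (m.+1)%:R)^-1 by rewrite ge_min lexx.
  have d2 : d <= 4^-1 by rewrite !ge_min lexx /= orbT.
  have d3 : d <= e / (2 * l) by rewrite !ge_min lexx !orbT.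
  have dl : d * l <= e / 2.
    by rewrite -ler_pdivlMr// -mulrA -invfM.
  have := bd1 m (l * (1 - d)); have -> : l - e < l * (1 - d) by lra.
  have -> : l / 2 < l * (1 - d) by have := l0; nra.
  have -> : l * (1 - d) < l by have := l0; nra.
  move=> /(_ isT isT isT) h1.
  rewrite -ler_pdivrMl//; apply: le_trans h1; rewrite mulr_sumr; apply: ler_sum => k _.
  rewrite mulrCA ler_wpM2l// exprMn mulrC ler_wpM2l ?exprn_ge0 ?(ltW l0)//.
  have dd : 0 <= d <= 1 by apply/andP; split; lra.
  apply: le_trans (bernoulli_sub k dd).
  have : k%:R * d <= 2^-1.
    apply: (@le_trans _ _ ((m.+1)%:R * (2 * (m.+1)%:R)^-1)).
      apply: ler_pM => //; first exact: ltW.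
      by rewrite ler_nat ltnW// ltnS ltnW.
    by rewrite invfM mulrCA divff ?mulr1// pnatr_eq0.
  lra.
(* This quantity replaces an asymptotic formula for [kap]. It is nondecreasing since
   [rho_poly X <= X^n <= al_poly X] at [X = X k.+1], and dividing it by [X k.+1 <= k + 2] bounds
   [g k.+1 * l ^+ k.+1] from below by a harmonic term. *)
pose u k := al_poly (X k) * kap k * l ^+ k.
have uE k : u k = rho_poly (X k.+1) * kap k.+1 * l ^+ k.+1.
  rewrite /u kapS exprS; have := ppos k => pk; field.
  by rewrite !gt_eqF.
have u0 : 0 < u 0%N by rewrite /u !mulr_gt0.
have rhoX k y : y \in rho -> 0 <= y <= X k.+1.
  by move=> /rho01/andP[y0 y1]; rewrite y0 (le_trans (ltW y1)).
have umono k : u 0%N <= u k.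
  elim: k => [//|k IH]; apply: le_trans IH _; rewrite uE /u.
  rewrite ler_wpM2r ?exprn_ge0 ?(ltW l0)// ler_wpM2r ?(ltW (kap0 _))//.
  apply: (@le_trans _ _ (X k.+1 ^+ n)).
    by rewrite -size_rho; have /andP[] := prod_sub_le (rhoX k).
  by rewrite -size_al; apply: prod_add_ge => // y /al01/andP[/ltW].
have gl k : u 0%N / k.+2%:R <= g k.+1 * l ^+ k.+1.
  have Xk0 : 0 < X k.+1 by apply: lt_le_trans (X1 k).
  apply: (@le_trans _ _ (u 0%N / X k.+1)).
    rewrite ler_wpM2l ?(ltW u0)// lef_pV2 ?posrE// /X -[k.+2%:R]natr1; lra.
  rewrite ler_pdivrMr//; apply: le_trans (umono k) _; rewrite uE /g.
  have -> : X k.+1 ^+ n' * kap k.+1 * l ^+ k.+1 * X k.+1 = X k.+1 ^+ n * kap k.+1 * l ^+ k.+1.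
    by rewrite (exprS (X k.+1) n'); ring.
  rewrite ler_wpM2r ?exprn_ge0 ?(ltW l0)// ler_wpM2r ?(ltW (kap0 _))//.
  by rewrite -size_rho; have /andP[] := prod_sub_le (rhoX k).
have [m hm] := harmonic_unbounded (2 * B / u 0%N).
have := bd2 m.+1; rewrite big_ord_recl expr0 mulr1 => hB.
have : u 0%N * \sum_(k < m) (k.+2%:R)^-1 <= 2 * B.
  apply: le_trans hB; rewrite mulr_sumr; apply: (@le_trans _ _ (\sum_(k < m) g k.+1 * l ^+ k.+1)).
    by apply: ler_sum => k _; exact: gl.
  by rewrite lerDr.
by rewrite -ler_pdivlMl// mulrC leNgt hm.
Qed.

End HypergeometricSystem.

(** * Local monodromies at the origin and at infinity *)

Section LocalMonodromies.
Variable R : realType.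
Local Notation C := (complexField R).
Local Notation tau := (toC (2 * pi) * cI R).

Lemma cexpN (x : C) : cexp (- x) = (cexp x)^-1.
Proof.
have := cexpD x (- x); rewrite subrr cexp0 => h.
by apply: (mulfI (cexp_neq0 x)); rewrite -h divff// cexp_neq0.
Qed.

Lemma cexp_2pi_real (x : R) : cexp (toC x * tau) = cos (x * (2 * pi)) +i* sin (x * (2 * pi)).
Proof. by rewrite mulrA -toCM cexp_imag. Qed.

Lemma cos_sin_small (d : R) : -1 < d < 1 -> cos (d * (2 * pi)) = 1 -> d = 0.
Proof.
move=> /andP[d0 d1]; have pi0 : 0 < pi :> R := pi_gt0 R.
have -> : d * (2 * pi) = d * pi + d * pi by ring.
rewrite cosD -!expr2 => h; have := cos2Dsin2 (d * pi) => h2.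
have s0 : sin (d * pi) = 0 by apply/eqP; rewrite -sqrf_eq0; apply/eqP; lra.
have [d00|d00|//] := ltgtP d 0.
  have : 0 < sin (- (d * pi)) by apply: sin_gt0_pi; apply/andP; split; nra.
  by rewrite sinN s0 oppr0 ltxx.
have : 0 < sin (d * pi) by apply: sin_gt0_pi; apply/andP; split; nra.
by rewrite s0 ltxx.
Qed.

Lemma cexp_2pi_inj (x y : R) : 0 <= x < 1 -> 0 <= y < 1 ->
  cexp (toC x * tau) = cexp (toC y * tau) -> x = y.
Proof.
move=> /andP[x0 x1] /andP[y0 y1]; rewrite !cexp_2pi_real => -[hc hs].
apply/eqP; rewrite -subr_eq0; apply/eqP; apply: cos_sin_small; first by apply/andP; split; lra.
by rewrite mulrBl cosB hc hs -!expr2 cos2Dsin2.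
Qed.

Lemma cos_quarter (v : R) : - (pi / 4) <= v <= pi / 4 -> 2^-1 <= cos v.
Proof.
move=> /andP[v1 v2]; have pi0 : 0 < pi :> R := pi_gt0 R.
have c0 : 0 < cos v by apply: cos_gt0_pihalf; apply/andP; split; lra.
have c2 : 0 <= cos (v + v) by apply: cos_ge0_pihalf; apply/andP; split; lra.
have h2 := cos2Dsin2 v; rewrite cosD -!expr2 in c2.
rewrite leNgt; apply/negP => h; have : cos v ^+ 2 < 2^-1 ^+ 2.
  by rewrite ltr_pXn2r ?nnegrE ?(ltW c0)//.
by lra.
Qed.

Lemma lfactN n m (A : 'M[C]_n) s (w : 'M[C]_(n, m)) :
  lfact (- A) (map -%R s) w = (-1) ^+ size s *: lfact A s w.
Proof.
elim: s => [|x s IH] /=; first by rewrite scale1r.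
rewrite IH exprS mulN1r scaleNr mulNmx scaleNr opprK -scalemxAr scalerBr opprB addrC.
by rewrite !scalerA mulrC.
Qed.

Lemma mexpN n (M : 'M[C]_n) z : mexp M z *m mexp M (- z) = 1%:M.
Proof. by rewrite -mexpD addrC subrr mexp0. Qed.

Variables (n' : nat) (rho al : seq R) (l : R).
Local Notation n := n'.+1.
Hypotheses (l0 : 0 < l) (size_rho : size rho = n) (size_al : size al = n).
Hypotheses (rho01 : forall x, x \in rho -> 0 <= x < 1) (al01 : forall x, x \in al -> 0 < x <= 1).
Local Notation M := (sysM n' rho).
Local Notation D := (sysD n' rho al).
Local Notation Moo := (- rcomp n' (indicialoo al)).
Variables (E : chart -> C -> 'M[C]_n) (a b : 'M[C]_n).
Hypothesis at_ab : atlas l M D E a b.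

(** The exponents lie in [[0, 1)], so two of them never differ by a positive integer, even if some
    coincide. *)
Lemma nonresonant_M k (H : 'M[C]_n) : k.+1%:R *: H + H *m M - M *m H = 0 -> H = 0.
Proof.
apply: (@nonresonant _ _ _ (map (@toC R) rho)).
  by move=> m w; exact: sysM_lfact.
move=> x y /mapP[x' /rho01/andP[x0 x1] ->] /mapP[y' /rho01/andP[y0 y1] ->].
rewrite -toC_nat -toCD (inj_eq (@toC_inj R)); apply/eqP => h.
have : 0 <= k%:R :> R by []. rewrite -natr1 in h; lra.
Qed.

Lemma Moo_lfact m (w : 'M[C]_(n, m)) : lfact Moo (map (@toC R) al) w = 0.
Proof.
have -> : map (@toC R) al = map -%R (map (fun x => toC (- x)) al).
  by rewrite -map_comp; apply: eq_map => x /=; rewrite toCN opprK.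
by rewrite lfactN rcomp_lfact ?scaler0// size_map.
Qed.

Lemma nonresonant_Moo k (H : 'M[C]_n) : k.+1%:R *: H + H *m Moo - Moo *m H = 0 -> H = 0.
Proof.
apply: (@nonresonant _ _ _ (map (@toC R) al)).
  by move=> m w; exact: Moo_lfact.
move=> x y /mapP[x' /al01/andP[x0 x1] ->] /mapP[y' /al01/andP[y0 y1] ->].
rewrite -toC_nat -toCD (inj_eq (@toC_inj R)); apply/eqP => h.
have : 0 <= k%:R :> R by []. rewrite -natr1 in h; lra.
Qed.

(** The disc of the middle chart is [|t|^2 < l Re t]; on the circle of radius [expR u] this is
    [expR u < l cos v], and [cos v >= 1/2]. *)
Lemma mid_cexp u v : expR u < l / 2 -> - (pi / 4) <= v <= pi / 4 ->
  cdom l ChartMid (cexp (u +i* v)).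
Proof.
move=> hu /cos_quarter hv; rewrite cexpE /= /in_ball cmod_lt_sqr; last by rewrite divr_ge0// ltW.
rewrite cReB cImB /= subr0; have := cos2Dsin2 v; have := expR_gt0 u; set e := expR u in hu *.
set c := cos v in hv *; set s := sin v => e0 cs.
have -> : (e * c - l / 2) ^+ 2 + (e * s) ^+ 2 = e ^+ 2 * (c ^+ 2 + s ^+ 2) - l * e * c + (l / 2) ^+ 2.
  by field.
rewrite cs mulr1.
have : e * e < e * (l / 2) by rewrite ltr_pM2l.
have : 0 < l * e by rewrite mulr_gt0.
have : l * e * 2^-1 <= l * e * c by rewrite ler_wpM2l// ltW// mulr_gt0.
rewrite expr2; lra.
Qed.

Lemma right_cexp u v : 2 * l < expR u -> - (pi / 4) <= v <= pi / 4 ->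
  cdom l ChartRight (cexp (u +i* v)).
Proof.
move=> hu /cos_quarter hv; rewrite cexpE /=.
by apply: (@lt_le_trans _ _ (expR u * 2^-1)); [lra|rewrite ler_wpM2l ?expR_ge0].
Qed.

(** Besides the conjugation of [a], it keeps the recurrence and the domain of the Frobenius solution
    and its value in the middle chart at one point, which are needed to study this solution near
    [l]. *)
Lemma monodromy_a : exists H V w u, [/\
  H 0%N = 1%:M /\ (forall s, 0 < s -> s < l -> mcvg H s),
  (forall k, k.+1%:R *: H k.+1 + H k.+1 *m M - M *m H k.+1 = D *m V k) /\
  (forall k, mshift V k - toC l *: V k = H k),
  is_sol (xfuchs M D (toC l)) (fun x => expR (cRe x) < l) (frob M H),
  w \in unitmx /\ mexp M tau *m w *m a = w &
  expR u < l / 2 /\ E ChartMid (cexp (toC u)) = frob M H (toC u) *m w].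
Proof.
have [H [V [H0 HS VS hc [sol [u0 Hu]]]]] := frobenius_solution D l0 nonresonant_M.
have l4 : 0 < l / 4 by rewrite divr_gt0.
pose u := Num.min u0 (ln (l / 4)).
have uu0 : u <= u0 by rewrite ge_min lexx.
have ul4 : expR u <= l / 4 by rewrite -[leRHS]lnK ?posrE// ler_expR ge_min lexx orbT.
have ul : expR u < l / 2 by have := l0; lra.
have ul' : expR u < l by have := l0; lra.
have solu : is_sol (xfuchs M D (toC l)) (fun x => cRe x = u) (frob M H).
  by apply: is_sol_sub sol => x ->.
have Huu x : cRe x = u -> frob M H x \in unitmx by move=> xu; apply: Hu; rewrite xu.
have [w [wu wT wE]] := circle_monodromy l0 at_ab (c := ChartMid) (g := a) (u := u)
  (atlas_MU at_ab) (atlas_MD at_ab) (fun v => mid_cexp ul) solu Huu (frob_periodic M H).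
by exists H, V, w, u; split.
Qed.

(** The substitution [s = 1 / t] changes the sign of [theta] and replaces [l] by its inverse. The
    coefficient matrix tends to [M + D], the companion matrix of [r], at infinity; hence [Moo] is
    its opposite, with the exponents [al], while [D] is unchanged. *)
Lemma sol_at_infinity (H : nat -> 'M[C]_n) :
  is_sol (xfuchs Moo D (toC l^-1)) (fun x => expR (cRe x) < l^-1) (frob Moo H) ->
  is_sol (xfuchs M D (toC l)) (fun x => l < expR (cRe x)) (fun x => frob Moo H (- x)).
Proof.
move=> sol x xl.
have xl' : expR (cRe (- x)) < l^-1.
  by rewrite cReN expRN ltf_pV2 ?posrE ?expR_gt0.
have hN : cderiv (fun x : C => - x) x (-1).
  have := cderivZ (-1) (cderiv_id x); rewrite mulr1.
  by rewrite (_ : (fun w => _) = fun x : C => - x)//; apply/funext => y; rewrite mulN1r.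
have := mderiv_comp hN (sol _ xl').
rewrite (_ : -1 *: _ = xfuchs M D (toC l) x *m frob Moo H (- x))// scaleN1r -mulNmx.
congr (_ *m _); rewrite /xfuchs cexpN.
set t := cexp x; have t0 : t != 0 := cexp_neq0 x.
have tl : t - toC l != 0.
  rewrite subr_eq0; apply: contraTneq xl => E'; rewrite -leNgt -cmod_cexp -/t E'.
  by rewrite cmod_toC ger0_norm// ltW.
have lC : toC l != 0 by rewrite toC_eq0 gt_eqF.
have -> : rcomp n' (indicialoo al) = M + D by rewrite /sysD addrC subrK.
rewrite opprD opprK -scaleNr -addrA; congr (_ + _).
rewrite -[X in X + _]scale1r -scalerDl; congr (_ *: _).
rewrite toCV (_ : t^-1 - (toC l)^-1 = (toC l - t) / (t * toC l)); last by field; rewrite lC.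
have tl' : toC l - t != 0 by rewrite -opprB oppr_eq0.
by field; rewrite t0 tl tl' lC.
Qed.

Lemma monodromy_b : exists w, w \in unitmx /\ mexp Moo (- tau) *m w *m b = w.
Proof.
have li0 : 0 < l^-1 by rewrite invr_gt0.
have [H [V [H0 HS VS hc [sol [u0 Hu]]]]] := frobenius_solution D li0 nonresonant_Moo.
pose u := Num.max (- u0) (ln (4 * l)).
have l4 : 0 < 4 * l by rewrite mulr_gt0.
have uu0 : - u <= u0 by rewrite lerNl le_max lexx.
have ul4 : 4 * l <= expR u by rewrite -[leLHS]lnK ?posrE// ler_expR le_max lexx orbT.
have ul : 2 * l < expR u by have := l0; lra.
have ul' : l < expR u by have := l0; lra.
pose Y x := frob Moo H (- x).
have YT x : Y (x + tau) = Y x *m mexp Moo (- tau).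
  have e : - x = - (x + tau) + tau by rewrite opprD -addrA addNr addr0.
  by rewrite /Y [in RHS]e frob_periodic -mulmxA mexpN mulmx1.
have Yu x : cRe x = u -> Y x \in unitmx by move=> xu; apply: Hu; rewrite cReN xu.
have Ysol : is_sol (xfuchs M D (toC l)) (fun x => cRe x = u) Y.
  by apply: is_sol_sub (sol_at_infinity sol) => x ->.
have [w [wu wT _]] := circle_monodromy l0 at_ab (c := ChartRight) (g := b) (u := u)
  (atlas_RU at_ab) (atlas_RD at_ab) (fun v => right_cexp ul) Ysol Yu YT.
by exists w.
Qed.

Lemma lfact_of_conj (g T w : 'M[C]_n) (M' : 'M[C]_n) z s (v : 'cV[C]_n) : w \in unitmx ->
  mexp M' z *m w *m g = w -> (forall v : 'cV[C]_n, lfact M' s v = 0) ->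
  lfact g (map (fun x => cexp (x * (- z))) s) v = 0.
Proof.
move=> wu wE h.
have gE : w *m g = mexp M' (- z) *m w.
  move: (mexpN M' z) (mexp_unit M' z) wE; generalize (mexp M' z) (mexp M' (- z)) => A B AB Au wE.
  by apply: (can_inj (mulKmx Au)); rewrite !mulmxA wE AB mul1mx.
apply: (can_inj (mulKmx wu)).
by rewrite (lfact_conj _ wu gE) lfact_mexp// mulmx0.
Qed.

(** The sign of [tau] is due to [a] being conjugate to the inverse of [mexp M tau]; for [b] the
    substitution of [- x] for [x] at infinity reverses it once more. *)
Definition charpoly0 : {poly C} := \prod_(x <- map (fun x => cexp (toC x * - tau)) rho) ('X - x%:P).
Definition charpolyoo : {poly C} := \prod_(x <- map (fun x => cexp (toC x * tau)) al) ('X - x%:P).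

Theorem atlas_companion : exists2 T : 'M[C]_n, T \in unitmx &
  a *m T = T *m ccomp n' charpoly0 /\ b *m T = T *m ccomp n' charpolyoo.
Proof.
have [H [V [w [u [[H0 hc] [HS VS] sol [wu wT] [ul wE]]]]]] := monodromy_a.
have [w' [wu' wT']] := monodromy_b.
have [Z [DZ hZ]] := sysD_projection size_rho size_al rho01 al01.
have [W [abW WZ [e e0 [K hK]]]] :=
  apparent_hyperplane l0 at_ab (sysD_resolvent size_rho size_al rho01 al01) DZ.
have ha (v : 'cV[C]_n) : lfact a (map (fun x => cexp (toC x * - tau)) rho) v = 0.
  rewrite (map_comp (fun x => cexp (x * - tau)) (@toC R)).
  by apply: (lfact_of_conj a _ wu wT) => v'; exact: sysM_lfact.
have hb (v : 'cV[C]_n) : lfact b (map (fun x => cexp (toC x * tau)) al) v = 0.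
  rewrite (map_comp (fun x => cexp (x * tau)) (@toC R)) -{1}(opprK tau).
  by apply: (lfact_of_conj b _ wu' wT') => v'; exact: Moo_lfact.
apply: (common_cyclic_vector (W := W)) => //.
- by rewrite size_map.
- exact: monic_prod_XsubC.
- by rewrite size_prod_XsubC size_map size_al.
- apply/row_matrixP => i; apply/rowP => j; rewrite row0 !mxE.
  have := hb (delta_mx j 0); rewrite lfactE -colE => /colP/(_ i); rewrite !mxE.
  exact.
- by move=> c /WZ; exact: hZ.
(* An eigenvector [v] of [a] in the hyperplane gives the eigenvector [w v] of [mexp M tau], with
   inverse eigenvalue. Distinct exponents in [[0, 1)] have distinct exponentials, so [w v] is an
   eigenvector of [M] itself, to which [frob_unbounded] applies. *)
move=> x c hx; apply/eqP; apply: contraT => v0; set v := W *m c in hx v0.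
have Pv0 : w *m v != 0.
  by apply: contraNneq v0 => /(congr1 (mulmx (invmx w))); rewrite mulKmx// mulmx0 => ->.
have TPv : x *: (mexp M tau *m (w *m v)) = w *m v.
  by rewrite -[in RHS]wT -!mulmxA hx -!scalemxAr.
have x0 : x != 0 by apply: contraNneq Pv0 => xE; rewrite -TPv xE scale0r.
have Teig : mexp M tau *m (w *m v) = x^-1 *: (w *m v) by rewrite -[in RHS]TPv scalerA mulVf// scale1r.
have tau0 : tau != 0.
  apply: mulf_neq0; first by rewrite toC_eq0 gt_eqF// mulr_gt0// pi_gt0.
  by apply/eqP => /(congr1 (@cIm R)) /= /eqP; rewrite oner_eq0.
have [|y /mapP[x1 x1r ->] Meig] := mexp_eigenvector tau0 _ (sysM_lfact size_rho (w *m v)) Teig Pv0.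
  move=> y y' /mapP[x1 /rho01 h1 ->] /mapP[x2 /rho01 h2 ->] h.
  by rewrite (cexp_2pi_inj h1 h2 h).
case: (frob_unbounded l0 size_rho size_al rho01 al01 H0 HS VS hc x1r Meig Pv0
  (K := K * mnorm c) e0) => s /andP[s1 s2].
have K' := hK (expR s) ltac:(by rewrite s1 s2).
(* The Frobenius solution agrees with the chart solution at [toC u], hence along the real segment up
   to [s]. Through the chart it inherits the bound of solutions holomorphic at [lam], which is the
   contradiction. *)
have seg : E ChartMid (cexp (toC s)) *m v = frob M H (toC s) *m (w *m v).
  apply: (@xfuchs_unique _ _ M D (toC l) _
    (fun x => expR (cRe x) < l /\ cdom l ChartMid (cexp x))
    (fun x => E ChartMid (cexp x) *m v) (fun x => frob M H x *m (w *m v)) (toC u)).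
  - by move=> t [_ /(cdom_regular l0)[]].
  - move=> t; rewrite in_itv => t01; rewrite -toCB -toCM -toCD.
    set y' := u + _; have yl : expR y' < l.
      have ll : expR (ln l) = l by rewrite lnK.
      rewrite -ll ltr_expR.
      have lu : u < ln l by rewrite -ltr_expR ll; have := l0; lra.
      have ls : s < ln l by rewrite -ltr_expR ll.
      have := @lt_convex_comb _ t (- u) (- s) (- ln l) t01.
      by rewrite !ltrN2 /y' => /(_ lu ls); lra.
    split; first exact: yl.
    rewrite cexp_real.
    rewrite /= /in_ball -toCB cmod_toC ltr_norml; have := expR_gt0 y'.
    by move=> h; apply/andP; split; have := l0; lra.
  - by apply: is_sol_sub (is_solMr v (is_sol_cexp (atlas_sol at_ab (c := ChartMid)))) => t [].
  - by apply: is_sol_sub (is_solMr (w *m v) sol) => t [].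
  - by rewrite (mulmxA (frob M H (toC u)) w v) -wE.
rewrite -seg cexp_real /v mulmxA; apply: le_trans (mnormM _ _) _.
by rewrite ler_wpM2r ?mnorm_ge0.
Qed.

End LocalMonodromies.

(** * From the scalar equation to the system *)

Section EulerOperators.
Variable R : realType.
Local Notation C := (complexField R).
Implicit Types (f g : C -> C) (z b : C) (u v : {poly C}).

Lemma analytic_near f b : analytic_at f b ->
  exists2 r : R, 0 < r & forall w, cmod (w - b) < r -> analytic_at f w.
Proof.
move=> /analytic_atP[a [r fb]]; exists r; first by case: fb => -[].
by move=> w; exact: pseries_on_analytic fb.
Qed.

Lemma analytic_theta f b : analytic_at f b -> analytic_at (theta f) b.
Proof.
move=> /analytic_atP[a [r fb]]; have r0 : 0 < r by case: fb => -[].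
have r2 := halfR_gt0 r0.
have rr : r / 2 < r by rewrite ltr_pdivrMr// ltr_pMr// ltr1n.
have h := pseries_on_theta r2 rr fb.
by apply/analytic_atP; exists (fun k => b * psder a k + psshift (psder a) k), (r / 2); exact: h.
Qed.

Lemma analytic_iter_theta f b i : analytic_at f b -> analytic_at (iter i (@theta R) f) b.
Proof. by move=> h; elim: i => [|i IH]; [exact: h|rewrite iterS; apply: analytic_theta; exact: IH]. Qed.

Lemma analytic_cderiv f z : analytic_at f z -> cderiv f z (derive1 f z).
Proof.
move=> /analytic_atP[a [r fb]]; have r0 : 0 < r by case: fb => -[].
have zz : cmod (z - z) < r by rewrite subrr cmod0.
by have h := pseries_on_cderiv fb zz; rewrite (cderiv_derive1 h).
Qed.

(** The operator [u(theta)] applied to [f]. *)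
Definition evop u f z : C := \sum_(i < size u) u`_i * iter i (@theta R) f z.

Lemma evopE m u f z : (size u <= m)%N ->
  evop u f z = \sum_(i < m) u`_i * iter i (@theta R) f z.
Proof.
move=> um; rewrite /evop (big_ord_widen _ (fun i => u`_i * iter i (@theta R) f z) um).
rewrite [RHS](bigID (fun i : 'I_m => (i < size u)%N)) /= [X in _ = _ + X]big1 ?addr0// => i.
by rewrite -leqNgt => h; rewrite nth_default// mul0r.
Qed.

Lemma evopZ c u f z : evop (c *: u) f z = c * evop u f z.
Proof.
rewrite (evopE _ _ (size_scale_leq c u)) /evop mulr_sumr.
by apply: eq_bigr => i _; rewrite coefZ mulrA.
Qed.

Lemma theta_affine_evop c a u f g z : analytic_at f z ->
  (\forall w \near z, g w = evop u f w) ->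
  theta_affine c a g z = evop ((c *: 'X + a%:P) * u) f z.
Proof.
move=> fz /nearP_cmod[r r0 gE].
have hd : cderiv g z (\sum_(i < size u) u`_i * derive1 (iter i (@theta R) f) z).
  apply: (@eq_near_cderiv _ (evop u f) g _ _ _ r0).
    by move=> h hr; rewrite gE// addrAC subrr add0r.
  by apply: cderiv_sum => i; apply: cderivZ; apply: analytic_cderiv; exact: analytic_iter_theta.
have gz : g z = evop u f z by apply: gE; rewrite subrr cmod0.
rewrite /theta_affine /theta (cderiv_derive1 hd) gz.
have sz : (size ((c *: 'X + a%:P) * u)%R <= (size u).+1)%N.
  apply: leq_trans (size_polyMleq _ _) _.
  have : (size (c *: 'X + a%:P : {poly C})%R <= 2)%N.
    apply: leq_trans (size_polyD _ _) _; rewrite geq_max (leq_trans (size_polyC_leq1 _))//.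
    by rewrite (leq_trans (size_scale_leq _ _))// size_polyX.
  lia.
rewrite (evopE _ _ sz) mulrDl -scalerAl mul_polyC.
rewrite [RHS](eq_bigr (fun i : 'I_(size u).+1 => c * (('X * u)`_i * iter i (@theta R) f z) +
   a * (u`_i * iter i (@theta R) f z))); last first.
  by move=> i _; rewrite coefD !coefZ mulrDl !mulrA.
rewrite big_split /= -!mulr_sumr; congr (_ * _ + _ * _).
  rewrite big_ord_recl coefXM /= mul0r add0r mulr_sumr; apply: eq_bigr => i _.
  by rewrite coefXM /= mulrCA.
by rewrite -(evopE _ _ (leqnSn (size u))).
Qed.

(** [A] acts as [u(theta)]. The argument [g] is only known near [b], and only as some [v(theta) f],
    because that is what an inner factor of a composition delivers. *)
Definition represents (A : (C -> C) -> C -> C) u b := forall f g v, analytic_at f b ->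
  (\forall w \near b, g w = evop v f w) -> A g b = evop (u * v) f b.

Lemma represents_near A u f g v b : (forall z, represents A u z) -> analytic_at f b ->
  (\forall w \near b, g w = evop v f w) -> \forall w \near b, A g w = evop (u * v) f w.
Proof.
move=> hA /analytic_near[r r0 fr] /nearP_cmod[s s0 gE].
apply/nearP_cmod; exists (Num.min r s); first by rewrite lt_min r0.
move=> w; rewrite lt_min => /andP[wr ws]; apply: hA; first exact: fr.
apply/nearP_cmod; exists (s - cmod (w - b)); first by rewrite subr_gt0.
move=> w' hw'; apply: gE; rewrite (_ : w' - b = (w' - w) + (w - b)); last by ring.
by apply: le_lt_trans (cmodD _ _) _; lra.
Qed.

Lemma represents_id z : represents id 1 z.
Proof.
move=> f g v _ /nearP_cmod[r r0 gE]; rewrite mul1r.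
by apply: gE; rewrite subrr cmod0.
Qed.

Lemma represents_comp A B u v : (forall z, represents A u z) -> (forall z, represents B v z) ->
  forall z, represents (op_comp A B) (u * v) z.
Proof.
move=> hA hB z f g v' fz gE; rewrite /op_comp /= -mulrA.
by apply: hA => //; exact: represents_near.
Qed.

Lemma represents_theta_affine c a z : represents (theta_affine c a) (c *: 'X + a%:P) z.
Proof. by move=> f g v; exact: theta_affine_evop. Qed.

Lemma represents_big (I : Type) (s : seq I) (A : I -> (C -> C) -> C -> C) (u : I -> {poly C}) :
  (forall i z, represents (A i) (u i) z) ->
  forall z, represents (\big[@op_comp R/id]_(i <- s) A i) (\prod_(i <- s) u i) z.
Proof.
move=> h; elim/big_ind2: _ => [|A1 u1 A2 u2|i _]; [exact: represents_id|exact: represents_comp|].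
exact: h.
Qed.

Lemma represents_eval A u f z : represents A u z -> analytic_at f z -> A f z = evop u f z.
Proof.
move=> hA fz; rewrite -[u]mulr1; apply: hA => //; apply/nearP_cmod; exists 1 => // w _.
by rewrite /evop size_poly1 big_ord1 coef1 mul1r.
Qed.

Variables (N r : nat) (q : 'I_N.+1 -> nat) (d : 'I_r -> nat).

Definition op_poly0 : {poly C} :=
  \prod_(nu < N.+1) \prod_(a < q nu) ((q nu)%:R *: 'X + (- a%:R)%:P).
Definition op_polyoo : {poly C} :=
  \prod_(k < r) \prod_(1 <= b < (d k).+1) ((d k)%:R *: 'X + (b%:R)%:P).

Lemma hypergeometric_opE f z : analytic_at f z ->
  hypergeometric_op q d f z = evop op_poly0 f z - z * evop op_polyoo f z.
Proof.
move=> fz; rewrite /hypergeometric_op; congr (_ - _ * _).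
  apply: represents_eval fz; apply: represents_big => nu z'; apply: represents_big => a z''.
  exact: represents_theta_affine.
apply: represents_eval fz; apply: represents_big => k z'; apply: represents_big => b z''.
exact: represents_theta_affine.
Qed.

End EulerOperators.

(** * Equivalence of the scalar equation with the system *)

Section Jets.
Variable R : realType.
Local Notation C := (complexField R).
Implicit Types (f g : C -> C) (z b : C).
Variables (n' : nat) (rho al : seq R) (l : R).
Local Notation n := n'.+1.
Hypotheses (l0 : 0 < l) (size_rho : size rho = n) (size_al : size al = n).
Local Notation M := (sysM n' rho).
Local Notation D := (sysD n' rho al).
Local Notation G := (fuchs M D (toC l)).
Local Notation p := (indicial0 rho).
Local Notation r := (indicialoo al).

Definition jet f z : 'cV[C]_n := \col_i iter i (@theta R) f z.

Lemma fuchs_row m (Y : 'M[C]_(n, m)) z (i : 'I_n) k (lt : (i.+1 < n)%N) : z != 0 ->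
  z * (G z *m Y) i k = Y (Ordinal lt) k.
Proof.
move=> z0; have im : i != ord_max by rewrite neq_ltn /= -ltnS lt.
rewrite fuchs_mul [X in _ * X]mxE [X in _ * (X + _)]mxE [X in _ * (_ + X)]mxE.
by rewrite (sysD_mul _ _ _ _ im) mulr0 addr0 (rcomp_mul _ _ _ lt) mulrA divff// mul1r.
Qed.

Lemma fuchs_last m (Y : 'M[C]_(n, m)) z k : z != 0 -> z != toC l ->
  (z - toC l) * (z * (G z *m Y) ord_max k) =
  toC l * (\sum_(j < n) p`_j * Y j k) - z * (\sum_(j < n) r`_j * Y j k).
Proof.
move=> z0 zl; have zl0 : z - toC l != 0 by rewrite subr_eq0.
rewrite fuchs_mul [X in _ * (_ * X)]mxE [X in _ * (_ * (X + _))]mxE.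
rewrite [X in _ * (_ * (_ + X))]mxE sysD_mul_last rcomp_mul_last.
have -> : \sum_(j < n) (p`_j - r`_j) * Y j k = \sum_(j < n) p`_j * Y j k - \sum_(j < n) r`_j * Y j k.
  by rewrite -sumrB; apply: eq_bigr => j _; rewrite mulrBl.
set P := \sum_(i < n) p`_i * _; set Q := \sum_(i < n) r`_i * _.
have e1 := divff z0; have e2 := divff zl0.
transitivity ((z - toC l) * (z / z) * - P + z * ((z - toC l) / (z - toC l)) * (P - Q)); first by ring.
by rewrite e1 e2; ring.
Qed.

Lemma evop_monic (u : {poly C}) f z : u \is monic -> size u = n.+1 ->
  evop u f z = \sum_(j < n) u`_j * jet f z j 0 + iter n (@theta R) f z.
Proof.
move=> um su; rewrite /evop su big_ord_recr /=; congr (_ + _).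
  by apply: eq_bigr => i _; rewrite mxE.
by have := monicP um; rewrite lead_coefE su /= => ->; rewrite mul1r.
Qed.

Definition sol_eq f z := toC l * evop p f z = z * evop r f z.

(** Both polynomials are monic, so [theta^n f] occurs with the coefficient [l - z] and the equation
    can be solved for it. *)
Lemma sol_eq_last f z : z != 0 -> z != toC l ->
  sol_eq f z <-> iter n (@theta R) f z = z * (G z *m jet f z) ord_max 0.
Proof.
move=> z0 zl; have zl0 : z - toC l != 0 by rewrite subr_eq0.
rewrite /sol_eq (evop_monic _ _ (monic_indicial0 rho) (size_indicial0 size_rho)).
rewrite (evop_monic _ _ (monic_indicialoo al) (size_indicialoo size_al)).
have := fuchs_last (jet f z) 0 z0 zl.
set P := \sum_(j < n) _; set Q := \sum_(j < n) _; set W := z * _; set F := iter n _ _ _ => h.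
split=> h2; last by rewrite h2; apply/eqP; rewrite -subr_eq0; apply/eqP;
  transitivity (toC l * P - z * Q - (z - toC l) * W); [ring|rewrite h subrr].
apply: (mulfI zl0); rewrite h; apply/eqP; rewrite -subr_eq0; apply/eqP.
by transitivity (z * (Q + F) - toC l * (P + F)); [ring|rewrite h2 subrr].
Qed.

Lemma jet_sol f (Om : C -> Prop) : (forall z, Om z -> z != 0 /\ z != toC l) ->
  (forall z, Om z -> analytic_at f z /\ sol_eq f z) -> is_sol G Om (jet f).
Proof.
move=> O0 h z Oz i k; rewrite !ord1; have [z0 zl] := O0 z Oz; have [fz fs] := h z Oz.
rewrite (_ : (fun w => jet f w i 0) = iter i (@theta R) f); last by apply/funext => w; rewrite mxE.
have := analytic_cderiv (analytic_iter_theta i fz).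
suff -> : (G z *m jet f z) i 0 = derive1 (iter i (@theta R) f) z by [].
apply: (mulfI z0); rewrite -[RHS]/(iter i.+1 (@theta R) f z).
have [->|im] := eqVneq i ord_max; first by rewrite ((sol_eq_last f z0 zl).1 fs).
have lt : (i.+1 < n)%N.
  have := ltn_ord i; rewrite ltnS leq_eqVlt => /orP[/eqP E|//].
  by case/eqP: im; apply: val_inj.
by rewrite (fuchs_row _ _ lt z0) mxE.
Qed.

(** All rows but the last make each entry of [Y] the [theta] of the preceding one, so [Y] is the jet
    of its first entry; the last row is then the equation. Openness of [Om] lets [f] be
    differentiated through [Y]. *)
Lemma sol_jet f (Om : C -> Prop) (Y : C -> 'cV[C]_n) :
  (forall z, Om z -> z != 0 /\ z != toC l) ->
  (forall z, Om z -> exists2 e : R, 0 < e & forall w, in_ball z e w -> Om w) ->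
  is_sol G Om Y -> (forall z, Om z -> f z = Y z ord0 0) ->
  forall z, Om z -> jet f z = Y z /\ sol_eq f z.
Proof.
move=> O0 Oop hY fY.
have der i (lt : (i < n)%N) : (forall z, Om z -> iter i (@theta R) f z = Y z (Ordinal lt) 0) ->
    forall z, Om z -> iter i.+1 (@theta R) f z = z * (G z *m Y z) (Ordinal lt) 0.
  move=> h z Oz /=; rewrite [LHS]/(z * _); congr (_ * _).
  have [e e0 he] := Oop z Oz; apply: cderiv_derive1.
  apply: (@eq_near_cderiv _ (fun w => Y w (Ordinal lt) 0) _ _ _ _ e0 _ (hY z Oz _ _)).
  by move=> w we; rewrite h//; apply: he; rewrite /in_ball addrAC subrr add0r.
have it i (lt : (i < n)%N) z : Om z -> iter i (@theta R) f z = Y z (Ordinal lt) 0.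
  elim: i lt z => [|i IH] lt z Oz; first by rewrite [LHS]/= fY//; congr (Y z _ _); apply: val_inj.
  rewrite (der i (ltnW lt) (IH _))//; have [z0 _] := O0 z Oz.
  by rewrite (@fuchs_row _ _ _ (Ordinal (ltnW lt)) _ lt z0).
have jE z : Om z -> jet f z = Y z.
  move=> Oz; apply/colP => i; rewrite mxE (it i (ltn_ord i))//.
  by congr (Y z _ _); apply: val_inj.
move=> z Oz; split; first exact: jE.
have [z0 zl] := O0 z Oz; apply/(sol_eq_last f z0 zl); rewrite jE//.
by rewrite (der n' (ltnSn n') (it n' _))//; congr (_ * (_ : 'cV[C]_n) _ _).
Qed.

Lemma jet0 z : jet (fun=> 0) z = 0.
Proof.
apply/colP => i; rewrite !mxE; move: z; elim: (nat_of_ord i) => [//|j IH] z /=.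
rewrite /theta (cderiv_derive1 (_ : cderiv _ z 0)) ?mulr0//.
rewrite (_ : iter j _ _ = fun=> 0); first exact: cderiv_cst.
by apply/funext => w; exact: IH.
Qed.

End Jets.

(** * Exponents with prescribed denominators and roots of unity *)

Section Fractions.
Variable R : realType.
Local Notation C := (complexField R).
Local Notation tau := (toC (2 * pi) * cI R).
Variables (m : nat) (e : 'I_m -> nat).
Hypothesis e0 : forall k, (0 < e k)%N.

(* [s = 0] gives the local exponents at the origin, [s = 1] those at infinity. *)
Definition fracs (s : nat) : seq R :=
  [seq a%:R / (e k)%:R | k <- index_enum 'I_m, a <- index_iota s (s + e k)].

Lemma big_fracs (T : Type) (idx : T) (op : Monoid.law idx) s (F : R -> T) :
  \big[op/idx]_(x <- fracs s) F x =
  \big[op/idx]_(k < m) \big[op/idx]_(s <= a < s + e k) F (a%:R / (e k)%:R).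
Proof. by rewrite /fracs big_allpairs_dep. Qed.

Lemma size_fracs s : size (fracs s) = (\sum_(k < m) e k)%N.
Proof.
rewrite size_allpairs_dep sumnE big_map; apply: eq_bigr => k _.
by rewrite size_iota addKn.
Qed.

Lemma mem_fracs s x : x \in fracs s ->
  exists k a, [/\ (s <= a < s + e k)%N & x = a%:R / (e k)%:R].
Proof.
by move=> /allpairsPdep[k [a [_ + ->]]]; rewrite mem_index_iota => ha; exists k, a.
Qed.

Lemma fracs0_range x : x \in fracs 0 -> 0 <= x < 1.
Proof.
move=> /mem_fracs[k [a [/andP[_ ha] ->]]]; rewrite divr_ge0//=.
by rewrite ltr_pdivrMr ?ltr0n// mul1r ltr_nat.
Qed.

Lemma fracs1_range x : x \in fracs 1 -> 0 < x <= 1.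
Proof.
move=> /mem_fracs[k [a [/andP[a0 ha] ->]]]; rewrite divr_gt0 ?ltr0n//=.
by rewrite ler_pdivrMr ?ltr0n// mul1r ler_nat.
Qed.

(** Extracts the leading coefficients of the factors of the operator; [c] is -1 for the exponents at
    the origin and 1 for those at infinity. *)
Lemma prod_affine_fracs s (c : C) :
  \prod_(k < m) \prod_(s <= a < s + e k) ((e k)%:R *: 'X + (c * a%:R)%:P) =
  (\prod_(k < m) (e k)%:R ^+ e k) *: \prod_(x <- fracs s) ('X - (- c * toC x)%:P).
Proof.
rewrite big_fracs -scaler_prod; apply: eq_bigr => k _.
rewrite (_ : (e k)%:R ^+ e k = \prod_(s <= a < s + e k) (e k)%:R :> C); last first.
  by rewrite prodr_const_nat addKn.
rewrite -scaler_prod; apply: eq_bigr => a _; rewrite scalerBr; congr (_ + _).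
have ek : (e k)%:R != 0 :> C by rewrite pnatr_eq0 -lt0n.
rewrite -mul_polyC -polyCM -polyCN toCM toCV !toC_nat; congr _%:P.
by rewrite mulNr mulrN opprK mulrCA (mulrC _ _^-1) mulVKf.
Qed.

Lemma cexp_natM k (x : C) : cexp (k%:R * x) = cexp x ^+ k.
Proof.
elim: k => [|k IH]; first by rewrite mul0r cexp0 expr0.
by rewrite -natr1 mulrDl mul1r cexpD IH exprSr.
Qed.

Lemma cexp_natdiv a k (x : C) :
  cexp (toC (a%:R / k%:R) * x) = cexp (toC k%:R^-1 * x) ^+ a.
Proof. by rewrite -(cexp_natM a) toCM toC_nat -(mulrA a%:R). Qed.

Lemma cexp_tau : cexp tau = 1.
Proof.
have := cexp_2pi_real (1 : R); rewrite toC1 mul1r mul1r => ->.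
by rewrite mulrC mulr_natr cos2pi sin2pi.
Qed.

Lemma cexp_primitive k : (0 < k)%N -> k.-primitive_root (cexp (toC (k%:R^-1 : R) * tau)).
Proof.
move=> k0; have kC : k%:R != 0 :> R by rewrite pnatr_eq0 -lt0n.
apply/andP; split => //; apply/forallP => i; apply/eqP; rewrite unity_rootE.
rewrite -cexp_natM mulrA -toC_nat -toCM.
have [->|ik] := eqVneq i.+1 k; first by rewrite divff// toC1 mul1r cexp_tau eqxx.
apply/negbTE/eqP => h.
have lt : (i.+1 < k)%N by rewrite ltn_neqAle ik ltn_ord.
have : i.+1%:R / k%:R = 0 :> R.
  apply: cexp_2pi_inj; last by rewrite toC0 mul0r cexp0.
    by rewrite divr_ge0//= ltr_pdivrMr ?ltr0n// mul1r ltr_nat.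
  by rewrite lexx ltr01.
by move/eqP; rewrite mulf_eq0 invr_eq0 (negbTE kC) orbF pnatr_eq0.
Qed.

Lemma prim_rootV (F : fieldType) k (z : F) : k.-primitive_root z -> k.-primitive_root z^-1.
Proof.
move=> /andP[k0 /forallP h]; apply/andP; split => //; apply/forallP => i.
by have := h i; rewrite !unity_rootE exprVn invr_eq1.
Qed.

(** Starting at 1 instead of 0 replaces the root [z ^+ 0] by [z ^+ k], which is the same. *)
Lemma prod_XsubC_roots (F : fieldType) k (z : F) s : (s <= 1)%N -> k.-primitive_root z ->
  \prod_(s <= a < s + k) ('X - (z ^+ a)%:P) = 'X^k - 1.
Proof.
move=> s1 pz; rewrite -(factor_Xn_sub_1 pz); case: s s1 => [|[|//]] _ //.
have k0 := prim_order_gt0 pz; rewrite add1n big_nat_recr//= (prim_expr_order pz).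
by rewrite [RHS]big_ltn// mulrC expr0.
Qed.

Lemma prod_cexp_fracs s : (s <= 1)%N ->
  \prod_(x <- map (fun x => cexp (toC x * tau)) (fracs s)) ('X - x%:P) =
  \prod_(k < m) ('X^(e k) - 1) :> {poly C}.
Proof.
move=> s1; rewrite big_map big_fracs; apply: eq_bigr => k _.
rewrite -(prod_XsubC_roots s1 (cexp_primitive (e0 k))); apply: eq_bigr => a _.
by rewrite cexp_natdiv.
Qed.

Lemma prod_cexpN_fracs s : (s <= 1)%N ->
  \prod_(x <- map (fun x => cexp (toC x * - tau)) (fracs s)) ('X - x%:P) =
  \prod_(k < m) ('X^(e k) - 1) :> {poly C}.
Proof.
move=> s1; rewrite big_map big_fracs; apply: eq_bigr => k _.
rewrite -(prod_XsubC_roots s1 (prim_rootV (cexp_primitive (e0 k)))); apply: eq_bigr => a _.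
by rewrite cexp_natdiv mulrN cexpN.
Qed.

End Fractions.

(** * Specialization to the sequences [q] and [d] *)

Section HypergeometricData.
Variable R : realType.
Local Notation C := (complexField R).
Variables (N r n' : nat) (q : 'I_N.+1 -> nat) (d : 'I_r -> nat).
Local Notation n := n'.+1.
Hypotheses (q_gt0 : forall nu, (0 < q nu)%N) (d_gt0 : forall k, (0 < d k)%N).

Definition prod_self m (e : 'I_m -> nat) : R := \prod_(k < m) (e k)%:R ^+ e k.
Definition lam : R := prod_self q / prod_self d.

Lemma prod_self_gt0 m (e : 'I_m -> nat) : (forall k, (0 < e k)%N) -> 0 < prod_self e.
Proof. by move=> e0; apply: prodr_gt0 => k _; rewrite exprn_gt0// ltr0n. Qed.

Lemma lam_gt0 : 0 < lam.
Proof. by rewrite divr_gt0// prod_self_gt0. Qed.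

Lemma toC_prod_self m (e : 'I_m -> nat) : toC (prod_self e) = \prod_(k < m) (e k)%:R ^+ e k :> C.
Proof.
rewrite /prod_self (big_morph (@toC R) (@toCM R) (toC1 R)); apply: eq_bigr => k _.
by rewrite toCX toC_nat.
Qed.

Lemma toC_lam : toC lam = hypergeometric_lambda R q d.
Proof. by rewrite /lam toCM toCV !toC_prod_self. Qed.

Lemma op_poly0E : op_poly0 R q = toC (prod_self q) *: indicial0 (fracs R q 0).
Proof.
rewrite toC_prod_self /indicial0 big_map.
transitivity (\prod_(nu < N.+1) \prod_(0 <= a < 0 + q nu)
   ((q nu)%:R *: 'X + (- 1 * a%:R)%:P) : {poly C}).
  by apply: eq_bigr => nu _; rewrite add0n big_mkord; apply: eq_bigr => a _; rewrite mulN1r.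
rewrite (prod_affine_fracs q_gt0); congr (_ *: _); apply: eq_bigr => x _.
by rewrite opprK mul1r.
Qed.

Lemma op_polyooE : op_polyoo R d = toC (prod_self d) *: indicialoo (fracs R d 1).
Proof.
rewrite toC_prod_self /indicialoo big_map.
transitivity (\prod_(k < r) \prod_(1 <= a < 1 + d k)
   ((d k)%:R *: 'X + (1 * a%:R)%:P) : {poly C}).
  by apply: eq_bigr => k _; rewrite add1n; apply: eq_bigr => a _; rewrite mul1r.
rewrite (prod_affine_fracs d_gt0); congr (_ *: _); apply: eq_bigr => x _.
by rewrite toCN mulN1r.
Qed.

Lemma hypergeometric_op_sol_eq f z : analytic_at f z ->
  hypergeometric_op q d f z = 0 <-> sol_eq (fracs R q 0) (fracs R d 1) lam f z.
Proof.
move=> fz; rewrite (hypergeometric_opE _ _ fz) op_poly0E op_polyooE !evopZ /sol_eq.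
rewrite /lam toCM toCV; set P := evop _ _ _; set Q := evop _ _ _.
have d0 : toC (prod_self d) != 0 by rewrite toC_eq0 gt_eqF// prod_self_gt0.
set cd := toC (prod_self d) in d0 *; set cq := toC _.
split => h.
  apply: (mulfI d0); transitivity (cq * P * (cd / cd)); first by ring.
  by rewrite divff// mulr1; apply/eqP; rewrite -subr_eq0; apply/eqP; rewrite -[RHS]h; ring.
transitivity (cd * (cq / cd * P) + (1 - cd / cd) * (cq * P) - z * (cd * Q)); first by ring.
by rewrite h divff//; ring.
Qed.

Lemma charpoly0_fracs : charpoly0 (fracs R q 0) =
  map_poly intr (\prod_(nu < N.+1) ('X^(q nu) - 1) : {poly int}).
Proof.
rewrite /charpoly0 (prod_cexpN_fracs R q_gt0)// rmorph_prod; apply: eq_bigr => k _.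
by rewrite rmorphB rmorph1 /= map_polyXn.
Qed.

Lemma charpolyoo_fracs : charpolyoo (fracs R d 1) =
  map_poly intr (\prod_(k < r) ('X^(d k) - 1) : {poly int}).
Proof.
rewrite /charpolyoo (prod_cexp_fracs R d_gt0)// rmorph_prod; apply: eq_bigr => k _.
by rewrite rmorphB rmorph1 /= map_polyXn.
Qed.

Lemma map_last_column_companion (p : {poly int}) :
  map_mx intr (last_column_companion n p) = ccomp n' (map_poly intr p) :> 'M[C]_n.
Proof.
apply/matrixP => i j; rewrite !mxE /=; case: ifP => _; last by rewrite rmorph_nat.
by rewrite rmorphN coef_map.
Qed.

End HypergeometricData.

(** * Paths and continuation *)

Section Paths.
Variable R : realType.
Local Notation C := (complexField R).
Implicit Types (f g : C -> C) (p z w : C) (gamma : R -> C) (s : R).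

Lemma halfR_lt (e : R) : 0 < e -> e / 2 < e.
Proof. by move=> e0; rewrite ltr_pdivrMr// ltr_pMr// ltr1n. Qed.

Lemma near_within01 s (P : R -> Prop) :
  (\forall s' \near within `[0, 1] (nbhs s), P s') <->
  exists2 d : R, 0 < d & forall s', s' \in `[0, 1] -> `|s' - s| < d -> P s'.
Proof.
split=> [/nbhs_ballP[d /= d0 h]|[d d0 h]].
  by exists d => // s' s01 s'd; apply: h => //; rewrite /ball /= distrC.
apply/nbhs_ballP; exists d => // s' s'd s01; apply: h => //.
by move: s'd; rewrite /ball /= distrC.
Qed.

Lemma continuous01P gamma : {within `[0, 1], continuous gamma} <->
  forall s, s \in `[0, 1] -> forall e : R, 0 < e -> exists2 d : R, 0 < d &
    forall s', s' \in `[0, 1] -> `|s' - s| < d -> cmod (gamma s' - gamma s) < e.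
Proof.
split=> [/subspace_continuousP h s s01 e e0|h].
  have /(h s s01) : nbhs (gamma s) [set z | cmod (z - gamma s) < e].
    by apply/nearP_cmod; exists e.
  by move=> /near_within01.
apply/subspace_continuousP => s s01 P /nearP_cmod[e e0 he].
have [d d0 hd] := h s s01 e e0.
by apply/near_within01; exists d => // s' s'01 s'd; apply: he; exact: hd.
Qed.

Lemma near_all p (P : C -> Prop) : (forall z, P z) -> \forall z \near p, P z.
Proof. by move=> h; apply/nearP_cmod; exists 1. Qed.

Lemma near_open p (P : C -> Prop) : (\forall z \near p, P z) ->
  exists2 r : R, 0 < r & forall w, cmod (w - p) < r -> \forall z \near w, P z.
Proof.
move=> /nearP_cmod[r r0 hr]; exists r => // w wr.
apply/nearP_cmod; exists (r - cmod (w - p)); first by rewrite subr_gt0.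
move=> z hz; apply: hr; rewrite (_ : z - p = (z - w) + (w - p)); last by ring.
by apply: le_lt_trans (cmodD _ _) _; lra.
Qed.

(** Connectedness of [[0, 1]], by a supremum, for a property that is locally constant. *)
Lemma interval_induction (P : R -> Prop) : P 0 ->
  (forall s, s \in `[0, 1] -> exists2 d : R, 0 < d &
     forall s', s' \in `[0, 1] -> `|s' - s| < d -> (P s <-> P s')) ->
  P 1.
Proof.
move=> P0 hP.
pose A := [set s : R | 0 <= s <= 1 /\ forall t, 0 <= t <= s -> P t].
have A0 : A 0.
  by split=> [|t]; [rewrite lexx ler01|rewrite -eq_le => /eqP <-].
have hA : has_sup A by split; [exists 0|exists 1 => s [/andP[]]].
have s0 : 0 <= sup A by apply: sup_ubound => //; exact: hA.2.
have s1 : sup A <= 1 by apply: sup_le_ub; [exists 0|move=> s [/andP[]]].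
set s := sup A in s0 s1.
have s01 : s \in `[0, 1] by rewrite in_itv /= s0.
have [d d0 hd] := hP s s01.
have [t At ts] := sup_adherent d0 hA; rewrite -/s in ts.
have tles : t <= s by apply: sup_ubound => //; exact: hA.2.
have [/andP[t0 t1] Pt] := At.
have Ps : P s.
  apply/(hd t); first by rewrite in_itv /= t0.
    by rewrite ltr_norml; apply/andP; split; lra.
  by apply: Pt; rewrite t0 lexx.
have next (u : R) : s <= u -> u < s + d -> u <= 1 -> A u.
  move=> su us u1; split=> [|v /andP[v0 vu]]; first by rewrite u1 (le_trans s0).
  have [vt|tv] := leP v t; first by apply: Pt; rewrite v0.
  apply/(hd v) => //; first by rewrite in_itv /= v0 (le_trans vu).
  by rewrite ltr_norml; apply/andP; split; lra.
have [sd|sd] := leP (s + d / 2) 1.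
  have d2 : 0 < d / 2 by rewrite divr_gt0.
  have As := next (s + d / 2) ltac:(lra) ltac:(lra) sd.
  have : s + d / 2 <= s by apply: sup_ubound => //; exact: hA.2.
  by move=> ?; exfalso; lra.
have [_ h] := next 1 s1 ltac:(lra) (lexx 1).
by apply: h; rewrite lexx ler01.
Qed.

(** Equality of germs is locally constant along the segment: where the germs differ, the functions
    differ on a punctured neighbourhood, so the germs also differ at all nearby points. *)
Lemma identity_segment f g p w :
  on_segment p w (fun z => analytic_at f z /\ analytic_at g z) ->
  (\forall z \near p, f z = g z) -> \forall z \near w, f z = g z.
Proof.
move=> fg fgp; set gamma := fun s : R => p + toC s * (w - p).
have -> : w = gamma 1 by rewrite /gamma toC1 mul1r; ring.
apply: (@interval_induction (fun s => \forall z \near gamma s, f z = g z)).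
  by rewrite /gamma toC0 mul0r addr0.
have gc s (e : R) : 0 < e -> exists2 d : R, 0 < d & forall s' : R, `|s' - s| < d ->
    cmod (gamma s' - gamma s) < e.
  move=> e0; have k0 : 0 < cmod (w - p) + 1 by rewrite ltr_wpDl ?cmod_ge0.
  exists (e / (cmod (w - p) + 1)) => [|s' hs]; first by rewrite divr_gt0.
  have -> : gamma s' - gamma s = toC (s' - s) * (w - p) by rewrite /gamma toCB; ring.
  rewrite cmodM cmod_toC; move: hs; rewrite ltr_pdivlMr// => hs; apply: le_lt_trans hs.
  by rewrite ler_wpM2l// lerDl.
move=> s s01; have [fs gs] := fg s s01.
have [E|E] := pselect (\forall z \near gamma s, f z = g z).
  have [e e0 he] := near_open E; have [d d0 hd] := gc s e e0.
  by exists d; [exact: d0|move=> s' _ ss; split=> _; [apply: he; exact: hd|exact: E]].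
have [e e0 he] : exists2 e : R, 0 < e & forall z, cmod (z - gamma s) < e -> z != gamma s -> f z <> g z.
  apply: contrapT => h; apply: E; apply: analytic_isolated fs gs _ => e e0.
  apply: contrapT => h2; apply: h; exists e => // z zs zn fgz; apply: h2.
  by exists z.
have [d d0 hd] := gc s e e0; exists d; first exact: d0.
move=> s' _ ss; split=> [fgs|/nearP_cmod[r r0 hr]]; first by case: (E fgs).
exfalso; have cs := hd _ ss.
set k := Num.min r (e - cmod (gamma s' - gamma s)).
have k0 : 0 < k by rewrite lt_min r0 subr_gt0.
have k2 := halfR_gt0 k0.
have kr : k <= r by rewrite ge_min lexx.
have ke : k <= e - cmod (gamma s' - gamma s) by rewrite ge_min lexx orbT.
clearbody k.
have kk := halfR_lt k0.
(* The centre of the punctured neighbourhood must be avoided, and [gamma s'] may coincide with it,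
   for example when [p = w]. *)
have [z z1 z2] : exists2 z, cmod (z - gamma s') <= k / 2 & z != gamma s.
  have [E'|E'] := eqVneq (gamma s') (gamma s).
    exists (gamma s' + toC (k / 2)).
      by rewrite addrAC subrr add0r cmod_toC gtr0_norm.
    by rewrite E' -subr_eq0 addrAC subrr add0r toC_eq0 gt_eqF.
  by exists (gamma s'); [rewrite subrr cmod0; exact: ltW|exact: E'].
apply: (he z _ z2); last by apply: hr; exact: lt_le_trans (le_lt_trans z1 kk) kr.
rewrite (_ : z - gamma s = (z - gamma s') + (gamma s' - gamma s)); last by ring.
apply: le_lt_trans (cmodD _ _) _; lra.
Qed.

Definition avoids (S : set C) gamma :=
  {within `[0, 1], continuous gamma} /\ forall s, s \in `[0, 1] -> ~ S (gamma s).

Section Reach.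
Variable S : set C.

(** One path serves the whole family of germs, as in [monodromy_group], where a single loop acts on
    all members of a basis. *)
Definition reach (I : Type) p (f : I -> C -> C) w (g : I -> C -> C) :=
  exists gamma, [/\ avoids S gamma, gamma 0 = p, gamma 1 = w
    & forall i, continues_along gamma (f i) (g i)].

Lemma reach_reindex (I J : Type) (k : J -> I) p (f : I -> C -> C) w (g : I -> C -> C) :
  reach p f w g -> reach p (fun j => f (k j)) w (fun j => g (k j)).
Proof. by move=> [gamma [h1 h2 h3 h4]]; exists gamma; split; [exact: h1|exact: h2|exact: h3|move=> j; exact: h4]. Qed.

Lemma reach_near (I : Type) p (f f' : I -> C -> C) w (g g' : I -> C -> C) :
  (forall i, \forall z \near p, f i z = f' i z) ->
  (forall i, \forall z \near w, g i z = g' i z) ->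
  reach p f w g -> reach p f' w g'.
Proof.
move=> ff gg [gamma [h1 h2 h3 h4]]; exists gamma; split; [exact: h1|exact: h2|exact: h3|move=> i].
have [F [F1 F2 F3 F4]] := h4 i; exists F; split; [exact: F1|exact: F2| | ].
  by move: F3; rewrite h2; apply: filterS2 (ff i) => z <- ->.
by move: F4; rewrite h3; apply: filterS2 (gg i) => z <- ->.
Qed.

Lemma reach_segment (I : Type) p (f : I -> C -> C) w :
  on_segment p w (fun z => ~ S z /\ forall i, analytic_at (f i) z) -> reach p f w f.
Proof.
move=> h; exists (fun s : R => p + toC s * (w - p)); split.
- split; last by move=> s /h[].
  apply/continuous01P => s _ e e0.
  have k0 : 0 < cmod (w - p) + 1 by rewrite ltr_wpDl ?cmod_ge0.
  exists (e / (cmod (w - p) + 1)) => [|s' _ hs]; first by rewrite divr_gt0.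
  rewrite (_ : _ - _ = toC (s' - s) * (w - p)); last by rewrite toCB; ring.
  rewrite cmodM cmod_toC; move: hs; rewrite ltr_pdivlMr// => hs; apply: le_lt_trans hs.
  by rewrite ler_wpM2l// lerDl.
- by rewrite toC0 mul0r addr0.
- by rewrite toC1 mul1r; ring.
move=> i; exists (fun _ => f i); split; [by move=> s /h[_ fa]; exact: fa| |exact: near_all|exact: near_all].
by move=> s _; apply/near_within01; exists 1 => // s' _ _; exact: near_all.
Qed.

Lemma rev01 s : s \in `[0, 1] -> 1 - s \in `[0, 1].
Proof. by rewrite !in_itv /= => /andP[? ?]; apply/andP; split; lra. Qed.

Lemma reach_sym (I : Type) p (f : I -> C -> C) w (g : I -> C -> C) : reach p f w g -> reach w g p f.
Proof.
move=> [gamma [[gc gS] h2 h3 h4]]; exists (fun s => gamma (1 - s)); split.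
- split; last by move=> s s01; apply: gS; exact: rev01.
  apply/continuous01P => s s01 e e0.
  have [d d0 hd] := (continuous01P gamma).1 gc _ (rev01 s01) e e0.
  exists d; [exact: d0|move=> s' s'01 ss]; apply: hd; first exact: rev01.
  by rewrite (_ : _ - _ = - (s' - s)) ?normrN//; ring.
- by rewrite [X in gamma X]subr0; exact: h3.
- by rewrite [X in gamma X]subrr; exact: h2.
move=> i; have [F [F1 F2 F3 F4]] := h4 i; exists (fun s => F (1 - s)); split.
- by move=> s s01; apply: F1; exact: rev01.
- move=> s s01; have /near_within01[d d0 hd] := F2 _ (rev01 s01).
  apply/near_within01; exists d; [exact: d0|move=> s' s'01 ss]; apply: hd; first exact: rev01.
  by rewrite (_ : _ - _ = - (s' - s)) ?normrN//; ring.
- by rewrite [X in F X]subr0 [X in gamma X]subr0; exact: F4.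
- by rewrite [X in F X]subrr [X in gamma X]subrr; exact: F3.
Qed.

Lemma reach_trans (I : Type) p (f : I -> C -> C) w (g : I -> C -> C) u (h : I -> C -> C) :
  reach p f w g -> reach w g u h -> reach p f u h.
Proof.
move=> [c1 [[k1 S1] a1 b1 F1]] [c2 [[k2 S2] a2 b2 F2]].
have l01 s : s \in `[0, 1] -> s <= 1 / 2 -> 2 * s \in `[0, 1].
  by rewrite !in_itv /= => /andP[? ?] ?; apply/andP; split; lra.
have r01 s : s \in `[0, 1] -> 1 / 2 < s -> 2 * s - 1 \in `[0, 1].
  by rewrite !in_itv /= => /andP[? ?] ?; apply/andP; split; lra.
have h0 : (0 : R) \in `[0, 1] by rewrite in_itv /= lexx ler01.
have h1 : (1 : R) \in `[0, 1] by rewrite in_itv /= lexx ler01.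
have z2 : 0 <= 1 / 2 :> R by rewrite divr_ge0.
have o2 : 1 / 2 < 1 :> R by lra.
have e20 : 2 * 0 = 0 :> R by rewrite mulr0.
have e21 : 2 * 1 - 1 = 1 :> R by lra.
have eh : 2 * (1 / 2) - 1 = 0 :> R by lra.
have eh1 : 2 * (1 / 2) = 1 :> R by lra.
have double s s' (d : R) : `|s' - s| < d / 2 -> `|2 * s' - 2 * s| < d.
  by rewrite !ltr_norml => /andP[? ?]; apply/andP; split; lra.
have double1 s s' (d : R) : `|s' - s| < d / 2 -> `|(2 * s' - 1) - (2 * s - 1)| < d.
  by rewrite !ltr_norml => /andP[? ?]; apply/andP; split; lra.
have glue (P : R -> R -> Prop) :
    (forall s, s \in `[0, 1] -> s <= 1 / 2 -> exists2 d : R, 0 < d & forall s',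
       s' \in `[0, 1] -> s' <= 1 / 2 -> `|s' - s| < d -> P s s') ->
    (forall s, s \in `[0, 1] -> 1 / 2 <= s -> exists2 d : R, 0 < d & forall s',
       s' \in `[0, 1] -> 1 / 2 < s' -> `|s' - s| < d -> P s s') ->
    forall s, s \in `[0, 1] -> exists2 d : R, 0 < d & forall s',
       s' \in `[0, 1] -> `|s' - s| < d -> P s s'.
  move=> A B s s01; have [sh|sh|sh] := ltgtP s (1 / 2).
  - have [d d0 hd] := A s s01 (ltW sh); exists (Num.min d (1 / 2 - s)).
      by rewrite lt_min d0 subr_gt0.
    move=> s' s'01; rewrite lt_min => /andP[ss]; rewrite ltr_norml => /andP[_ ?].
    by apply: hd => //; lra.
  - have [d d0 hd] := B s s01 (ltW sh); exists (Num.min d (s - 1 / 2)).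
      by rewrite lt_min d0 subr_gt0.
    move=> s' s'01; rewrite lt_min => /andP[ss]; rewrite ltr_norml => /andP[? _].
    by apply: hd => //; lra.
  have [d d0 hd] := A s s01 ltac:(by rewrite sh).
  have [d' d'0 hd'] := B s s01 ltac:(by rewrite sh).
  exists (Num.min d d'); first by rewrite lt_min d0.
  move=> s' s'01; rewrite lt_min => /andP[sd sd'].
  by have [?|?] := leP s' (1 / 2); [exact: hd|exact: hd'].
pose gamma s := if s <= 1 / 2 then c1 (2 * s) else c2 (2 * s - 1).
have gl s : s <= 1 / 2 -> gamma s = c1 (2 * s) by move=> hs; rewrite /gamma hs.
have gr s : 1 / 2 < s -> gamma s = c2 (2 * s - 1) by move=> hs; rewrite /gamma leNgt hs.
have gr' s : 1 / 2 <= s -> gamma s = c2 (2 * s - 1).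
  rewrite le_eqVlt => /orP[/eqP <-|]; last exact: gr.
  by rewrite (gl _ (lexx _)) eh eh1 b1 a2.
have gc : forall s, s \in `[0, 1] -> forall e : R, 0 < e -> exists2 d : R, 0 < d &
    forall s', s' \in `[0, 1] -> `|s' - s| < d -> cmod (gamma s' - gamma s) < e.
  move=> s s01 e e0; apply: (glue (fun s s' => cmod (gamma s' - gamma s) < e)) s01 => {}s s01 hs.
    have [d d0 hd] := (continuous01P c1).1 k1 _ (l01 s s01 hs) e e0.
    exists (d / 2); first by rewrite divr_gt0.
    by move=> s' s'01 hs' ss; rewrite (gl s hs) (gl s' hs'); apply: hd; [exact: l01|exact: double].
  have s2 : 2 * s - 1 \in `[0, 1].
    by move: s01 hs; rewrite !in_itv /= => /andP[? ?] ?; apply/andP; split; lra.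
  have [d d0 hd] := (continuous01P c2).1 k2 _ s2 e e0.
  exists (d / 2); first by rewrite divr_gt0.
  by move=> s' s'01 hs' ss; rewrite (gr' s hs) (gr s' hs'); apply: hd; [exact: r01|exact: double1].
exists gamma; split.
- split; first exact/continuous01P.
  move=> s s01; have [hs|hs] := leP s (1 / 2).
    by rewrite (gl _ hs); apply: S1; exact: l01.
  by rewrite (gr _ hs); apply: S2; exact: r01.
- by rewrite (gl _ z2) e20; exact: a1.
- by rewrite (gr _ o2) e21; exact: b2.
move=> i; have [G1 [An1 L1 I1 O1]] := F1 i; have [G2 [An2 L2 I2 O2]] := F2 i.
pose F s := if s <= 1 / 2 then G1 (2 * s) else G2 (2 * s - 1).
have fl s : s <= 1 / 2 -> F s = G1 (2 * s) by move=> hs; rewrite /F hs.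
have fr s : 1 / 2 < s -> F s = G2 (2 * s - 1) by move=> hs; rewrite /F leNgt hs.
(* At [s = 1 / 2] the value of [F] is the end of [G1], which agrees with the start of [G2] only as a
   germ. *)
have FG s : 1 / 2 <= s -> \forall z \near gamma s, F s z = G2 (2 * s - 1) z.
  rewrite le_eqVlt => /orP[/eqP <-|hs]; last by rewrite (fr _ hs); exact: near_all.
  rewrite (fl _ (lexx _)) (gl _ (lexx _)) eh eh1; move: O1 I2; rewrite b1 a2.
  by apply: filterS2 => z -> ->.
exists F; split.
- move=> s s01; have [hs|hs] := leP s (1 / 2).
    by rewrite (gl _ hs) (fl _ hs); apply: An1; exact: l01.
  by rewrite (gr _ hs) (fr _ hs); apply: An2; exact: r01.
- move=> s s01; apply/near_within01.
  apply: (glue (fun s s' => \forall z \near gamma s', F s' z = F s z)) s01 => {}s s01 hs.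
    have /near_within01[d d0 hd] := L1 _ (l01 s s01 hs).
    exists (d / 2); first by rewrite divr_gt0.
    move=> s' s'01 hs' ss; rewrite (gl s' hs') (fl s hs) (fl s' hs').
    by apply: hd; [exact: l01|exact: double].
  have s2 : 2 * s - 1 \in `[0, 1].
    by move: s01 hs; rewrite !in_itv /= => /andP[? ?] ?; apply/andP; split; lra.
  have /near_within01[d d0 hd] := L2 _ s2.
  have [e e0 he] := near_open (FG s hs).
  have [d' d'0 hd'] := gc s s01 e e0.
  exists (Num.min (d / 2) d'); first by rewrite lt_min d'0 divr_gt0.
  move=> s' s'01 hs'; rewrite lt_min => /andP[ss ss'].
  have := he _ (hd' s' s'01 ss').
  have := hd (2 * s' - 1) (r01 s' s'01 hs') (double1 _ _ _ ss).
  by rewrite (gr s' hs') (fr s' hs'); apply: filterS2 => z -> ->.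
- by rewrite (gl _ z2) (fl _ z2) e20; exact: I1.
- by rewrite (gr _ o2) (fr _ o2) e21; exact: O2.
Qed.

End Reach.
End Paths.

(** The subgroup generated by [a] and [b], with the closure rules of [generated_by], so that the
    comparison of the two groups is an induction in each direction. *)
Inductive transition (F : fieldType) n (a b : 'M[F]_n) : 'M[F]_n -> Prop :=
| transition_one : transition a b 1%:M
| transition_mul g h : transition a b g -> transition a b h -> transition a b (g *m h)
| transition_inv g : transition a b g -> transition a b (invmx g)
| transition_a : transition a b a
| transition_b : transition a b b.

Lemma transition_unit (F : fieldType) n (a b g : 'M[F]_n) :
  a \in unitmx -> b \in unitmx -> transition a b g -> g \in unitmx.
Proof.
move=> ua ub; elim=> [|g1 h _ u1 _ u2|g1 _ u1||]; first exact: unitmx1.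
- by rewrite unitmx_mul u1.
- by rewrite unitmx_inv.
- exact: ua.
exact: ub.
Qed.

Lemma uniform_radius (R : realType) n (Q : 'I_n -> R -> Prop) :
  (forall i (x y : R), y <= x -> Q i x -> Q i y) ->
  (forall i, exists2 e : R, 0 < e & Q i e) -> exists2 e : R, 0 < e & forall i, Q i e.
Proof.
move=> Qle /fin_all_exists2[e e0 Qe].
(* The initial value 1 keeps the minimum positive for an empty family. *)
exists (\big[Order.min/1]_i e i) => [|i]; last by apply: Qle (Qe i); exact: bigmin_le.
by elim/big_ind: _ => // x y x0 y0; rewrite lt_min x0.
Qed.

(** * Analytic continuation of solutions and the monodromy group *)

Section LocalSolutions.
Variable R : realType.
Local Notation C := (complexField R).
Variables (n' : nat) (rho al : seq R) (l : R).
Local Notation n := n'.+1.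
Hypotheses (l0 : 0 < l) (size_rho : size rho = n) (size_al : size al = n).
Local Notation M := (sysM n' rho).
Local Notation D := (sysD n' rho al).
Local Notation G := (fuchs M D (toC l)).
Variables (E : chart -> C -> 'M[C]_n) (a b : 'M[C]_n).
Hypothesis at_ab : atlas l M D E a b.
Variable L : (C -> C) -> C -> C.
Hypothesis L_sol : forall f z, analytic_at f z -> L f z = 0 <-> sol_eq rho al l f z.
Local Notation S := [set 0; toC l].
Implicit Types (c : chart) (z w : C) (v : 'cV[C]_n) (g h : 'M[C]_n).

(** The vector [v] holds the coordinates of a solution in the chart [c]; passing to another chart
    multiplies [v] on the left by a transition matrix. *)
Definition lsol c v z : C := (E c z *m v) ord0 ord0.

Lemma lsol_is_sol c v : is_sol G (cdom l c) (fun z => E c z *m v).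
Proof. exact: is_solMr (@atlas_sol _ _ _ _ _ _ _ _ at_ab c). Qed.

Lemma lsol_analytic c v z : cdom l c z -> analytic_at (lsol c v) z.
Proof.
move=> /cdom_open[r r0 hr].
have [r' r'0 h] := sol_pseries r0 (@cdom_regular _ _ l0 c) hr (lsol_is_sol v).
by apply/analytic_atP; have [x hx] := h ord0 ord0; exists x, r'; exact: hx.
Qed.

Lemma lsol_jet c v z : cdom l c z ->
  jet n' (lsol c v) z = E c z *m v /\ sol_eq rho al l (lsol c v) z.
Proof.
apply: (sol_jet size_rho size_al (@cdom_regular _ _ l0 c) (@cdom_open _ l c) (lsol_is_sol v)).
by move=> w _.
Qed.

Lemma lsol_local c v z : cdom l c z -> local_solution L z (lsol c v).
Proof.
move=> cz; split; first exact: lsol_analytic.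
have [r r0 hr] := cdom_open cz; apply/nearP_cmod; exists r; first exact: r0.
by move=> w /hr cw; apply/(L_sol (lsol_analytic v cw)); exact: (lsol_jet v cw).2.
Qed.

Lemma lsol_mul c m (X : 'M[C]_(n, m)) (k : 'cV[C]_m) z :
  lsol c (X *m k) z = \sum_i k i ord0 * lsol c (col i X) z.
Proof.
rewrite /lsol mulmxA mxE; apply: eq_bigr => i _; rewrite [LHS]mulrC; congr (_ * _).
by rewrite !mxE; apply: eq_bigr => j _; rewrite mxE.
Qed.

Lemma lsolB c v v' z : lsol c (v - v') z = lsol c v z - lsol c v' z.
Proof. by rewrite /lsol mulmxBr !mxE. Qed.

Lemma lsol_inj c v v' z : cdom l c z ->
  (\forall w \near z, lsol c v w = lsol c v' w) -> v = v'.
Proof.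
move=> cz /nearP_cmod[e e0 he]; have [r r0 hr] := cdom_open cz.
set m := Num.min e r; have m0 : 0 < m by rewrite lt_min e0.
have hm w : in_ball z m w -> cmod (w - z) < e /\ cdom l c w.
  by rewrite /in_ball lt_min => /andP[h1 /hr].
have zm : in_ball z m z by rewrite /in_ball subrr cmod0.
have [j0 _] : jet n' (fun=> 0) z = E c z *m (v - v') /\ sol_eq rho al l (fun=> 0) z.
  apply: (sol_jet size_rho size_al (Om := in_ball z m) (Y := fun w => E c w *m (v - v'))
    _ _ _ _ zm) => [w /hm[_ cw]|w wm||w /hm[we _]].
  - exact: (cdom_regular l0 cw).
  - exists (m - cmod (w - z)); first by rewrite subr_gt0.
    move=> u; rewrite /in_ball => uw.
    rewrite (_ : u - z = (u - w) + (w - z)); last by ring.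
    by apply: le_lt_trans (cmodD _ _) _; lra.
  - by apply: is_sol_sub (lsol_is_sol (v - v')) => w /hm[].
  by rewrite -[RHS]/(lsol c (v - v') w) lsolB he// subrr.
have u := atlas_unit at_ab cz; rewrite jet0 in j0.
have : v - v' = 0 by rewrite -(mulKmx u (v - v')) -j0 mulmx0.
by move/eqP; rewrite subr_eq0 => /eqP.
Qed.

Lemma lsol_complete c z f : cdom l c z -> local_solution L z f ->
  exists v, \forall w \near z, f w = lsol c v w.
Proof.
move=> cz [fz /nearP_cmod[e e0 he]]; have [r r0 hr] := cdom_open cz.
have [s s0 hs] := analytic_near fz.
set m := Num.min (Num.min e r) s; have m0 : 0 < m by rewrite !lt_min e0 r0 s0.
have hm w : in_ball z m w -> [/\ cmod (w - z) < e, cdom l c w & analytic_at f w].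
  rewrite /in_ball !lt_min => /andP[/andP[h1 h2] h3].
  by split; [exact: h1|exact: hr|exact: hs].
have zm : in_ball z m z by rewrite /in_ball subrr cmod0.
have reg w : in_ball z m w -> w != 0 /\ w != toC l by move=> /hm[_ cw _]; exact: cdom_regular cw.
have jf : is_sol G (in_ball z m) (jet n' f).
  apply: (jet_sol size_rho size_al reg) => w /hm[we cw fw]; split; first exact: fw.
  by apply/(L_sol fw); exact: he.
pose v := invmx (E c z) *m jet n' f z.
exists v; apply/nearP_cmod; exists m; first exact: m0.
move=> w wm; suff jw : jet n' f w = E c w *m v by rewrite /lsol -jw mxE.
apply: (fuchs_unique (Y := jet n' f) (Z := fun w => E c w *m v) reg (convex_ball zm wm) jf).
  by apply: is_sol_sub (lsol_is_sol v) => u /hm[].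
by rewrite /v mulKVmx// (atlas_unit at_ab cz).
Qed.

Local Notation trans := (transition a b).

(** Disjoint charts are related as well, vacuously and by the identity, so that [chartsP] covers all
    pairs. *)
Definition chart_related c c' := exists2 h, trans h &
  forall z, cdom l c z -> cdom l c' z -> E c z = E c' z *m h.

Lemma chart_related_sym c c' : chart_related c c' -> chart_related c' c.
Proof.
move=> [h th hE]; exists (invmx h); first exact: transition_inv.
move=> z z1 z2; have uh : h \in unitmx.
  by have [ua ub] := atlas_transition_unit l0 at_ab; exact: (transition_unit ua ub th).
by rewrite (hE z z2 z1) mulmxK.
Qed.

Lemma chart_related_eq c c' :
  (forall z, cdom l c z -> cdom l c' z -> E c z = E c' z) -> chart_related c c'.
Proof.
move=> h; exists 1%:M; first exact: transition_one.
by move=> z z1 z2; rewrite mulmx1; exact: h.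
Qed.

Lemma chart_related_disjoint c c' :
  (forall z, cdom l c z -> ~ cdom l c' z) -> chart_related c c'.
Proof. by move=> h; apply: chart_related_eq => z z1 /(h z z1). Qed.

Lemma chartsP c c' : chart_related c c'.
Proof.
have refl c1 : chart_related c1 c1 by exact: chart_related_eq.
have LU := chart_related_eq (@atlas_LU _ _ _ _ _ _ _ _ at_ab).
have MU := chart_related_eq (@atlas_MU _ _ _ _ _ _ _ _ at_ab).
have RU := chart_related_eq (@atlas_RU _ _ _ _ _ _ _ _ at_ab).
have LD := chart_related_eq (@atlas_LD _ _ _ _ _ _ _ _ at_ab).
have MD : chart_related ChartMid ChartDown.
  by exists a; [exact: transition_a|exact: (atlas_MD at_ab)].
have RD : chart_related ChartRight ChartDown.
  by exists b; [exact: transition_b|exact: (atlas_RD at_ab)].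
have UD : chart_related ChartUp ChartDown.
  by apply: chart_related_disjoint => z /= h1 h2; move: (lt_trans h1 h2); rewrite ltxx.
have ML : chart_related ChartMid ChartLeft.
  apply: chart_related_disjoint => z /mid_bounds/andP[h1 _] h2.
  by move: (lt_trans h1 h2); rewrite ltxx.
have RL : chart_related ChartRight ChartLeft.
  apply: chart_related_disjoint => z h1 h2.
  by move: (lt_trans (lt_trans l0 h1) h2); rewrite ltxx.
have MR : chart_related ChartMid ChartRight.
  apply: chart_related_disjoint => z /mid_bounds/andP[_ h1] h2.
  by move: (lt_trans h1 h2); rewrite ltxx.
by case: c; case: c'; first
  [ exact: refl | exact: LU | exact: MU | exact: RU | exact: LD | exact: MD | exact: RD
  | exact: UD | exact: ML | exact: RL | exact: MR
  | apply: chart_related_sym; first [exact: LU | exact: MU | exact: RU | exact: LD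
      | exact: MD | exact: RD | exact: UD | exact: ML | exact: RL | exact: MR]].
Qed.

Lemma lsol_change c c' z : cdom l c z -> cdom l c' z -> exists2 h, trans h &
  forall v, \forall w \near z, lsol c v w = lsol c' (h *m v) w.
Proof.
move=> cz c'z; have [h th hE] := chartsP c c'; exists h; first exact: th.
move=> v; have [r r0 hr] := cdom_open cz; have [r' r'0 hr'] := cdom_open c'z.
apply/nearP_cmod; exists (Num.min r r'); first by rewrite lt_min r0.
move=> w; rewrite lt_min => /andP[wr wr'].
by rewrite /lsol (hE w (hr w wr) (hr' w wr')) mulmxA.
Qed.

(** The invariant of continuation: one and the same transition [g] describes all the germs, in some
    chart around [p]. By [state_chart] any other chart around [p] would do. *)
Definition state (m : nat) (v : 'I_m -> 'cV[C]_n) p (f : 'I_m -> C -> C) :=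
  exists c g, [/\ cdom l c p, trans g & forall i, \forall w \near p, f i w = lsol c (g *m v i) w].

Lemma state_chart m (v : 'I_m -> 'cV[C]_n) p f c : cdom l c p ->
  state v p f <-> exists2 g, trans g & forall i, \forall w \near p, f i w = lsol c (g *m v i) w.
Proof.
move=> cp; split=> [[c' [g [c'p tg fE]]]|[g tg fE]]; last by exists c, g.
have [h th hE] := lsol_change c'p cp; exists (h *m g); first exact: transition_mul.
move=> i; rewrite -mulmxA; apply: filterS2 (fE i) (hE (g *m v i)) => w -> ->.
by [].
Qed.

(** The invariant is locally constant along the path: nearby points of the path stay in a disc
    inside one chart, where the identity principle carries the equality of germs in both directions
    with the same [g]. Hence no homotopy of paths is involved. *)
Lemma state_continuation m (v : 'I_m -> 'cV[C]_n) gamma (F : 'I_m -> R -> C -> C) :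
  avoids S gamma ->
  (forall i (s : R), s \in `[0, 1] -> analytic_at (F i s) (gamma s)) ->
  (forall i (s : R), s \in `[0, 1] ->
     \forall s' \near within `[0, 1] (nbhs s), \forall z \near gamma s', F i s' z = F i s z) ->
  state v (gamma 0) (fun i => F i 0) -> state v (gamma 1) (fun i => F i 1).
Proof.
move=> [gc gS] An Lc st0.
apply: (@interval_induction _ (fun s : R => state v (gamma s) (fun i => F i s))) st0 _ => s s01.
have [z0 zl] : gamma s != 0 /\ gamma s != toC l.
  by split; apply/eqP => h; apply: (gS s s01); [left|right].
have [c cs] := cdom_cover z0 zl; have [r r0 hr] := cdom_open cs.
have [e e0 he] : exists2 e : R, 0 < e &
    forall i w, cmod (w - gamma s) < e -> analytic_at (F i s) w.
  apply: (@uniform_radius _ _ (fun i e => forall w, cmod (w - gamma s) < e -> analytic_at (F i s) w)).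
    by move=> i x y yx h w wy; apply: h; exact: lt_le_trans wy yx.
  by move=> i; exact: analytic_near (An i s s01).
have [d d0 hd] : exists2 d : R, 0 < d & forall i (s' : R), s' \in `[0, 1] -> `|s' - s| < d ->
    \forall z \near gamma s', F i s' z = F i s z.
  apply: (@uniform_radius _ _ (fun i d => forall s' : R, s' \in `[0, 1] -> `|s' - s| < d ->
    \forall z \near gamma s', F i s' z = F i s z)).
    by move=> i x y yx h s' s'01 ss; apply: h; [exact: s'01|exact: lt_le_trans ss yx].
  by move=> i; apply/near_within01; exact: Lc.
set k := Num.min r e; have k0 : 0 < k by rewrite lt_min r0.
have hk w : in_ball (gamma s) k w -> cdom l c w /\ forall i, analytic_at (F i s) w.
  rewrite /in_ball lt_min => /andP[wr we]; split; first exact: hr.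
  by move=> i; exact: he.
clearbody k.
have sk : in_ball (gamma s) k (gamma s) by rewrite /in_ball subrr cmod0.
have [d' d'0 hd'] := (continuous01P gamma).1 gc s s01 k k0.
exists (Num.min d d'); first by rewrite lt_min d0.
move=> s' s'01; rewrite lt_min => /andP[ss ss'].
have s'k : in_ball (gamma s) k (gamma s') := hd' s' s'01 ss'.
have ident i p w u : in_ball (gamma s) k p -> in_ball (gamma s) k w ->
    (\forall z \near p, F i s z = lsol c u z) -> \forall z \near w, F i s z = lsol c u z.
  move=> pk wk; apply: identity_segment => t t01.
  have [ct At] := hk _ (convex_ball pk wk t01).
  by split; [exact: At|exact: lsol_analytic].
split=> [/(state_chart _ _ cs)|/(state_chart _ _ (hk _ s'k).1)] [g tg gE].
  apply/(state_chart _ _ (hk _ s'k).1); exists g; first exact: tg.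
  move=> i; apply: filterS2 (hd i s' s'01 ss) (ident i _ _ _ sk s'k (gE i)) => z -> ->.
  by [].
apply/(state_chart _ _ cs); exists g; first exact: tg.
move=> i; apply: (ident i _ _ _ s'k sk).
by apply: filterS2 (hd i s' s'01 ss) (gE i) => z -> ->.
Qed.

Local Notation reaches := (@reach R S 'cV[C]_n).

Lemma reach_chart c p q : cdom l c p -> cdom l c q -> reaches p (lsol c) q (lsol c).
Proof.
move=> cp cq; apply: reach_segment => s s01.
have cs := cdom_convex cp cq s01; have [s0 sl] := cdom_regular l0 cs.
split; last by move=> v; exact: lsol_analytic.
by move=> [/= h|/= h]; [move: s0|move: sl]; rewrite h eqxx.
Qed.

Lemma reach_via c c' h p x q : cdom l c p -> cdom l c x -> cdom l c' x -> cdom l c' q ->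
  (forall z, cdom l c z -> cdom l c' z -> E c z = E c' z *m h) ->
  reaches p (lsol c) q (fun v => lsol c' (h *m v)).
Proof.
move=> cp cx c'x c'q hE; apply: (reach_trans (reach_chart cp cx)).
apply: (reach_near (f := fun v => lsol c' (h *m v)) (g := fun v => lsol c' (h *m v))).
- move=> v; have [r r0 hr] := cdom_open cx; have [r' r'0 hr'] := cdom_open c'x.
  apply/nearP_cmod; exists (Num.min r r'); first by rewrite lt_min r0.
  move=> w; rewrite lt_min => /andP[wr wr'].
  by rewrite /lsol (hE w (hr w wr) (hr' w wr')) mulmxA.
- by move=> v; exact: near_all.
exact: (reach_reindex (fun v => h *m v) (reach_chart c'x c'q)).
Qed.

Lemma reach_eq c c' p x q : cdom l c p -> cdom l c x -> cdom l c' x -> cdom l c' q ->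
  (forall z, cdom l c z -> cdom l c' z -> E c z = E c' z) ->
  reaches p (lsol c) q (lsol c').
Proof.
move=> cp cx c'x c'q hE.
have := @reach_via c c' 1%:M p x q cp cx c'x c'q.
under eq_fun do rewrite mul1mx.
by apply=> z z1 z2; rewrite mulmx1; exact: hE.
Qed.

Definition pt (c : chart) : C := match c with
  | ChartUp => 0 +i* 1 | ChartDown => 0 +i* (-1) | ChartLeft => (-1) +i* 0
  | ChartMid => toC (l / 2) | ChartRight => toC (l + 1) end.

Lemma pt_dom c : cdom l c (pt c).
Proof.
case: c; [exact: ltr01|exact: ltrN10|exact: ltrN10| |].
  by rewrite /= /in_ball subrr cmod0 divr_gt0.
by rewrite /= ltrDl.
Qed.

Lemma mid_quarter (y : R) : y ^+ 2 = (l / 4) ^+ 2 -> cdom l ChartMid ((l / 2) +i* y).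
Proof.
move=> hy; rewrite /= /in_ball cmod_lt_sqr; last by rewrite divr_ge0// ltW.
by rewrite cReB cImB /= subrr subr0 hy expr0n /= add0r; have := l0; nra.
Qed.

Lemma reach_LU p : cdom l ChartUp p -> reaches p (lsol ChartUp) (pt ChartLeft) (lsol ChartLeft).
Proof.
move=> h; apply: (@reach_eq ChartUp ChartLeft p ((-1) +i* 1) (pt ChartLeft) h (ltr01 : 0 < 1 :> R) (ltrN10 R) (ltrN10 R)).
by move=> z z1 z2; rewrite (atlas_LU at_ab).
Qed.

(** The routes use trivial gluings only, through the upper half plane for the middle and right
    charts, so the coordinates of the solution do not change. *)
Lemma reach_hub c p : cdom l c p -> reaches p (lsol c) (pt ChartLeft) (lsol ChartLeft).
Proof.
case: c => h.
- exact: reach_LU.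
- apply: (@reach_eq ChartDown ChartLeft p ((-1) +i* (-1)) (pt ChartLeft) h (ltrN10 R) (ltrN10 R) (ltrN10 R)).
  by move=> z z1 z2; rewrite (atlas_LD at_ab).
- exact: reach_chart h (pt_dom ChartLeft).
- apply: reach_trans (reach_LU (pt_dom ChartUp)).
  have xu : cdom l ChartUp ((l / 2) +i* (l / 4)) by rewrite /= divr_gt0.
  exact: (reach_eq h (mid_quarter erefl) xu (pt_dom ChartUp) (atlas_MU at_ab)).
apply: reach_trans (reach_LU (pt_dom ChartUp)).
have xr : cdom l ChartRight ((l + 1) +i* 1) by rewrite /= ltrDl.
have xu : cdom l ChartUp ((l + 1) +i* 1) := @ltr01 R.
exact: (reach_eq h xr xu (pt_dom ChartUp) (atlas_RU at_ab)).
Qed.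

Local Notation hub := (pt ChartLeft).
Local Notation f0 := (lsol ChartLeft).

(** The loop goes from the hub into [c], crosses into the lower half plane at [x] and returns across
    the negative axis; the crossing at [x] contributes [h] and all other passages are trivial. *)
Lemma reach_around c h x : cdom l c x -> cdom l ChartDown x ->
  (forall z, cdom l c z -> cdom l ChartDown z -> E c z = E ChartDown z *m h) ->
  reaches hub f0 hub (fun v => f0 (h *m v)).
Proof.
move=> cx dx hE; apply: reach_trans (reach_sym (reach_hub (pt_dom c))) _.
apply: reach_trans (reach_via (pt_dom c) cx dx (pt_dom ChartDown) hE) _.
exact: (reach_reindex (fun v => h *m v) (reach_hub (pt_dom ChartDown))).
Qed.

Lemma reach_transition g : trans g -> reaches hub f0 hub (fun v => f0 (g *m v)).
Proof.
have [ua ub] := atlas_transition_unit l0 at_ab.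
elim=> [|g1 h _ r1 _ r2|g1 t1 r1||].
- have := reach_chart (pt_dom ChartLeft) (pt_dom ChartLeft).
  by under [X in _ -> reach _ _ _ _ X]eq_fun do rewrite mul1mx.
(* Coordinates are multiplied on the left, so the loop of the right factor [h] is run first. *)
- apply: reach_trans r2 _; have := reach_reindex (fun v => h *m v) r1.
  by under [X in reach _ _ _ _ X -> _]eq_fun do rewrite mulmxA.
- have u1 := transition_unit ua ub t1.
  have := reach_sym (reach_reindex (fun v => invmx g1 *m v) r1).
  by under [X in reach _ _ X _ _ -> _]eq_fun do rewrite mulKVmx//.
- apply: (@reach_around ChartMid _ ((l / 2) +i* - (l / 4))).
  + by apply: mid_quarter; rewrite sqrrN.
  + by rewrite /= -oppr_gt0 opprK divr_gt0.
  exact: (atlas_MD at_ab).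
apply: (@reach_around ChartRight _ ((l + 1) +i* -1)).
+ by rewrite /= ltrDl.
+ exact: ltrN10.
exact: (atlas_RD at_ab).
Qed.

Lemma reach_loop c p g : cdom l c p -> trans g ->
  reaches p (lsol c) p (fun v => lsol c (g *m v)).
Proof.
move=> cp tg; apply: reach_trans (reach_hub cp) _.
apply: reach_trans (reach_transition tg) _.
exact: (reach_reindex (fun v => g *m v) (reach_sym (reach_hub cp))).
Qed.

Lemma solution_basis_exists c p : cdom l c p ->
  exists e : 'I_n -> C -> C, solution_basis L p e.
Proof.
move=> cp; exists (fun i => lsol c (delta_mx i ord0)).
have comb (k : 'cV[C]_n) z : \sum_i k i ord0 * lsol c (delta_mx i ord0) z = lsol c k z.
  rewrite -[k in RHS]mul1mx lsol_mul; apply: eq_bigr => i _; congr (_ * lsol c _ z).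
  by apply/colP => j; rewrite !mxE eqxx andbT.
split=> [i|k hk i|f /(lsol_complete cp)[v hv]]; first exact: lsol_local.
  have : \col_i k i = 0 :> 'cV[C]_n.
    apply: (lsol_inj cp); apply: filterS hk => z hz.
    rewrite -comb; under eq_bigr do rewrite mxE.
    by rewrite hz /lsol mulmx0 mxE.
  by move/colP => /(_ i); rewrite !mxE.
by exists (fun i => v i ord0); apply: filterS hv => z ->; rewrite comb.
Qed.

(** The columns of [X] are the chart coordinates of the basis [e]. Every continuation gives a
    transition by [state_continuation], and every transition is realized by a loop through
    [reach_loop]. *)
Theorem monodromy_groupE p (e : 'I_n -> C -> C) : ~ S p -> solution_basis L p e ->
  exists2 X : 'M[C]_n, X \in unitmx &
    monodromy_group S p e = [set K | exists2 g, trans g & X *m K = g *m X].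
Proof.
move=> pS [e_sol _ e_span].
have [z0 zl] : p != 0 /\ p != toC l.
  by split; apply/eqP => h; apply: pS; [left|right].
have [c cp] := cdom_cover z0 zl.
have [v hv] := fin_all_exists (fun i => lsol_complete cp (e_sol i)).
pose X : 'M[C]_n := \matrix_(i, j) v j i ord0.
have colX i : col i X = v i by apply/colP => j; rewrite !mxE.
have comb (k : 'I_n -> C) : \forall z \near p, \sum_i k i * e i z = lsol c (X *m \col_i k i) z.
  have [r r0 hr] : exists2 r : R, 0 < r & forall i z, cmod (z - p) < r -> e i z = lsol c (v i) z.
    apply: (@uniform_radius _ _ (fun i r => forall z, cmod (z - p) < r -> e i z = lsol c (v i) z)).
      by move=> i x y yx h z zy; apply: h; exact: lt_le_trans zy yx.
    by move=> i; exact/nearP_cmod.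
  apply/nearP_cmod; exists r; first exact: r0.
  move=> z zr; rewrite lsol_mul; apply: eq_bigr => i _.
  by rewrite colX mxE (hr i z zr).
(* Invertibility of [X] comes from spanning: every unit coordinate vector belongs to a local
   solution, which is a combination of the [e i]. *)
have hex i : exists k : 'cV[C]_n, X *m k = delta_mx i ord0.
  have [k kE] := e_span _ (lsol_local (delta_mx i ord0) cp).
  exists (\col_i k i); apply: (lsol_inj cp).
  by apply: filterS2 kE (comb k) => z -> ->.
have [k hk] := fin_all_exists hex.
have uX : X \in unitmx.
  apply: (proj1 (mulmx1_unit (_ : X *m \matrix_(i, j) k j i ord0 = 1%:M))).
  apply/matrixP => i j; have /colP/(_ i) := hk j; rewrite !mxE eqxx andbT => <-.
  by apply: eq_bigr => s _; rewrite !mxE.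
exists X; first exact: uX.
have colK (K : 'M[C]_n) i : X *m \col_j K j i = col i (X *m K).
  by apply/colP => j; rewrite !mxE; apply: eq_bigr => s _; rewrite !mxE.
apply/seteqP; split=> [K [gamma [gc g0 g1 gS] cont]|K [g tg gE]] /=.
  have [F hF] := fin_all_exists cont.
  have st0 : state v (gamma 0) (fun i => F i 0).
    rewrite g0; apply/(state_chart _ _ cp); exists 1%:M; first exact: transition_one.
    move=> i; have [_ _ + _] := hF i; rewrite g0 mul1mx => h.
    by apply: filterS2 h (hv i) => z -> ->.
  have := state_continuation (conj gc gS) (fun i => let: And4 h _ _ _ := hF i in h)
    (fun i => let: And4 _ h _ _ := hF i in h) st0.
  rewrite g1 => /(state_chart _ _ cp)[g tg gE]; exists g; first exact: tg.
  have colE i : col i (X *m K) = g *m v i.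
    rewrite -colK; apply: (lsol_inj cp); have [_ _ _ +] := hF i; rewrite g1 => h.
    apply: filterS3 (comb (fun j => K j i)) h (gE i) => z <- <- ->.
    by [].
  apply/matrixP => i j; have /colP/(_ i) := colE j; rewrite mxE => ->.
  by rewrite -colX !mxE; apply: eq_bigr => s _; rewrite !mxE.
have [gamma [[gc gS] g0 g1 cont]] := reach_reindex v (reach_loop cp tg).
have [gamma' [[gc' gS'] g0' g1' cont']] : reach S p e p (fun i z => \sum_j K j i * e j z).
  apply: (reach_near _ _ (reach_reindex v (reach_loop cp tg))) => i.
    by apply: filterS (hv i) => z ->.
  apply: filterS (comb (fun j => K j i)) => z ->; congr (lsol c _ z).
  by rewrite colK gE -[v i]colX; apply/colP => j; rewrite !mxE; apply: eq_bigr => s _; rewrite !mxE.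
by exists gamma'.
Qed.

End LocalSolutions.

(** * Conjugation to the hypergeometric group *)

Lemma det_last_column_companion n' (p : {poly int}) :
  \det (last_column_companion n'.+1 p) = - p`_0 * (-1) ^+ n'.
Proof.
rewrite (expand_det_row _ ord0) (bigD1 ord_max)//= [X in _ + X]big1 ?addr0.
  rewrite !mxE /= eqxx /cofactor add0n (_ : row' _ _ = 1%:M) ?det1 ?mulr1//.
  by apply/matrixP => i j; rewrite !mxE lift_max /= ltn_eqF ?ltn_ord//.
move=> j jm; by rewrite !mxE /= ifN ?mul0r//.
Qed.

Lemma coef0_prod_Xn_sub1 m (e : 'I_m -> nat) : (forall k, (0 < e k)%N) ->
  (\prod_(k < m) ('X^(e k) - 1) : {poly int})`_0 \is a GRing.unit.
Proof.
move=> e0; rewrite -horner_coef0 horner_prod.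
elim/big_ind: _ => [|x y ux uy|k _]; [exact: unitr1|by rewrite unitrM ux|].
by rewrite hornerD hornerN hornerXn hornerC expr0n eqn0Ngt e0 sub0r unitrN unitr1.
Qed.

(** Ensures that the embedding of integer matrices into matrices over a field commutes with [invmx]
    on the whole group. *)
Lemma hypergeometric_group_unit N r n' (q : 'I_N.+1 -> nat) (d : 'I_r -> nat) A :
  (forall nu, (0 < q nu)%N) -> (forall k, (0 < d k)%N) ->
  hypergeometric_group q d n'.+1 A -> A \in unitmx.
Proof.
move=> q0 d0; elim=> [B|||B _ uB].
- by move=> [|] /= ->; rewrite unitmxE det_last_column_companion unitrM unitrN
    unitrX ?unitrN1// coef0_prod_Xn_sub1.
- exact: unitmx1.
- by move=> B B' _ uB _ uB'; rewrite unitmx_mul uB.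
by rewrite unitmx_inv.
Qed.

Lemma map_intr_mulV (F : fieldType) n (A : 'M[int]_n) : A \in unitmx ->
  map_mx intr A *m map_mx intr (invmx A) = 1%:M :> 'M[F]_n.
Proof. by move=> uA; rewrite -map_mxM mulmxV// map_mx1. Qed.

Lemma map_intr_unit (F : fieldType) n (A : 'M[int]_n) : A \in unitmx ->
  (map_mx intr A : 'M[F]_n) \in unitmx.
Proof. by move=> uA; exact: (proj1 (mulmx1_unit (map_intr_mulV F uA))). Qed.

Lemma map_intr_invmx (F : fieldType) n (A : 'M[int]_n) : A \in unitmx ->
  map_mx intr (invmx A) = invmx (map_mx intr A) :> 'M[F]_n.
Proof.
by move=> uA; rewrite -[LHS](mulKmx (map_intr_unit F uA)) map_intr_mulV// mulmx1.
Qed.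

Section TransitionGroup.
Variables (F : fieldType) (N r n' : nat) (q : 'I_N.+1 -> nat) (d : 'I_r -> nat).
Hypotheses (q_gt0 : forall nu, (0 < q nu)%N) (d_gt0 : forall k, (0 < d k)%N).
Local Notation n := n'.+1.
Local Notation H := (hypergeometric_group q d n).
Variables (a b T : 'M[F]_n).
Hypotheses (uT : T \in unitmx) (ua : a \in unitmx) (ub : b \in unitmx).
Hypothesis aT : a *m T =
  T *m map_mx intr (last_column_companion n (\prod_(nu < N.+1) ('X^(q nu) - 1))).
Hypothesis bT : b *m T =
  T *m map_mx intr (last_column_companion n (\prod_(k < r) ('X^(d k) - 1))).

Lemma conj_invmx (g h : 'M[F]_n) : g \in unitmx -> h \in unitmx ->
  g *m T = T *m h -> invmx g *m T = T *m invmx h.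
Proof.
by move=> ug uh gT; rewrite -[X in _ *m X = _](mulmxK uh) -gT -mulmxA mulKmx.
Qed.

Lemma transitionP g : transition a b g <-> exists2 h, H h & g *m T = T *m map_mx intr h.
Proof.
split.
  elim=> [|g1 g2 _ [h1 H1 e1] _ [h2 H2 e2]|g1 t1 [h1 H1 e1]||].
  - by exists 1%:M; [exact: generated_one|rewrite map_mx1 mul1mx mulmx1].
  - exists (h1 *m h2); first exact: generated_mul.
    by rewrite map_mxM -mulmxA e2 !mulmxA e1.
  - have u1 := hypergeometric_group_unit q_gt0 d_gt0 H1.
    exists (invmx h1); first exact: generated_inv.
    rewrite map_intr_invmx//; apply: conj_invmx e1; first exact: transition_unit t1.
    exact: map_intr_unit.
  - by eexists; [apply: generated_incl; right|exact: aT].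
  by eexists; [apply: generated_incl; left|exact: bT].
move=> [h Hh hE].
have -> : g = T *m map_mx intr h *m invmx T by rewrite -hE mulmxK.
elim: Hh => {g h hE} [A|||].
- move=> [|] /= ->; rewrite -?aT -?bT mulmxK//; [exact: transition_b|exact: transition_a].
- by rewrite map_mx1 mulmx1 mulmxV//; exact: transition_one.
- move=> A B _ tA _ tB; rewrite map_mxM.
  have -> : T *m (map_mx intr A *m map_mx intr B) *m invmx T =
      (T *m map_mx intr A *m invmx T) *m (T *m map_mx intr B *m invmx T).
    by rewrite !mulmxA mulmxKV.
  exact: transition_mul.
move=> A HA tA; have uA := hypergeometric_group_unit q_gt0 d_gt0 HA.
rewrite map_intr_invmx//.
have -> : T *m invmx (map_mx intr A) *m invmx T = invmx (T *m map_mx intr A *m invmx T).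
  have ug := transition_unit ua ub tA.
  rewrite -(conj_invmx ug (map_intr_unit F uA)) ?mulmxK//.
  by rewrite mulmxKV.
exact: transition_inv.
Qed.

End TransitionGroup.

Theorem theorem1p1 (R : realType) (N r Q : nat)
    (q : 'I_N.+1 -> nat) (d : 'I_r -> nat)
    (q_gt0 : forall nu, (0 < q nu)%N) (d_gt0 : forall k, (0 < d k)%N)
    (sum_q : (\sum_(nu < N.+1) q nu = Q)%N) (sum_d : (\sum_(k < r) d k = Q)%N)
    (b : complexField R)
    (b_regular : ~ [set 0; hypergeometric_lambda R q d] b) :
  (exists e : 'I_Q -> complexField R -> complexField R,
     solution_basis (hypergeometric_op q d) b e) /\
  (forall e : 'I_Q -> complexField R -> complexField R,
     solution_basis (hypergeometric_op q d) b e ->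
     exists2 P : 'M[complexField R]_Q, P \in unitmx &
       monodromy_group [set 0; hypergeometric_lambda R q d] b e =
       [set invmx P *m map_mx intr h *m P | h in hypergeometric_group q d Q]).
Proof.
case: Q sum_q sum_d => [|n'] sum_q sum_d.
  by move: sum_q; rewrite big_ord_recl; have := q_gt0 ord0; lia.
have l0 := lam_gt0 R q_gt0 d_gt0.
have size_rho : size (fracs R q 0) = n'.+1 by rewrite size_fracs.
have size_al : size (fracs R d 1) = n'.+1 by rewrite size_fracs.
have [E [A [B at_AB]]] := atlas_exists l0 (sysM n' (fracs R q 0))
  (sysD n' (fracs R q 0) (fracs R d 1)).
have L_sol := hypergeometric_op_sol_eq (R := R) q_gt0 d_gt0.
rewrite -(toC_lam R q d) in b_regular *.
have [c cb] : exists c, cdom (lam R q d) c b.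
  by apply: cdom_cover; apply/eqP => h; apply: b_regular; [left|right].
split; first exact: (solution_basis_exists l0 size_rho size_al at_AB L_sol cb).
move=> e he.
have [X uX ->] := monodromy_groupE l0 size_rho size_al at_AB L_sol b_regular he.
have [T uT [AT BT]] := atlas_companion l0 size_rho size_al
  (fracs0_range q_gt0) (fracs1_range d_gt0) at_AB.
rewrite (charpoly0_fracs _ q_gt0) -map_last_column_companion in AT.
rewrite (charpolyoo_fracs _ d_gt0) -map_last_column_companion in BT.
have [uA uB] := atlas_transition_unit l0 at_AB.
have tP := transitionP q_gt0 d_gt0 uT uA uB AT BT.
(* [X] passes from coordinates in the basis [e] to chart coordinates and [invmx T] from these to the
   cyclic basis in which [a] and [b] are companion matrices. *)
have uP : invmx T *m X \in unitmx by rewrite unitmx_mul unitmx_inv uT.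
exists (invmx T *m X); first exact: uP.
have conjE (h : 'M[complexField R]_(n'.+1)) : invmx (invmx T *m X) *m h *m (invmx T *m X) =
    invmx X *m (T *m h *m invmx T) *m X.
  have -> : invmx (invmx T *m X) = invmx X *m T.
    by rewrite -[RHS](mulKmx uP) -(mulmxA (invmx T)) mulKVmx// mulVmx// mulmx1.
  by rewrite !mulmxA.
apply/seteqP; split=> [K [g /tP[h Hh gT] XK]|_ [h Hh <-]] /=.
  exists h; first exact: Hh.
  by rewrite conjE -gT mulmxK// -mulmxA -XK mulKmx.
exists (T *m map_mx intr h *m invmx T).
  by apply/tP; exists h; [exact: Hh|rewrite mulmxKV].
by rewrite conjE -(mulmxA (invmx X)) mulKVmx.
Qed.
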